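(* Let $r\ge2$ and let $Z$ be a $C^{r+1}$ map from an open neighborhood of $0$ in $(\mathbb{R}^d)^{N+1}$ to $\mathbb{R}^d$ with $Z(0)=0$ and $B_0=\partial_0Z(0)$ invertible. Let $\boldsymbol\lambda=(\lambda_1,\ldots,\lambda_m)\in\mathbb{R}^m$ be a stable non-resonant vector of eigenvalues with real eigenvectors $v_1,\ldots,v_m$ ($T(\lambda_j)v_j=0$), linearly independent, and let $\Lambda=\mathrm{diag}(\lambda_1,\ldots,\lambda_m)$, $V=(v_1\cdots v_m)$. Assume there exists $\mu$ with $\|\Lambda\|^r\le\mu<1$ and $\sum_{i=1}^N\mu^i\|B_0^{-1}B_i\|<1$. Then there exist $\rho>0$ and a $C^r$ map $P:D_\rho\to\mathbb{R}^d$, $D_\rho=\{z\in\mathbb{R}^m:\|z\|_\infty\le\rho\}$, such that $P(0)=0$, $DP(0)=V$ (so the range of $DP(0)$ is the span of the eigenvectors $v_1,\dots,v_m$), and $$Z\big(P(z),P(\Lambda z),\ldots,P(\Lambda^Nz)\big)=0\qquad\text{for all }z\in D_\rho .$$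
   Context: $B_i=\partial_iZ(0)$ is the derivative with respect to the $i$-th block variable; $T(\lambda)=\sum_{i=0}^N\lambda^iB_i$; $\mathcal{F}(\lambda)=\det T(\lambda)$. $\boldsymbol\lambda^\alpha=\prod\lambda_i^{\alpha_i}$. A vector $\boldsymbol\lambda$ is a stable non-resonant vector of eigenvalues if $|\lambda_i|<1$, $\mathcal{F}(\lambda_i)=0$ for all $i$, and $\mathcal{F}(\boldsymbol\lambda^\alpha)\ne0$ for all $\alpha\in\mathbb{Z}_+^m$ with $|\alpha|\ge2$. Norms: sup norm $\|\cdot\|_\infty$ on $\mathbb{R}^m,\mathbb{R}^d$ and the induced operator norms on matrices. *)

(* Defs.v *)
From Stdlib Require Import Reals Lra Lia Arith.
Open Scope R_scope.

(* Vectors of R^n are represented by functions nat -> R; only the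
   coordinates 0..n-1 are meaningful.  Matrices are nat -> nat -> R. *)

Fixpoint sumR (n : nat) (f : nat -> R) : R :=
  match n with O => 0 | S n' => sumR n' f + f n' end.

Fixpoint sumN (n : nat) (f : nat -> nat) : nat :=
  match n with O => O | S n' => (sumN n' f + f n')%nat end.

Fixpoint prodR (n : nat) (f : nat -> R) : R :=
  match n with O => 1 | S n' => prodR n' f * f n' end.

Fixpoint supnorm (n : nat) (x : nat -> R) : R :=
  match n with O => 0 | S n' => Rmax (supnorm n' x) (Rabs (x n')) end.

Definition zerov : nat -> R := fun _ => 0.

Definition upd (x : nat -> R) (p : nat) (t : R) : nat -> R :=
  fun q => if Nat.eq_dec q p then t else x q.

Definition is_open (n : nat) (U : (nat -> R) -> Prop) : Prop :=
  forall x, U x -> exists delta, 0 < delta /\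
    forall y, (forall p, (p < n)%nat -> Rabs (y p - x p) < delta) -> U y.

Definition cont_at (n : nat) (f : (nat -> R) -> R) (x : nat -> R) : Prop :=
  forall eps, 0 < eps -> exists delta, 0 < delta /\
    forall y, (forall p, (p < n)%nat -> Rabs (y p - x p) < delta) ->
      Rabs (f y - f x) < eps.

Fixpoint Ck (k n : nat) (U : (nat -> R) -> Prop) (f : (nat -> R) -> R) : Prop :=
  match k with
  | O => forall x, U x -> cont_at n f x
  | S k' => (forall x, U x -> cont_at n f x) /\
      forall p, (p < n)%nat -> exists g : (nat -> R) -> R,
        (forall x, U x -> derivable_pt_lim (fun t => f (upd x p t)) (x p) (g x))
        /\ Ck k' n U g
  end.

Definition Ck_vec (k n d : nat) (U : (nat -> R) -> Prop)
  (f : (nat -> R) -> (nat -> R)) : Prop :=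
  forall i, (i < d)%nat -> Ck k n U (fun x => f x i).

(* stacking N+1 (or more) blocks of R^d into (R^d)^(N+1) = R^(d(N+1)):
   coordinate k*d+j is the j-th coordinate of the k-th block *)
Definition stack (d : nat) (xs : nat -> (nat -> R)) : nat -> R :=
  fun p => xs (p / d)%nat (p mod d)%nat.

Definition matvec (cols : nat) (A : nat -> nat -> R) (x : nat -> R) : nat -> R :=
  fun i => sumR cols (fun j => A i j * x j).

Definition matmul (n : nat) (A B : nat -> nat -> R) : nat -> nat -> R :=
  fun i k => sumR n (fun j => A i j * B j k).

Definition idm : nat -> nat -> R := fun i j => if Nat.eq_dec i j then 1 else 0.

Definition is_inverse (n : nat) (A Ainv : nat -> nat -> R) : Prop :=
  forall i j, (i < n)%nat -> (j < n)%nat ->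
    matmul n Ainv A i j = idm i j /\ matmul n A Ainv i j = idm i j.

Definition is_opnorm (n : nat) (A : nat -> nat -> R) (c : R) : Prop :=
  (forall x, supnorm n (matvec n A x) <= c * supnorm n x) /\
  (forall c', (forall x, supnorm n (matvec n A x) <= c' * supnorm n x) -> c <= c').

Definition minor (A : nat -> nat -> R) (j : nat) : nat -> nat -> R :=
  fun i k => A (S i) (if Nat.ltb k j then k else S k).

Fixpoint det (n : nat) (A : nat -> nat -> R) : R :=
  match n with
  | O => 1
  | S n' => sumR (S n') (fun j => (-1) ^ j * A 0%nat j * det n' (minor A j))
  end.

Definition Tmat (N : nat) (B : nat -> nat -> nat -> R) (l : R) : nat -> nat -> R :=
  fun a b => sumR (S N) (fun k => l ^ k * B k a b).

Definition Fdet (d N : nat) (B : nat -> nat -> nat -> R) (l : R) : R :=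
  det d (Tmat N B l).

Definition mpow (m : nat) (lam : nat -> R) (alpha : nat -> nat) : R :=
  prodR m (fun i => lam i ^ alpha i).

Definition stable_nonresonant (d N m : nat) (B : nat -> nat -> nat -> R)
  (lam : nat -> R) : Prop :=
  (forall i, (i < m)%nat -> Rabs (lam i) < 1) /\
  (forall i, (i < m)%nat -> Fdet d N B (lam i) = 0) /\
  (forall alpha : nat -> nat,
      (2 <= sumN m alpha)%nat ->
      Fdet d N B (mpow m lam alpha) <> 0).

Definition diagm (lam : nat -> R) : nat -> nat -> R :=
  fun i j => if Nat.eq_dec i j then lam i else 0.

Definition Lpow (lam : nat -> R) (k : nat) (z : nat -> R) : nat -> R :=
  fun j => lam j ^ k * z j.

(* Main.v *)
Require Import Defs.
From Stdlib Require Import Reals Lra Lia Arith FunctionalExtensionality PSeries_reg.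
From mathcomp Require ssreflect ssrfun ssrbool eqtype ssrnat fintype bigop ssralg matrix Rstruct.
Open Scope R_scope.

(** Since [B_0] is invertible, the equation for [P] is the fixed point equation
    [P(z) = F(P(z), P(Lambda z), ..., P(Lambda^N z))] with [F(X) = X_0 - B_0^-1 Z(X)].
    Non-resonance gives, degree by degree, a polynomial [P_0] of degree [r] with
    linear part [V] and residual [O(|z|^(r+1))].  Among corrections of size
    [O(|z|^(r+1))] the substitution [z -> Lambda^k z] gains the factor
    [||Lambda||^(k(r+1)) <= mu^k], so iterating [F] from [P_0] converges geometrically.

    For regularity, the pair [(P, DP)] solves a system of the same shape, in which
    the derivative is a correction of order one less.  The weights [w a] below record
    these orders: differentiation in [z_j] multiplies the coefficient of
    [P(Lambda^k z)] by [lambda_j^k], which compensates the lost order, so the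
    contraction constant is unchanged; and the coupling to components of higher
    order is negligible near [0].  Convergence in [C^0] for all graded systems
    thus gives convergence in [C^r] after differentiating [r] times. *)

(** The equation for [DP] is linear in [DP], but its coefficients depend on [P] with a Lipschitz
    constant that nothing makes small, so a plain sup norm on the pair yields no contraction. This
    is why the estimates use a matrix of Lipschitz constants, triangular with respect to the
    weights, instead of one constant. Each differentiation costs one derivative of the map and one
    unit of weight. From class C^(r+1) and weight r + 1, [r] differentiations leave a map of class
    C^1, hence locally Lipschitz, and weight at least 1, so that corrections still vanish at 0. The
    residual, too, must lose only one order per derivative; a function of given order need not have
    this property, and it is here that the smoothness of the residual enters, through an
    interpolation inequality. Convergence is proved for one explicit sequence rather than for an
    abstract fixed point, because the derivative of the n-th iterate is the n-th iterate of the
    derived system. Uniform convergence of both then makes the limit differentiable, with the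
    expected derivative. *)

(** * Finite sums and stacked indices *)

Lemma sumR_ext n f g : (forall i, (i < n)%nat -> f i = g i) -> sumR n f = sumR n g.
Proof.
  induction n as [|n IH]; intros H; simpl; [reflexivity|].
  rewrite IH by (intros; apply H; lia). rewrite H by lia. reflexivity.
Qed.

Lemma sumR_plus n f g : sumR n (fun i => f i + g i) = sumR n f + sumR n g.
Proof. induction n as [|n IH]; simpl; [lra|rewrite IH; lra]. Qed.

Lemma sumR_minus n f g : sumR n (fun i => f i - g i) = sumR n f - sumR n g.
Proof. induction n as [|n IH]; simpl; [lra|rewrite IH; lra]. Qed.

Lemma sumR_scal n c f : sumR n (fun i => c * f i) = c * sumR n f.
Proof. induction n as [|n IH]; simpl; [lra|rewrite IH; lra]. Qed.

Lemma sumR_zero n f : (forall i, (i < n)%nat -> f i = 0) -> sumR n f = 0.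
Proof.
  induction n as [|n IH]; intros H; simpl; [reflexivity|].
  rewrite IH by (intros; apply H; lia). rewrite H by lia. lra.
Qed.

Lemma sumR_const n c : sumR n (fun _ => c) = INR n * c.
Proof. induction n as [|n IH]; [simpl; lra|]. rewrite S_INR; simpl; rewrite IH; lra. Qed.

Lemma sumR_le n f g : (forall i, (i < n)%nat -> f i <= g i) -> sumR n f <= sumR n g.
Proof.
  induction n as [|n IH]; intros H; simpl; [lra|].
  apply Rplus_le_compat; [apply IH; intros; apply H; lia|apply H; lia].
Qed.

Lemma sumR_nonneg n f : (forall i, (i < n)%nat -> 0 <= f i) -> 0 <= sumR n f.
Proof.
  intros H. rewrite <- (sumR_zero n (fun _ => 0)) by reflexivity. now apply sumR_le.
Qed.

Lemma sumR_abs n f : Rabs (sumR n f) <= sumR n (fun i => Rabs (f i)).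
Proof.
  induction n as [|n IH]; simpl; [rewrite Rabs_R0; lra|].
  eapply Rle_trans; [apply Rabs_triang|lra].
Qed.

Lemma sumR_term_le n f i : (forall j, (j < n)%nat -> 0 <= f j) -> (i < n)%nat -> f i <= sumR n f.
Proof.
  induction n as [|n IH]; intros H Hi; [lia|]. simpl.
  assert (0 <= sumR n f) by (apply sumR_nonneg; intros; apply H; lia).
  assert (0 <= f n) by (apply H; lia).
  destruct (Nat.eq_dec i n) as [->|]; [lra|].
  assert (f i <= sumR n f) by (apply IH; [intros; apply H|]; lia). lra.
Qed.

Lemma sumR_single n f i : (i < n)%nat -> (forall j, (j < n)%nat -> j <> i -> f j = 0) ->
  sumR n f = f i.
Proof.
  induction n as [|n IH]; intros Hi H; [lia|]. simpl.
  destruct (Nat.eq_dec i n) as [->|].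
  - rewrite sumR_zero; [lra|intros; apply H; lia].
  - rewrite IH by (try lia; intros; apply H; lia). rewrite (H n) by lia. lra.
Qed.

Lemma sumR_swap n m f :
  sumR n (fun i => sumR m (fun j => f i j)) = sumR m (fun j => sumR n (fun i => f i j)).
Proof.
  induction n as [|n IH]; simpl.
  - symmetry; apply sumR_zero; reflexivity.
  - rewrite IH, sumR_plus. reflexivity.
Qed.

Lemma sumR_shift n f : sumR (S n) f = f O + sumR n (fun i => f (S i)).
Proof. induction n as [|n IH]; [simpl; lra|]. simpl in *. rewrite IH. lra. Qed.

Lemma sumR_add n k f : sumR (n + k) f = sumR n f + sumR k (fun i => f (n + i)%nat).
Proof.
  induction k as [|k IH]; [rewrite Nat.add_0_r; simpl; lra|].
  rewrite Nat.add_succ_r; simpl; rewrite IH; lra.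
Qed.

Lemma sumR_mul d n f :
  sumR (d * n) f = sumR n (fun k => sumR d (fun b => f (k * d + b)%nat)).
Proof.
  induction n as [|n IH]; [rewrite Nat.mul_0_r; reflexivity|].
  rewrite Nat.mul_succ_r, sumR_add, IH. simpl. f_equal.
  apply sumR_ext; intros; f_equal; lia.
Qed.

Lemma div_block k d b : (b < d)%nat -> ((k * d + b) / d = k)%nat.
Proof. intros. rewrite Nat.div_add_l by lia. rewrite Nat.div_small by lia. lia. Qed.

Lemma mod_block k d b : (b < d)%nat -> ((k * d + b) mod d = b)%nat.
Proof.
  intros. rewrite Nat.add_comm, Nat.Div0.mod_add. now apply Nat.mod_small.
Qed.

Lemma div_lt_block p d n : (p < d * n)%nat -> (p / d < n)%nat.
Proof. intros. apply Nat.Div0.div_lt_upper_bound. lia. Qed.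

Lemma mod_lt_block p d n : (p < d * n)%nat -> (p mod d < d)%nat.
Proof. intros. apply Nat.mod_upper_bound. lia. Qed.

Lemma block_lt k d b n : (k < n)%nat -> (b < d)%nat -> (k * d + b < d * n)%nat.
Proof. intros. nia. Qed.

Lemma div_mod_block p d : (p = p / d * d + p mod d)%nat.
Proof. rewrite Nat.mul_comm. apply Nat.div_mod_eq. Qed.

(** * Sup norm, boxes and balls *)

Lemma supnorm_nonneg n x : 0 <= supnorm n x.
Proof. induction n as [|n IH]; simpl; [lra|]. eapply Rle_trans; [apply IH|apply Rmax_l]. Qed.

Lemma supnorm_ge n x p : (p < n)%nat -> Rabs (x p) <= supnorm n x.
Proof.
  induction n as [|n IH]; intros Hp; [lia|]. simpl.
  destruct (Nat.eq_dec p n) as [->|]; [apply Rmax_r|].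
  eapply Rle_trans; [apply IH; lia|apply Rmax_l].
Qed.

Lemma supnorm_le n x c : 0 <= c -> (forall p, (p < n)%nat -> Rabs (x p) <= c) -> supnorm n x <= c.
Proof.
  induction n as [|n IH]; intros Hc H; simpl; [lra|].
  apply Rmax_lub; [apply IH; auto|apply H; lia].
Qed.

Lemma supnorm_lt n x c : 0 < c -> (forall p, (p < n)%nat -> Rabs (x p) < c) -> supnorm n x < c.
Proof.
  induction n as [|n IH]; intros Hc H; simpl; [lra|].
  apply Rmax_lub_lt; [apply IH; auto|apply H; lia].
Qed.

Lemma supnorm_zerov n : supnorm n zerov = 0.
Proof.
  apply Rle_antisym; [|apply supnorm_nonneg].
  apply supnorm_le; [lra|]. intros; unfold zerov; rewrite Rabs_R0; lra.
Qed.

Lemma supnorm_scal n t x : 0 <= t -> supnorm n (fun p => t * x p) = t * supnorm n x.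
Proof.
  intros Ht. induction n as [|n IH]; simpl; [lra|].
  rewrite IH, Rabs_mult, (Rabs_right t) by lra. now rewrite RmaxRmult.
Qed.

Definition box (n : nat) (c : nat -> R) (r : R) : (nat -> R) -> Prop :=
  fun x => forall p, (p < n)%nat -> Rabs (x p - c p) < r.

Definition ball0 (m : nat) (r : R) : (nat -> R) -> Prop := fun z => supnorm m z < r.

Lemma box_center n c r : 0 < r -> box n c r c.
Proof. intros Hr p Hp. replace (c p - c p) with 0 by lra. now rewrite Rabs_R0. Qed.

Lemma box_mono n c r r' x : r <= r' -> box n c r x -> box n c r' x.
Proof. intros Hr H p Hp. specialize (H p Hp). lra. Qed.

Lemma box_open n c r : is_open n (box n c r).
Proof.
  intros x Hx.
  assert (H : exists e, 0 < e /\ forall p, (p < n)%nat -> Rabs (x p - c p) + e <= r).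
  { unfold box in Hx. clear - Hx. induction n as [|n IH].
    - exists 1. split; [lra|intros; lia].
    - destruct IH as [e [He H]]; [intros; apply Hx; lia|].
      specialize (Hx n ltac:(lia)).
      exists (Rmin e (r - Rabs (x n - c n))). split.
      + apply Rmin_glb_lt; lra.
      + intros p Hp. destruct (Nat.eq_dec p n) as [->|].
        * pose proof (Rmin_r e (r - Rabs (x n - c n))). lra.
        * pose proof (Rmin_l e (r - Rabs (x n - c n))). specialize (H p ltac:(lia)). lra. }
  destruct H as [e [He H]]. exists e. split; [exact He|].
  intros y Hy p Hp. specialize (H p Hp). specialize (Hy p Hp).
  replace (y p - c p) with ((y p - x p) + (x p - c p)) by lra.
  eapply Rle_lt_trans; [apply Rabs_triang|lra].
Qed.

Lemma ball0_coord m r z p : ball0 m r z -> (p < m)%nat -> Rabs (z p) < r.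
Proof. intros H Hp. pose proof (supnorm_ge m z p Hp). unfold ball0 in H. lra. Qed.

Lemma ball0_box m r : 0 < r -> forall z, ball0 m r z <-> box m zerov r z.
Proof.
  intros Hr z. split.
  - intros H p Hp. unfold zerov. rewrite Rminus_0_r. now apply (ball0_coord m).
  - intros H. apply supnorm_lt; auto. intros p Hp. specialize (H p Hp).
    unfold zerov in H. now rewrite Rminus_0_r in H.
Qed.

Lemma ball0_open m r : is_open m (ball0 m r).
Proof.
  intros x Hx. pose proof (supnorm_nonneg m x). unfold ball0 in Hx.
  assert (Hr : 0 < r) by lra.
  destruct (box_open m zerov r x) as [e [He H']]; [now apply ball0_box|].
  exists e. split; [exact He|]. intros y Hy. apply ball0_box; auto.
Qed.

(** * Partial derivatives, mean values and the chain rule *)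

Lemma upd_same x p t : upd x p t p = t.
Proof. unfold upd. destruct (Nat.eq_dec p p); congruence. Qed.

Lemma upd_other x p t q : q <> p -> upd x p t q = x q.
Proof. unfold upd. intros. destruct (Nat.eq_dec q p); congruence. Qed.

Lemma upd_id x p : upd x p (x p) = x.
Proof.
  apply functional_extensionality; intros q. unfold upd.
  destruct (Nat.eq_dec q p); congruence.
Qed.

Lemma upd_upd x p s t : upd (upd x p s) p t = upd x p t.
Proof.
  apply functional_extensionality; intros q. unfold upd.
  destruct (Nat.eq_dec q p); congruence.
Qed.

Lemma derivable_pt_lim_ext_loc f g x l eps : 0 < eps ->
  (forall y, Rabs (y - x) < eps -> f y = g y) ->
  derivable_pt_lim f x l -> derivable_pt_lim g x l.
Proof.
  intros Heps Hfg H e He. destruct (H e He) as [delta Hd].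
  assert (Hm : 0 < Rmin delta eps) by (apply Rmin_glb_lt; [apply delta|lra]).
  exists (mkposreal _ Hm). simpl. intros h Hh Hhd.
  pose proof (Rmin_l delta eps). pose proof (Rmin_r delta eps).
  rewrite <- !Hfg.
  - apply Hd; [auto|lra].
  - replace (x - x) with 0 by lra. rewrite Rabs_R0; lra.
  - replace (x + h - x) with h by lra. lra.
Qed.

Lemma derivable_pt_lim_eq f g x l l' : (forall y, f y = g y) -> l = l' ->
  derivable_pt_lim f x l -> derivable_pt_lim g x l'.
Proof. intros Hfg <-. apply (derivable_pt_lim_ext_loc f g x l 1); auto with real. Qed.

Lemma derivable_pt_lim_cont f x l : derivable_pt_lim f x l -> continuity_pt f x.
Proof. intros H. apply derivable_continuous_pt. exists l. exact H. Qed.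

(** The reference slope [c] serves two uses: [c = 0] gives Lipschitz bounds, and a derivative at a
    fixed point gives first-order expansions. *)
Lemma mean_value_abs (f f' : R -> R) a b c M :
  (forall t, Rmin a b <= t <= Rmax a b -> derivable_pt_lim f t (f' t)) ->
  (forall t, Rmin a b <= t <= Rmax a b -> Rabs (f' t - c) <= M) ->
  Rabs (f b - f a - c * (b - a)) <= M * Rabs (b - a).
Proof.
  assert (K : forall u v, u < v ->
    (forall t, u <= t <= v -> derivable_pt_lim f t (f' t)) ->
    (forall t, u <= t <= v -> Rabs (f' t - c) <= M) ->
    Rabs (f v - f u - c * (v - u)) <= M * (v - u)).
  { intros u v Huv Hd Hb.
    destruct (MVT_cor2 f f' u v Huv Hd) as [t [Ht Htt]].
    rewrite Ht. replace (f' t * (v - u) - c * (v - u)) with ((f' t - c) * (v - u)) by ring.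
    rewrite Rabs_mult, (Rabs_right (v - u)) by lra.
    apply Rmult_le_compat_r; [lra|]. apply Hb; lra. }
  intros Hd Hb. destruct (Rtotal_order a b) as [H|[->|H]].
  - rewrite Rmin_left, Rmax_right in * by lra.
    rewrite (Rabs_right (b - a)) by lra. now apply K.
  - replace (f b - f b - c * (b - b)) with 0 by ring.
    replace (b - b) with 0 by ring. rewrite Rabs_R0. lra.
  - rewrite Rmin_right, Rmax_left in * by lra.
    rewrite (Rabs_left (b - a)) by lra.
    replace (f b - f a - c * (b - a)) with (- (f a - f b - c * (a - b))) by ring.
    rewrite Rabs_Ropp. replace (- (b - a)) with (a - b) by ring. now apply K.
Qed.

Lemma between_abs a b c t r : Rmin a b <= t <= Rmax a b ->
  Rabs (a - c) < r -> Rabs (b - c) < r -> Rabs (t - c) < r.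
Proof.
  intros Ht Ha Hb. apply Rabs_def2 in Ha. apply Rabs_def2 in Hb.
  unfold Rmin, Rmax in Ht. apply Rabs_def1; destruct (Rle_dec a b); lra.
Qed.

(** A point that shares the first [n] coordinates of [x] is within every [delta] of it. Continuity
    thus forces [f] to ignore the other coordinates, so functions on [nat -> R] behave as functions
    on R^n. *)
Lemma cont_at_local n f x y : cont_at n f x -> (forall p, (p < n)%nat -> y p = x p) -> f y = f x.
Proof.
  intros Hf Hy. apply cond_eq. intros eps He. destruct (Hf eps He) as [delta [Hd H]].
  apply H. intros p Hp. rewrite Hy by auto. replace (x p - x p) with 0 by lra. now rewrite Rabs_R0.
Qed.

Definition hybrid (k : nat) (x y : nat -> R) : nat -> R :=
  fun q => if Nat.ltb q k then y q else x q.

Lemma hybrid_0 x y : hybrid 0 x y = x.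
Proof. reflexivity. Qed.

Lemma hybrid_S k x y : hybrid (S k) x y = upd (hybrid k x y) k (y k).
Proof.
  apply functional_extensionality; intros q. unfold hybrid, upd.
  destruct (Nat.ltb_spec q (S k)), (Nat.eq_dec q k), (Nat.ltb_spec q k); subst; try lia; auto.
Qed.

Lemma hybrid_diag k x y : hybrid k x y k = x k.
Proof. unfold hybrid. now rewrite Nat.ltb_irrefl. Qed.

Definition partial_on (U : (nat -> R) -> Prop) (p : nat) (f g : (nat -> R) -> R) : Prop :=
  forall x, U x -> derivable_pt_lim (fun t => f (upd x p t)) (x p) (g x).

Lemma partial_on_line (U : (nat -> R) -> Prop) p f g x t :
  partial_on U p f g -> U (upd x p t) ->
  derivable_pt_lim (fun s => f (upd x p s)) t (g (upd x p t)).
Proof.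
  intros H HU. specialize (H _ HU). rewrite upd_same in H.
  eapply derivable_pt_lim_eq; [| reflexivity | exact H].
  intros s; simpl. now rewrite upd_upd.
Qed.

(* The increment is telescoped through the points that take their first k
   coordinates from y and the others from x, one coordinate at a time. *)
Lemma mean_value_box n x0 r f (g : nat -> (nat -> R) -> R) (c M : nat -> R) x y :
  (forall z, box n x0 r z -> cont_at n f z) ->
  (forall p, (p < n)%nat -> partial_on (box n x0 r) p f (g p)) ->
  (forall p z, (p < n)%nat -> box n x0 r z -> Rabs (g p z - c p) <= M p) ->
  box n x0 r x -> box n x0 r y ->
  Rabs (f y - f x - sumR n (fun p => c p * (y p - x p))) <= sumR n (fun p => M p * Rabs (y p - x p)).
Proof.
  intros Hc Hd Hb Hx Hy.
  (* A box is a product of intervals, so every segment of the telescoping path stays inside it. *)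
  assert (HB : forall k t, (k < n)%nat -> Rmin (x k) (y k) <= t <= Rmax (x k) (y k) ->
            box n x0 r (upd (hybrid k x y) k t)).
  { intros k t Hk Ht p Hp. destruct (Nat.eq_dec p k) as [->|Hpk].
    - rewrite upd_same. eapply between_abs; eauto.
    - rewrite upd_other by auto. unfold hybrid.
      destruct (Nat.ltb p k); auto. }
  assert (K : forall k, (k <= n)%nat ->
     Rabs (f (hybrid k x y) - f x - sumR k (fun p => c p * (y p - x p)))
       <= sumR k (fun p => M p * Rabs (y p - x p))).
  { induction k as [|k IH]; intros Hk.
    - rewrite hybrid_0. simpl. replace (f x - f x - 0) with 0 by lra. rewrite Rabs_R0; lra.
    - specialize (IH ltac:(lia)). simpl.
      pose proof (mean_value_abs (fun t => f (upd (hybrid k x y) k t))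
        (fun t => g k (upd (hybrid k x y) k t)) (x k) (y k) (c k) (M k)) as Hm.
      simpl in Hm. rewrite <- hybrid_S in Hm.
      assert (Hid : upd (hybrid k x y) k (x k) = hybrid k x y).
      { rewrite <- (hybrid_diag k x y) at 1. apply upd_id. }
      rewrite Hid in Hm.
      assert (Hm' : Rabs (f (hybrid (S k) x y) - f (hybrid k x y) - c k * (y k - x k))
                <= M k * Rabs (y k - x k)).
      { apply Hm.
        - intros t Ht. eapply partial_on_line; [apply Hd; lia|]. apply HB; [lia|auto].
        - intros t Ht. apply Hb; [lia|]. apply HB; [lia|auto]. }
      replace (f (hybrid (S k) x y) - f x -
        (sumR k (fun p => c p * (y p - x p)) + c k * (y k - x k))) with
        ((f (hybrid k x y) - f x - sumR k (fun p => c p * (y p - x p))) +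
         (f (hybrid (S k) x y) - f (hybrid k x y) - c k * (y k - x k))) by ring.
      eapply Rle_trans; [apply Rabs_triang|]. lra. }
  specialize (K n (le_n n)).
  rewrite (cont_at_local n f y (hybrid n x y)) in K; auto.
  intros p Hp. unfold hybrid. destruct (Nat.ltb_spec p n); [auto|lia].
Qed.

Lemma fin_pos n (Q : nat -> R -> Prop) :
  (forall i r r', 0 < r' <= r -> Q i r -> Q i r') ->
  (forall i, (i < n)%nat -> exists r, 0 < r /\ Q i r) ->
  exists r, 0 < r /\ forall i, (i < n)%nat -> Q i r.
Proof.
  intros Hm. induction n as [|n IH]; intros H.
  - exists 1. split; [lra|intros; lia].
  - destruct IH as [r1 [Hr1 H1]]; [intros; apply H; lia|].
    destruct (H n ltac:(lia)) as [r2 [Hr2 H2]].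
    assert (0 < Rmin r1 r2) by (apply Rmin_glb_lt; auto).
    exists (Rmin r1 r2). split; [auto|]. intros i Hi.
    destruct (Nat.eq_dec i n) as [->|].
    + apply (Hm n r2); [split; [auto|apply Rmin_r]|auto].
    + apply (Hm i r1); [split; [auto|apply Rmin_l]|apply H1; lia].
Qed.

Lemma fin_bound n (Q : nat -> R -> Prop) :
  (forall i r r', r <= r' -> Q i r -> Q i r') ->
  (forall i, (i < n)%nat -> exists r, Q i r) ->
  exists r, 0 < r /\ forall i, (i < n)%nat -> Q i r.
Proof.
  intros Hm. induction n as [|n IH]; intros H.
  - exists 1. split; [lra|intros; lia].
  - destruct IH as [r1 [Hr1 H1]]; [intros; apply H; lia|].
    destruct (H n ltac:(lia)) as [r2 H2].
    exists (Rmax r1 r2). pose proof (Rmax_l r1 r2). split; [lra|]. intros i Hi.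
    destruct (Nat.eq_dec i n) as [->|].
    + apply (Hm n r2); [apply Rmax_r|auto].
    + apply (Hm i r1); [apply Rmax_l|apply H1; lia].
Qed.

Lemma fin_choice {T : Type} (t0 : T) n (Q : nat -> T -> Prop) :
  (forall i, (i < n)%nat -> exists x, Q i x) ->
  exists f : nat -> T, forall i, (i < n)%nat -> Q i (f i).
Proof.
  induction n as [|n IH]; intros H.
  - exists (fun _ => t0). intros; lia.
  - destruct IH as [f Hf]; [intros; apply H; lia|].
    destruct (H n ltac:(lia)) as [x Hx].
    exists (fun i => if Nat.eq_dec i n then x else f i). intros i Hi.
    destruct (Nat.eq_dec i n) as [->|]; [auto|apply Hf; lia].
Qed.

Lemma is_open_sub_box n U x : is_open n U -> U x -> exists r, 0 < r /\ forall y, box n x r y -> U y.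
Proof. intros HU Hx. destruct (HU x Hx) as [r [Hr H]]. exists r. split; auto. Qed.

Definition C1_on (n : nat) (U : (nat -> R) -> Prop) (f : (nat -> R) -> R)
  (g : nat -> (nat -> R) -> R) : Prop :=
  (forall x, U x -> cont_at n f x) /\
  forall p, (p < n)%nat -> partial_on U p f (g p) /\ forall x, U x -> cont_at n (g p) x.

(** Apply [mean_value_box] with reference slopes [g p x]: by continuity the partials deviate from
    them by at most [eps] on a small box. *)
Lemma frechet n U f g x : is_open n U -> U x -> C1_on n U f g ->
  forall eps, 0 < eps -> exists r, 0 < r /\ forall y, box n x r y ->
    U y /\
    Rabs (f y - f x - sumR n (fun p => g p x * (y p - x p))) <= eps * sumR n (fun p => Rabs (y p - x p)).
Proof.
  intros HU Hx [Hc Hd] eps He.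
  destruct (is_open_sub_box n U x HU Hx) as [r0 [Hr0 HU0]].
  destruct (fin_pos n (fun p r => forall y, box n x r y -> Rabs (g p y - g p x) < eps))
    as [r1 [Hr1 H1]].
  - intros i r r' Hr H y Hy. apply H. eapply box_mono; [|exact Hy]; lra.
  - intros i Hi. destruct (Hd i Hi) as [_ Hg]. destruct (Hg x Hx eps He) as [dl [Hdl H]].
    exists dl. split; auto.
  - exists (Rmin r0 r1). assert (Hm : 0 < Rmin r0 r1) by (apply Rmin_glb_lt; auto).
    pose proof (Rmin_l r0 r1). pose proof (Rmin_r r0 r1).
    split; [auto|]. intros y Hy. split.
    + apply HU0. eapply box_mono; [|exact Hy]; lra.
    + rewrite <- sumR_scal.
      apply (mean_value_box n x (Rmin r0 r1) f g (fun p => g p x) (fun _ => eps)); auto.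
      * intros z Hz. apply Hc, HU0. eapply box_mono; [|exact Hz]; lra.
      * intros p Hp z Hz. apply Hd; auto. apply HU0. eapply box_mono; [|exact Hz]; lra.
      * intros p z Hp Hz. left. apply H1; auto. eapply box_mono; [|exact Hz]; lra.
      * now apply box_center.
Qed.

Lemma derivable_pt_lim_sumR n (f : nat -> R -> R) (l : nat -> R) t :
  (forall i, (i < n)%nat -> derivable_pt_lim (f i) t (l i)) ->
  derivable_pt_lim (fun s => sumR n (fun i => f i s)) t (sumR n l).
Proof.
  induction n as [|n IH]; intros H; simpl.
  - apply derivable_pt_lim_const.
  - apply (derivable_pt_lim_plus (fun s => sumR n (fun i => f i s)) (f n));
      [apply IH; intros; apply H; lia|apply H; lia].
Qed.

Lemma chain_rule n U f g (gam : R -> nat -> R) (gam' : nat -> R) t0 :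
  is_open n U -> U (gam t0) -> C1_on n U f g ->
  (forall p, (p < n)%nat -> derivable_pt_lim (fun t => gam t p) t0 (gam' p)) ->
  derivable_pt_lim (fun t => f (gam t)) t0 (sumR n (fun p => g p (gam t0) * gam' p)).
Proof.
  intros HU Hx HC Hg eps He.
  set (x := gam t0) in *.
  (* [S0] bounds the increment of the curve relative to [h], its summand 1 allowing for a quotient
     error [e2 <= 1]; [S1] is the size of the gradient. The tolerances [e1] and [e2] give each of
     the two errors at most [eps / 3], and the remaining third makes the inequality strict. *)
  set (S0 := sumR n (fun p => Rabs (gam' p) + 1)).
  assert (HS0 : 0 <= S0).
  { apply sumR_nonneg; intros. pose proof (Rabs_pos (gam' i)). lra. }
  set (S1 := sumR n (fun p => Rabs (g p x))).
  assert (HS1 : 0 <= S1) by (apply sumR_nonneg; intros; apply Rabs_pos).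
  set (e1 := eps / 3 / (S0 + 1)).
  assert (He1 : 0 < e1) by (unfold e1; repeat apply Rdiv_lt_0_compat; lra).
  destruct (frechet n U f g x HU Hx HC e1 He1) as [r [Hr HF]].
  set (e2 := Rmin 1 (eps / 3 / (S1 + 1))).
  assert (He2 : 0 < e2).
  { apply Rmin_glb_lt; [lra|]. repeat apply Rdiv_lt_0_compat; lra. }
  destruct (fin_pos n (fun p d => forall h, Rabs h < d -> Rabs (gam (t0 + h) p - x p) < r))
    as [d1 [Hd1 H1]].
  { intros i d d' Hd H h Hh. apply H. lra. }
  { intros i Hi. pose proof (derivable_pt_lim_cont _ _ _ (Hg i Hi)) as Hc.
    destruct (Hc r Hr) as [al [Hal HH]]. exists al. split; [exact Hal|].
    intros h Hh. destruct (Req_dec h 0) as [->|Hn].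
    - rewrite Rplus_0_r. fold x. replace (x i - x i) with 0 by lra. rewrite Rabs_R0; lra.
    - unfold x. apply (HH (t0 + h)). split.
      + split; [exact I|]. lra.
      + simpl. unfold R_dist. replace (t0 + h - t0) with h by lra. auto. }
  destruct (fin_pos n (fun p d => forall h, h <> 0 -> Rabs h < d ->
     Rabs ((gam (t0 + h) p - x p) / h - gam' p) < e2)) as [d2 [Hd2 H2]].
  { intros i d d' Hd H h Hn Hh. apply H; [auto|lra]. }
  { intros i Hi. destruct (Hg i Hi e2 He2) as [dl Hdl]. exists dl.
    split; [apply cond_pos|]. intros h Hn Hh. unfold x. now apply Hdl. }
  assert (Hm : 0 < Rmin d1 d2) by (apply Rmin_glb_lt; auto).
  exists (mkposreal _ Hm). simpl. intros h Hn Hh.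
  pose proof (Rmin_l d1 d2). pose proof (Rmin_r d1 d2).
  fold x.
  assert (Hbx : box n x r (gam (t0 + h))).
  { intros p Hp. apply H1; [auto|lra]. }
  destruct (HF _ Hbx) as [_ HFy].
  set (y := gam (t0 + h)) in *.
  assert (Hq : forall p, (p < n)%nat -> Rabs (y p - x p - gam' p * h) <= e2 * Rabs h).
  { intros p Hp. specialize (H2 p Hp h Hn ltac:(lra)). fold y in H2.
    replace (y p - x p - gam' p * h) with (((y p - x p) / h - gam' p) * h) by (field; auto).
    rewrite Rabs_mult. apply Rmult_le_compat_r; [apply Rabs_pos|lra]. }
  assert (Hsum : sumR n (fun p => Rabs (y p - x p)) <= S0 * Rabs h).
  { unfold S0. rewrite Rmult_comm, <- sumR_scal. apply sumR_le. intros p Hp.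
    specialize (Hq p Hp).
    replace (y p - x p) with ((y p - x p - gam' p * h) + gam' p * h) by ring.
    eapply Rle_trans; [apply Rabs_triang|]. rewrite (Rabs_mult (gam' p)).
    assert (e2 <= 1) by apply Rmin_l. pose proof (Rabs_pos h). nra. }
  assert (Hlin : Rabs (sumR n (fun p => g p x * (y p - x p)) - sumR n (fun p => g p x * gam' p) * h)
                 <= S1 * e2 * Rabs h).
  { rewrite (Rmult_comm _ h), <- sumR_scal, <- sumR_minus.
    eapply Rle_trans; [apply sumR_abs|].
    unfold S1. rewrite Rmult_assoc, (Rmult_comm _ (e2 * Rabs h)), <- sumR_scal.
    apply sumR_le. intros p Hp.
    replace (g p x * (y p - x p) - h * (g p x * gam' p)) with (g p x * (y p - x p - gam' p * h)) by ring.
    rewrite Rabs_mult, (Rmult_comm (e2 * _)). apply Rmult_le_compat_l; [apply Rabs_pos|].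
    now apply Hq. }
  assert (Hh0 : 0 < Rabs h) by now apply Rabs_pos_lt.
  replace ((f y - f x) / h - sumR n (fun p => g p x * gam' p)) with
    ((f y - f x - sumR n (fun p => g p x * gam' p) * h) / h) by (field; auto).
  unfold Rdiv. rewrite Rabs_mult, Rabs_inv.
  apply Rmult_lt_reg_r with (Rabs h); [auto|].
  rewrite Rmult_assoc, Rinv_l, Rmult_1_r by lra.
  replace (f y - f x - sumR n (fun p => g p x * gam' p) * h) with
    ((f y - f x - sumR n (fun p => g p x * (y p - x p))) +
     (sumR n (fun p => g p x * (y p - x p)) - sumR n (fun p => g p x * gam' p) * h)) by ring.
  eapply Rle_lt_trans; [apply Rabs_triang|].
  assert (Ha : e1 * S0 <= eps / 3).
  { unfold e1. apply Rle_trans with (eps / 3 / (S0 + 1) * (S0 + 1)).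
    - apply Rmult_le_compat_l; [|lra]. left; exact He1.
    - right. field. lra. }
  assert (Hb : S1 * e2 <= eps / 3).
  { apply Rle_trans with ((S1 + 1) * (eps / 3 / (S1 + 1))).
    - apply Rmult_le_compat; try lra. unfold e2; apply Rmin_r.
    - right. field. lra. }
  nra.
Qed.

(** * Functions of class C^k *)

Lemma Ck_cont k n U f x : Ck k n U f -> U x -> cont_at n f x.
Proof. destruct k; simpl; [auto|intros [H _]; auto]. Qed.

Lemma Ck_pred k : forall n U f, Ck (S k) n U f -> Ck k n U f.
Proof.
  induction k as [|k IH]; intros n U f H.
  - exact (proj1 H).
  - destruct H as [Hc Hd]. split; [exact Hc|]. intros p Hp.
    destruct (Hd p Hp) as [g [Hg HC]]. exists g. split; [exact Hg|]. now apply IH.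
Qed.

Lemma Ck_le k j n U f : (j <= k)%nat -> Ck k n U f -> Ck j n U f.
Proof. induction 1 as [|k H IH]; [auto|]. intros HC. apply IH. now apply Ck_pred. Qed.

Lemma Ck_sub k n (U U' : (nat -> R) -> Prop) : (forall x, U' x -> U x) ->
  forall f, Ck k n U f -> Ck k n U' f.
Proof.
  intros HU. induction k as [|k IH]; intros f H; simpl in *.
  - intros x Hx. apply H; auto.
  - destruct H as [Hc Hd]. split; [auto|]. intros p Hp.
    destruct (Hd p Hp) as [g [Hg HC]]. exists g. split; auto.
Qed.

Lemma Ck_partial k n U f : Ck (S k) n U f ->
  exists g, C1_on n U f g /\ forall p, (p < n)%nat -> Ck k n U (g p).
Proof.
  intros [Hc Hd].
  destruct (fin_choice f n (fun p g => partial_on U p f g /\ Ck k n U g)) as [g Hg].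
  { intros p Hp. destruct (Hd p Hp) as [g [H1 H2]]. exists g. split; auto. }
  exists g. split.
  - split; [exact Hc|]. intros p Hp. destruct (Hg p Hp) as [H1 H2]. split; [exact H1|].
    intros x Hx. eapply Ck_cont; eauto.
  - intros p Hp. apply Hg; auto.
Qed.

Lemma Ck_of_partial k n U f g : (forall x, U x -> cont_at n f x) ->
  (forall p, (p < n)%nat -> partial_on U p f (g p) /\ Ck k n U (g p)) -> Ck (S k) n U f.
Proof. intros Hc H. split; [exact Hc|]. intros p Hp. exists (g p). apply H; auto. Qed.

Lemma open_upd n U x p : is_open n U -> U x ->
  exists e, 0 < e /\ forall t, Rabs (t - x p) < e -> U (upd x p t).
Proof.
  intros HU Hx. destruct (HU x Hx) as [e [He H]]. exists e. split; [auto|].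
  intros t Ht. apply H. intros q Hq. unfold upd. destruct (Nat.eq_dec q p) as [->|]; [auto|].
  replace (x q - x q) with 0 by lra. now rewrite Rabs_R0.
Qed.

Lemma partial_on_ext n U p f f' g : is_open n U -> (forall x, U x -> f x = f' x) ->
  partial_on U p f g -> partial_on U p f' g.
Proof.
  intros HU Hf H x Hx. destruct (open_upd n U x p HU Hx) as [e [He Hu]].
  eapply derivable_pt_lim_ext_loc; [exact He| |apply H, Hx].
  intros t Ht; simpl. apply Hf. now apply Hu.
Qed.

Lemma cont_at_const n c x : cont_at n (fun _ => c) x.
Proof.
  intros eps He. exists 1. split; [lra|]. intros. replace (c - c) with 0 by lra. now rewrite Rabs_R0.
Qed.

Lemma cont_at_coord n p x : (p < n)%nat -> cont_at n (fun z => z p) x.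
Proof. intros Hp eps He. exists eps. split; auto. Qed.

Lemma cont_at_comp n m f (G : (nat -> R) -> (nat -> R)) z :
  cont_at n f (G z) -> (forall p, (p < n)%nat -> cont_at m (fun z => G z p) z) ->
  cont_at m (fun z => f (G z)) z.
Proof.
  intros Hf HG eps He. destruct (Hf eps He) as [d [Hd H]].
  destruct (fin_pos n (fun p r => forall y, box m z r y -> Rabs (G y p - G z p) < d)) as [r [Hr H1]].
  - intros i r r' Hr H2 y Hy. apply H2. eapply box_mono; [|exact Hy]; lra.
  - intros p Hp. destruct (HG p Hp d Hd) as [r [Hr HH]]. exists r. split; auto.
  - exists r. split; [auto|]. intros y Hy. apply H. intros p Hp. apply H1; auto.
Qed.

Lemma cont_at_plus n f g x : cont_at n f x -> cont_at n g x -> cont_at n (fun z => f z + g z) x.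
Proof.
  intros Hf Hg eps He. destruct (Hf (eps / 2) ltac:(lra)) as [d1 [Hd1 H1]].
  destruct (Hg (eps / 2) ltac:(lra)) as [d2 [Hd2 H2]]. exists (Rmin d1 d2).
  pose proof (Rmin_l d1 d2). pose proof (Rmin_r d1 d2).
  split; [apply Rmin_glb_lt; auto|]. intros y Hy.
  replace (f y + g y - (f x + g x)) with ((f y - f x) + (g y - g x)) by ring.
  eapply Rle_lt_trans; [apply Rabs_triang|].
  specialize (H1 y). specialize (H2 y).
  assert (Rabs (f y - f x) < eps / 2) by (apply H1; intros p Hp; specialize (Hy p Hp); lra).
  assert (Rabs (g y - g x) < eps / 2) by (apply H2; intros p Hp; specialize (Hy p Hp); lra).
  lra.
Qed.

Lemma cont_at_mult n f g x : cont_at n f x -> cont_at n g x -> cont_at n (fun z => f z * g z) x.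
Proof.
  intros Hf Hg eps He.
  set (A := Rabs (f x) + 1). set (B := Rabs (g x) + 1).
  assert (HA : 1 <= A) by (pose proof (Rabs_pos (f x)); unfold A; lra).
  assert (HB : 1 <= B) by (pose proof (Rabs_pos (g x)); unfold B; lra).
  assert (H0 : 0 < Rmin 1 (eps / 2 / B)).
  { apply Rmin_glb_lt; [lra|]. repeat apply Rdiv_lt_0_compat; lra. }
  assert (H0' : 0 < eps / 2 / A) by (repeat apply Rdiv_lt_0_compat; lra).
  destruct (Hf _ H0) as [d1 [Hd1 H1]].
  destruct (Hg _ H0') as [d2 [Hd2 H2]]. exists (Rmin d1 d2).
  pose proof (Rmin_l d1 d2). pose proof (Rmin_r d1 d2).
  split; [apply Rmin_glb_lt; auto|]. intros y Hy.
  specialize (H1 y ltac:(intros p Hp; specialize (Hy p Hp); lra)).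
  specialize (H2 y ltac:(intros p Hp; specialize (Hy p Hp); lra)).
  pose proof (Rmin_l 1 (eps / 2 / B)). pose proof (Rmin_r 1 (eps / 2 / B)).
  replace (f y * g y - f x * g x) with (f y * (g y - g x) + (f y - f x) * g x) by ring.
  eapply Rle_lt_trans; [apply Rabs_triang|]. rewrite !Rabs_mult.
  assert (Rabs (f y) <= A).
  { unfold A. replace (f y) with ((f y - f x) + f x) by ring.
    eapply Rle_trans; [apply Rabs_triang|]. lra. }
  assert (E1 : Rabs (f y) * Rabs (g y - g x) <= A * Rabs (g y - g x)).
  { apply Rmult_le_compat_r; [apply Rabs_pos|auto]. }
  assert (E2 : A * Rabs (g y - g x) < eps / 2).
  { apply Rlt_le_trans with (A * (eps / 2 / A)).
    - apply Rmult_lt_compat_l; lra.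
    - right; field; lra. }
  assert (E3 : Rabs (f y - f x) * Rabs (g x) <= eps / 2).
  { apply Rle_trans with (eps / 2 / B * B).
    - apply Rmult_le_compat; try apply Rabs_pos; unfold B in *; lra.
    - right; field; lra. }
  lra.
Qed.

Lemma Ck_const k n U c : Ck k n U (fun _ => c).
Proof.
  revert c. induction k as [|k IH]; intros c; simpl.
  - intros; apply cont_at_const.
  - split; [intros; apply cont_at_const|]. intros p Hp. exists (fun _ => 0). split; [|apply IH].
    intros; apply derivable_pt_lim_const.
Qed.

Lemma Ck_coord k n U p : (p < n)%nat -> Ck k n U (fun z => z p).
Proof.
  intros Hp. destruct k as [|k]; simpl.
  - intros; now apply cont_at_coord.
  - split; [intros; now apply cont_at_coord|]. intros q Hq.
    exists (fun _ => if Nat.eq_dec p q then 1 else 0). split; [|apply Ck_const].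
    intros x _. destruct (Nat.eq_dec p q) as [->|Hn].
    + apply (derivable_pt_lim_eq id _ (x q) 1); [intros; now rewrite upd_same|auto|].
      apply derivable_pt_lim_id.
    + apply (derivable_pt_lim_eq (fun _ => x p) _ (x q) 0); auto.
      * intros; now rewrite upd_other.
      * apply derivable_pt_lim_const.
Qed.

Lemma Ck_plus k n U : forall f g, Ck k n U f -> Ck k n U g -> Ck k n U (fun z => f z + g z).
Proof.
  induction k as [|k IH]; intros f g Hf Hg; simpl in *.
  - intros; apply cont_at_plus; auto.
  - destruct Hf as [Hf Hf'], Hg as [Hg Hg']. split; [intros; apply cont_at_plus; auto|].
    intros p Hp. destruct (Hf' p Hp) as [f1 [Hf1 Cf1]]. destruct (Hg' p Hp) as [g1 [Hg1 Cg1]].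
    exists (fun z => f1 z + g1 z). split; [|auto]. intros x Hx.
    apply (derivable_pt_lim_plus (fun t => f (upd x p t)) (fun t => g (upd x p t))); auto.
Qed.

Lemma Ck_mult k n U : forall f g, Ck k n U f -> Ck k n U g -> Ck k n U (fun z => f z * g z).
Proof.
  induction k as [|k IH]; intros f g Hf Hg.
  - simpl in *; intros; apply cont_at_mult; auto.
  - assert (Hfk := Ck_pred _ _ _ _ Hf). assert (Hgk := Ck_pred _ _ _ _ Hg).
    destruct Hf as [Hf Hf'], Hg as [Hg Hg']. split; [intros; apply cont_at_mult; auto|].
    intros p Hp. destruct (Hf' p Hp) as [f1 [Hf1 Cf1]]. destruct (Hg' p Hp) as [g1 [Hg1 Cg1]].
    exists (fun z => f1 z * g z + f z * g1 z). split.
    + intros x Hx.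
      pose proof (derivable_pt_lim_mult (fun t => f (upd x p t)) (fun t => g (upd x p t))
        _ _ _ (Hf1 x Hx) (Hg1 x Hx)) as H. simpl in H. rewrite !upd_id in H. exact H.
    + apply Ck_plus; auto.
Qed.

Lemma Ck_scal k n U c f : Ck k n U f -> Ck k n U (fun z => c * f z).
Proof. intros. apply Ck_mult; [apply Ck_const|auto]. Qed.

Lemma Ck_minus k n U f g : Ck k n U f -> Ck k n U g -> Ck k n U (fun z => f z - g z).
Proof.
  intros Hf Hg. replace (fun z => f z - g z) with (fun z => f z + (-1) * g z).
  - apply Ck_plus; [auto|]. now apply Ck_scal.
  - apply functional_extensionality; intros; ring.
Qed.

Lemma Ck_sumR k n U l (f : nat -> (nat -> R) -> R) :
  (forall i, (i < l)%nat -> Ck k n U (f i)) -> Ck k n U (fun z => sumR l (fun i => f i z)).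
Proof.
  induction l as [|l IH]; intros H; simpl.
  - apply Ck_const.
  - apply Ck_plus; [apply IH; intros; apply H; lia|apply H; lia].
Qed.

Lemma partial_on_comp n m U W f g (G : (nat -> R) -> (nat -> R)) (dG : nat -> (nat -> R) -> R) j :
  is_open n U -> (forall z, W z -> U (G z)) -> C1_on n U f g ->
  (forall p, (p < n)%nat -> partial_on W j (fun z => G z p) (dG p)) -> (j < m)%nat ->
  partial_on W j (fun z => f (G z)) (fun z => sumR n (fun p => g p (G z) * dG p z)).
Proof.
  intros HU HG Hf HdG Hj z Hz.
  pose proof (chain_rule n U f g (fun t => G (upd z j t)) (fun p => dG p z) (z j)) as H.
  simpl in H. rewrite upd_id in H. apply H; auto.
  intros p Hp. apply HdG; auto.
Qed.

Lemma Ck_comp k n m U W : is_open n U -> forall f (G : (nat -> R) -> (nat -> R)),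
  (forall z, W z -> U (G z)) -> Ck k n U f ->
  (forall p, (p < n)%nat -> Ck k m W (fun z => G z p)) ->
  Ck k m W (fun z => f (G z)).
Proof.
  intros HU. induction k as [|k IH]; intros f G HG Hf HGC.
  - intros z Hz. apply (cont_at_comp n m); [now apply Hf, HG|]. intros p Hp. now apply (HGC p Hp).
  - destruct (Ck_partial _ _ _ _ Hf) as [g [Hg Cg]].
    destruct (fin_choice (fun _ _ => 0) n (fun p (dG : nat -> (nat -> R) -> R) =>
       C1_on m W (fun z => G z p) dG /\ forall j, (j < m)%nat -> Ck k m W (dG j))) as [dG HdG].
    { intros p Hp. now apply Ck_partial, HGC. }
    split.
    + intros z Hz. apply (cont_at_comp n m); [apply (Ck_cont (S k) n U); auto|].
      intros p Hp. now apply (HGC p Hp).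
    + intros j Hj. exists (fun z => sumR n (fun p => g p (G z) * dG p j z)). split.
      * apply (partial_on_comp n m U W f g G (fun p => dG p j) j); auto.
        intros p Hp. apply (HdG p Hp); auto.
      * apply Ck_sumR. intros p Hp. apply Ck_mult.
        -- apply IH; auto. intros q Hq. apply Ck_pred. auto.
        -- now apply HdG.
Qed.

(** * The diagonal contraction and stacked orbits *)

Definition Lstack (D : nat) (lam : nat -> R) (P : (nat -> R) -> nat -> R) (z : nat -> R) : nat -> R :=
  stack D (fun k => P (Lpow lam k z)).

Lemma Lpow_0 lam z : Lpow lam 0 z = z.
Proof. apply functional_extensionality; intros j. unfold Lpow. simpl. ring. Qed.

Lemma Lpow_zerov lam k : Lpow lam k zerov = zerov.
Proof. apply functional_extensionality; intros j. unfold Lpow, zerov. ring. Qed.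

Lemma Lpow_upd lam k z j t : Lpow lam k (upd z j t) = upd (Lpow lam k z) j (lam j ^ k * t).
Proof.
  apply functional_extensionality; intros q. unfold Lpow, upd.
  destruct (Nat.eq_dec q j) as [->|]; auto.
Qed.

Lemma pow_abs_le1 x l k : Rabs x <= l -> l <= 1 -> Rabs (x ^ k) <= l ^ k.
Proof. intros. rewrite <- RPow_abs. apply pow_incr. split; [apply Rabs_pos|auto]. Qed.

Lemma pow_le_one l k : 0 <= l <= 1 -> 0 <= l ^ k <= 1.
Proof.
  intros [H0 H1]. split; [now apply pow_le|]. rewrite <- (pow1 k). apply pow_incr; auto.
Qed.

Section Contr.
Variables (m : nat) (lam : nat -> R) (l : R).
Hypothesis Hlam : forall j, (j < m)%nat -> Rabs (lam j) <= l.
Hypothesis Hl : 0 <= l <= 1.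

Lemma Lpow_norm k z : supnorm m (Lpow lam k z) <= l ^ k * supnorm m z.
Proof.
  pose proof (supnorm_nonneg m z). pose proof (pow_le_one l k Hl).
  apply supnorm_le; [nra|]. intros p Hp. unfold Lpow. rewrite Rabs_mult.
  apply Rmult_le_compat; try apply Rabs_pos; [apply pow_abs_le1; [auto|lra]|now apply supnorm_ge].
Qed.

Lemma Lpow_norm_le k z : supnorm m (Lpow lam k z) <= supnorm m z.
Proof.
  pose proof (Lpow_norm k z). pose proof (supnorm_nonneg m z). pose proof (pow_le_one l k Hl). nra.
Qed.

Lemma Lpow_ball k z r : ball0 m r z -> ball0 m r (Lpow lam k z).
Proof. unfold ball0. pose proof (Lpow_norm_le k z). lra. Qed.

(** [Lambda] is diagonal, so moving [z j] moves only coordinate [j] of [Lambda^k z]. Derivatives in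
    different directions therefore do not mix, and the factor is the scalar [lam j ^ k]. *)
Lemma partial_on_Lpow r f g k j : partial_on (ball0 m r) j f g ->
  partial_on (ball0 m r) j (fun z => f (Lpow lam k z)) (fun z => lam j ^ k * g (Lpow lam k z)).
Proof.
  intros H z Hz. specialize (H _ (Lpow_ball k z r Hz)).
  pose proof (derivable_pt_lim_comp (fun t => lam j ^ k * t)
    (fun t => f (upd (Lpow lam k z) j t)) (z j) (lam j ^ k) (g (Lpow lam k z))) as Hc.
  eapply derivable_pt_lim_eq; [| |apply Hc].
  - intros t. unfold comp. now rewrite Lpow_upd.
  - ring.
  - pose proof (derivable_pt_lim_scal id (lam j ^ k) (z j) 1 (derivable_pt_lim_id _)) as Hs.
    rewrite Rmult_1_r in Hs. exact Hs.
  - exact H.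
Qed.

Lemma Ck_Lpow s r f k : Ck s m (ball0 m r) f -> Ck s m (ball0 m r) (fun z => f (Lpow lam k z)).
Proof.
  intros H. apply (Ck_comp s m m (ball0 m r) (ball0 m r)); auto.
  - apply ball0_open.
  - intros; now apply Lpow_ball.
  - intros p Hp. unfold Lpow. apply Ck_scal. now apply Ck_coord.
Qed.

Lemma Ck_Lstack s r D N P : (forall a, (a < D)%nat -> Ck s m (ball0 m r) (fun z => P z a)) ->
  forall p, (p < D * S N)%nat -> Ck s m (ball0 m r) (fun z => Lstack D lam P z p).
Proof.
  intros H p Hp. unfold Lstack, stack.
  apply (Ck_Lpow s r (fun z => P z (p mod D)%nat)). apply H. eapply mod_lt_block; eauto.
Qed.
End Contr.

(** * Order of vanishing and Taylor expansion *)

(** Encodes a bound on the n-th derivative and leaves the intermediate derivatives anonymous, so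
    that combinations of dilates of [g] need no bookkeeping of them. *)
Fixpoint chain (n : nat) (g : R -> R) (L M : R) : Prop :=
  match n with
  | O => forall t, 0 <= t <= L -> Rabs (g t) <= M
  | S n' => exists g', (forall t, 0 <= t <= L -> derivable_pt_lim g t (g' t)) /\ chain n' g' L M
  end.

Lemma derivable_pt_lim_dilate g g' a t : derivable_pt_lim g (a * t) g' ->
  derivable_pt_lim (fun s => g (a * s)) t (a * g').
Proof.
  intros H.
  pose proof (derivable_pt_lim_scal id a t 1 (derivable_pt_lim_id t)) as Hs.
  rewrite Rmult_1_r in Hs.
  pose proof (derivable_pt_lim_comp _ g t a g' Hs H) as Hc.
  rewrite Rmult_comm. exact Hc.
Qed.

Lemma derivable_pt_lim_dilate_diff g g' al be t :
  derivable_pt_lim g t (g' t) -> derivable_pt_lim g (2 * t) (g' (2 * t)) ->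
  derivable_pt_lim (fun s => al * g (2 * s) - be * g s) t (2 * al * g' (2 * t) - be * g' t).
Proof.
  intros H1 H2.
  pose proof (derivable_pt_lim_scal _ al _ _ (derivable_pt_lim_dilate _ _ _ _ H2)) as A.
  pose proof (derivable_pt_lim_scal _ be _ _ H1) as B.
  replace (2 * al * g' (2 * t)) with (al * (2 * g' (2 * t))) by ring.
  exact (derivable_pt_lim_minus _ _ _ _ _ A B).
Qed.

Lemma increment_bound g g' a b c M : a <= b ->
  (forall t, a <= t <= b -> derivable_pt_lim g t (g' t)) ->
  (forall t, a <= t <= b -> Rabs (g' t - c) <= M) ->
  Rabs (g b - g a - c * (b - a)) <= M * (b - a).
Proof.
  intros Hab Hd Hb.
  pose proof (mean_value_abs g g' a b c M) as H.
  rewrite Rmin_left, Rmax_right, (Rabs_right (b - a)) in H by lra. auto.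
Qed.

Lemma increment_bound0 g g' a b M : a <= b ->
  (forall t, a <= t <= b -> derivable_pt_lim g t (g' t)) ->
  (forall t, a <= t <= b -> Rabs (g' t) <= M) ->
  Rabs (g b - g a) <= M * (b - a).
Proof.
  intros Hab Hd Hb. pose proof (increment_bound g g' a b 0 M Hab Hd) as H.
  replace (g b - g a - 0 * (b - a)) with (g b - g a) in H by ring. apply H.
  intros t Ht. rewrite Rminus_0_r. auto.
Qed.

(** After [k] derivatives the combination becomes [be] times the difference of the k-th derivatives
    at [2 * t] and [t], because each derivative of the dilate contributes a factor 2 and
    [al * 2 ^ k = be]. The mean value theorem turns this difference into a bound by one more
    derivative times the length. *)
Lemma chain_dilate_diff k : forall g L M al be, 0 <= L -> al * 2 ^ k = be ->
  chain (S k) g L M ->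
  chain k (fun t => al * g (2 * t) - be * g t) (L / 2) (Rabs be * M * (L / 2)).
Proof.
  induction k as [|k IH]; intros g L M al be HL Hab [g' [Hd Hch]].
  - simpl in *. intros t Ht. rewrite Rmult_1_r in Hab. subst be.
    replace (al * g (2 * t) - al * g t) with (al * (g (2 * t) - g t)) by ring.
    rewrite Rabs_mult, Rmult_assoc. apply Rmult_le_compat_l; [apply Rabs_pos|].
    assert (H : Rabs (g (2 * t) - g t) <= M * (2 * t - t)).
    { apply (increment_bound0 g g'); [lra| |]; intros s Hs; [apply Hd|apply Hch]; lra. }
    assert (0 <= M) by (eapply Rle_trans; [apply Rabs_pos|apply (Hch 0); lra]). nra.
  - exists (fun t => 2 * al * g' (2 * t) - be * g' t). split.
    + intros t Ht. apply derivable_pt_lim_dilate_diff; apply Hd; lra.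
    + apply IH; auto. simpl in Hab. lra.
Qed.

(* The combination g(2t) - 2^n g(t) cancels the degree n term of the Taylor
   polynomial, so induction on n isolates the linear term. *)
Lemma derivative_interpolation n : exists C, 0 <= C /\ forall g g1 L A M, 0 < L ->
  (forall t, 0 <= t <= L -> derivable_pt_lim g t (g1 t)) ->
  chain (S n) g1 L M -> (forall t, 0 <= t <= L -> Rabs (g t) <= A) ->
  Rabs (g1 0) * L <= C * (A + M * L ^ (S (S n))).
Proof.
  induction n as [|n [C [HC IH]]].
  - exists 2. split; [lra|]. intros g g1 L A M HL Hd [g2 [Hd2 Hb2]] HA. simpl in Hb2.
    assert (HM : 0 <= M) by (eapply Rle_trans; [apply Rabs_pos|apply (Hb2 0); lra]).
    assert (H : Rabs (g L - g 0 - g1 0 * (L - 0)) <= M * L * (L - 0)).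
    { apply (increment_bound g g1); [lra|auto|]. intros t Ht.
      assert (Rabs (g1 t - g1 0) <= M * (t - 0)).
      { apply (increment_bound0 g1 g2); [lra| |]; intros s Hs; [apply Hd2|apply Hb2]; lra. }
      nra. }
    pose proof (HA 0 ltac:(lra)) as H0. pose proof (HA L ltac:(lra)) as H1.
    rewrite Rminus_0_r in H.
    replace (Rabs (g1 0) * L) with (Rabs (g1 0 * L)) by (rewrite Rabs_mult, (Rabs_right L); lra).
    replace (g1 0 * L) with (- (g L - g 0 - g1 0 * L) + g L - g 0) by ring.
    assert (Rabs (- (g L - g 0 - g1 0 * L) + g L - g 0) <=
       Rabs (g L - g 0 - g1 0 * L) + Rabs (g L) + Rabs (g 0)).
    { unfold Rminus at 1. eapply Rle_trans; [apply Rabs_triang|]. rewrite Rabs_Ropp.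
      apply Rplus_le_compat_r. eapply Rle_trans; [apply Rabs_triang|]. rewrite Rabs_Ropp. lra. }
    simpl. nra.
  (* The exponent matches the degree to be cancelled. Since [q >= 4], the surviving linear
     coefficient [q - 2] is at least 2, which pays for halving the interval. *)
  - set (q := 2 ^ S (S n)). assert (Hq : 4 <= q).
    { unfold q. simpl. pose proof (pow_R1_Rle 2 n ltac:(lra)). lra. }
    exists (C * (1 + q)). split; [nra|].
    intros g g1 L A M HL Hd Hch HA.
    assert (HM : 0 <= A) by (eapply Rle_trans; [apply Rabs_pos|apply (HA 0); lra]).
    pose proof (IH (fun t => 1 * g (2 * t) - q * g t) (fun t => 2 * 1 * g1 (2 * t) - q * g1 t)
      (L / 2) ((1 + q) * A) (Rabs q * M * (L / 2))) as K.
    cbv beta in K. replace (2 * 0) with 0 in K by ring.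
    replace (2 * 1 * g1 0 - q * g1 0) with (- ((q - 2) * g1 0)) in K by ring.
    rewrite Rabs_Ropp, Rabs_mult, (Rabs_right (q - 2)), (Rabs_right q) in K by lra.
    assert (K' : (q - 2) * Rabs (g1 0) * (L / 2) <=
       C * ((1 + q) * A + q * M * (L / 2) * (L / 2) ^ S (S n))).
    { apply K.
      - lra.
      - intros t Ht. apply derivable_pt_lim_dilate_diff; apply Hd; lra.
      - replace (q * M * (L / 2)) with (Rabs q * M * (L / 2)) by (rewrite (Rabs_right q); lra).
        apply chain_dilate_diff; [lra| |exact Hch].
        unfold q. simpl. ring.
      - intros t Ht. unfold Rminus. eapply Rle_trans; [apply Rabs_triang|].
        rewrite Rabs_Ropp, !Rabs_mult, Rabs_R1, (Rabs_right q) by lra.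
        pose proof (HA t ltac:(lra)). pose proof (HA (2 * t) ltac:(lra)). nra. }
    assert (HM0 : q * M * (L / 2) * (L / 2) ^ S (S n) <= (1 + q) * (M * L ^ S (S (S n)))).
    { assert (HMp : 0 <= M).
      { clear - Hch HL. revert g1 Hch. generalize (S (S n)). intros k.
        induction k as [|k IHk]; intros g1 Hch.
        - eapply Rle_trans; [apply Rabs_pos|apply (Hch 0); lra].
        - destruct Hch as [g' [_ H]]. eauto. }
      assert (Hp : (L / 2) * (L / 2) ^ S (S n) <= L ^ S (S (S n))).
      { change ((L / 2) ^ S (S (S n)) <= L ^ S (S (S n))). apply pow_incr. lra. }
      assert (0 <= L ^ S (S (S n))) by (apply pow_le; lra).
      assert (0 <= (L / 2) * (L / 2) ^ S (S n)).
      { change (0 <= (L / 2) ^ S (S (S n))). apply pow_le. lra. }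
      assert (q * M * (L / 2) * (L / 2) ^ S (S n) <= q * M * L ^ S (S (S n))).
      { rewrite !Rmult_assoc. do 2 (apply Rmult_le_compat_l; [lra|]). lra. }
      nra. }
    assert (H1 : Rabs (g1 0) * L <= (q - 2) * Rabs (g1 0) * (L / 2)).
    { pose proof (Rmult_le_pos (q - 4) (Rabs (g1 0) * L) ltac:(lra)
        (Rmult_le_pos _ _ (Rabs_pos (g1 0)) (Rlt_le _ _ HL))). lra. }
    apply Rle_trans with (C * ((1 + q) * A + q * M * (L / 2) * (L / 2) ^ S (S n))); [lra|].
    rewrite (Rmult_assoc C (1 + q)). apply Rmult_le_compat_l; [auto|]. lra.
Qed.

Definition bigO (m n : nat) (f : (nat -> R) -> R) : Prop :=
  exists C r, 0 < r /\ forall z, ball0 m r z -> Rabs (f z) <= C * supnorm m z ^ n.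

Lemma bigO_pos m n f : bigO m n f -> exists C r, 0 <= C /\ 0 < r <= 1 /\
  forall z, ball0 m r z -> Rabs (f z) <= C * supnorm m z ^ n.
Proof.
  intros [C [r [Hr H]]]. exists (Rabs C), (Rmin r 1).
  pose proof (Rmin_l r 1). pose proof (Rmin_r r 1).
  split; [apply Rabs_pos|]. split; [split; [apply Rmin_glb_lt; lra|auto]|].
  intros z Hz. eapply Rle_trans; [apply H; unfold ball0 in *; lra|].
  apply Rmult_le_compat_r; [apply pow_le, supnorm_nonneg|apply Rle_abs].
Qed.

Lemma bigO_plus m n f g : bigO m n f -> bigO m n g -> bigO m n (fun z => f z + g z).
Proof.
  intros [C1 [r1 [H1 HH1]]] [C2 [r2 [H2 HH2]]]. exists (C1 + C2), (Rmin r1 r2).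
  pose proof (Rmin_l r1 r2). pose proof (Rmin_r r1 r2).
  split; [apply Rmin_glb_lt; lra|]. intros z Hz. unfold ball0 in *.
  eapply Rle_trans; [apply Rabs_triang|].
  specialize (HH1 z ltac:(lra)). specialize (HH2 z ltac:(lra)). lra.
Qed.

Lemma bigO_scal m n c f : bigO m n f -> bigO m n (fun z => c * f z).
Proof.
  intros [C1 [r1 [H1 HH1]]]. exists (Rabs c * C1), r1. split; [auto|]. intros z Hz.
  rewrite Rabs_mult, Rmult_assoc. apply Rmult_le_compat_l; [apply Rabs_pos|auto].
Qed.

Lemma bigO_mult m n k f g : bigO m n f -> bigO m k g -> bigO m (n + k) (fun z => f z * g z).
Proof.
  intros [C1 [r1 [H1 HH1]]] [C2 [r2 [H2 HH2]]]. exists (C1 * C2), (Rmin r1 r2).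
  pose proof (Rmin_l r1 r2). pose proof (Rmin_r r1 r2).
  split; [apply Rmin_glb_lt; lra|]. intros z Hz. unfold ball0 in *.
  specialize (HH1 z ltac:(lra)). specialize (HH2 z ltac:(lra)).
  rewrite Rabs_mult, pow_add.
  replace (C1 * C2 * (supnorm m z ^ n * supnorm m z ^ k)) with
    ((C1 * supnorm m z ^ n) * (C2 * supnorm m z ^ k)) by ring.
  apply Rmult_le_compat; auto; apply Rabs_pos.
Qed.

Lemma bigO_zero m n : bigO m n (fun _ => 0).
Proof. exists 0, 1. split; [lra|]. intros. rewrite Rabs_R0. lra. Qed.

Lemma bigO_sumR m n k f : (forall i, (i < k)%nat -> bigO m n (f i)) ->
  bigO m n (fun z => sumR k (fun i => f i z)).
Proof.
  induction k as [|k IH]; intros H; simpl.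
  - apply bigO_zero.
  - apply (bigO_plus m n (fun z => sumR k (fun i => f i z)) (f k)); [apply IH; intros; apply H|apply H]; lia.
Qed.

Lemma bigO_ext m n f g r : 0 < r -> (forall z, ball0 m r z -> f z = g z) -> bigO m n f -> bigO m n g.
Proof.
  intros Hr Hfg [C [r1 [H1 H]]]. exists C, (Rmin r r1).
  pose proof (Rmin_l r r1). pose proof (Rmin_r r r1).
  split; [apply Rmin_glb_lt; lra|]. intros z Hz. unfold ball0 in *.
  rewrite <- Hfg by lra. apply H. lra.
Qed.

Lemma bigO_at0 m n f : bigO m (S n) f -> f zerov = 0.
Proof.
  intros [C [r [Hr H]]]. specialize (H zerov). unfold ball0 in H. rewrite supnorm_zerov in H.
  specialize (H Hr). simpl in H. rewrite Rmult_0_l, Rmult_0_r in H.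
  pose proof (Rabs_pos (f zerov)). assert (Ha : Rabs (f zerov) = 0) by lra.
  destruct (Req_dec (f zerov) 0) as [|Hn]; [auto|]. apply Rabs_no_R0 in Hn. lra.
Qed.

Lemma bigO_le m n k f : (k <= n)%nat -> bigO m n f -> bigO m k f.
Proof.
  intros Hk H. destruct (bigO_pos _ _ _ H) as [C [r [HC [Hr HH]]]]. exists C, r.
  split; [lra|]. intros z Hz. eapply Rle_trans; [apply HH; auto|].
  apply Rmult_le_compat_l; [auto|]. replace n with (k + (n - k))%nat by lia.
  rewrite pow_add. pose proof (supnorm_nonneg m z). unfold ball0 in Hz.
  pose proof (pow_le_one (supnorm m z) (n - k) ltac:(lra)).
  pose proof (pow_le (supnorm m z) k H0). nra.
Qed.

Lemma cont_bigO0 m f : cont_at m f zerov -> bigO m 0 f.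
Proof.
  intros H. destruct (H 1 ltac:(lra)) as [d [Hd HH]].
  exists (Rabs (f zerov) + 1), d. split; [auto|]. intros z Hz. simpl. rewrite Rmult_1_r.
  replace (f z) with ((f z - f zerov) + f zerov) by ring.
  eapply Rle_trans; [apply Rabs_triang|].
  assert (Rabs (f z - f zerov) < 1); [|lra]. apply HH.
  apply (proj1 (ball0_box m d Hd z)). auto.
Qed.

Lemma ball0_zerov m r : 0 < r -> ball0 m r zerov.
Proof. unfold ball0. now rewrite supnorm_zerov. Qed.

Lemma ball0_mono m r r' z : r <= r' -> ball0 m r z -> ball0 m r' z.
Proof. unfold ball0. lra. Qed.

(** [M] comes from continuity of the last derivative at 0. The radius is uniform over all segments
    in direction [j], so the interpolation inequality can be applied from every nearby base
    point. *)
Lemma Ck_chain n m j : (j < m)%nat -> forall r f, 0 < r -> Ck n m (ball0 m r) f ->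
  exists M r', 0 < r' <= r /\ forall z L, 0 <= L ->
    (forall t, 0 <= t <= L -> ball0 m r' (upd z j (z j + t))) ->
    chain n (fun t => f (upd z j (z j + t))) L M.
Proof.
  intros Hj. induction n as [|n IH]; intros r f Hr Hf.
  - destruct (cont_bigO0 m f (Hf zerov (ball0_zerov m r Hr))) as [C [r' [Hr' H]]].
    exists C, (Rmin r r'). pose proof (Rmin_l r r'). pose proof (Rmin_r r r').
    split; [split; [apply Rmin_glb_lt|]; lra|]. intros z L HL Hz t Ht.
    specialize (H (upd z j (z j + t))). simpl in H. rewrite Rmult_1_r in H. apply H.
    eapply ball0_mono; [|apply Hz]; lra.
  - destruct Hf as [_ Hd]. destruct (Hd j Hj) as [g [Hg Cg]].
    destruct (IH r g Hr Cg) as [M [r' [Hr' H]]].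
    exists M, r'. split; [auto|]. intros z L HL Hz.
    exists (fun t => g (upd z j (z j + t))). split; [|apply H; auto].
    intros t Ht.
    assert (Hin : ball0 m r (upd z j (z j + t))) by (eapply ball0_mono; [|apply Hz]; lra).
    pose proof (partial_on_line _ _ _ _ z (z j + t) Hg Hin) as Hl.
    pose proof (derivable_pt_lim_comp (fun s => z j + s) (fun s => f (upd z j s)) t 1
      (g (upd z j (z j + t)))) as Hc.
    rewrite Rmult_1_r in Hc. apply Hc; [|exact Hl].
    apply (derivable_pt_lim_eq (fun s => (fun _ => z j) s + id s) _ t (0 + 1)); [auto|ring|].
    apply (derivable_pt_lim_plus (fun _ => z j) id); [apply derivable_pt_lim_const|apply derivable_pt_lim_id].
Qed.

(** An order of vanishing does not pass to derivatives in general. Here the derivatives of [f] of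
    order [S n] are bounded near 0, and [derivative_interpolation] on a segment in direction [j] of
    length about |z| trades smallness of [f] for smallness of its first derivative. *)
Lemma bigO_partial n m r f j g : 0 < r -> (j < m)%nat -> Ck (S n) m (ball0 m r) f ->
  bigO m (S n) f -> partial_on (ball0 m r) j f g -> Ck n m (ball0 m r) g -> bigO m n g.
Proof.
  intros Hr Hj Hf HO Hg HC. destruct n as [|n].
  - apply cont_bigO0, HC, ball0_zerov, Hr.
  - destruct (Ck_chain (S n) m j Hj r g Hr HC) as [M [r1 [Hr1 Hch]]].
    destruct (bigO_pos _ _ _ HO) as [A [r2 [HA [Hr2 HfA]]]].
    destruct (derivative_interpolation n) as [C [HC0 HK]].
    set (r3 := Rmin r1 r2 / 2).
    assert (Hr3 : 0 < r3 /\ 2 * r3 <= r1 /\ 2 * r3 <= r2).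
    { unfold r3. pose proof (Rmin_l r1 r2). pose proof (Rmin_r r1 r2).
      assert (0 < Rmin r1 r2) by (apply Rmin_glb_lt; lra). lra. }
    set (K := C * (A * 2 ^ S (S n) + Rabs M)).
    assert (HK0 : 0 <= K).
    { unfold K. apply Rmult_le_pos; [auto|]. apply Rplus_le_le_0_compat; [|apply Rabs_pos].
      apply Rmult_le_pos; [auto|]. apply pow_le; lra. }
    (* The length [L] is kept free above [supnorm m z]: at points of norm 0 it is sent to 0,
       elsewhere it is the norm itself. *)
    assert (key : forall z L, 0 < L < r3 -> supnorm m z <= L -> Rabs (g z) <= K * L ^ S n).
    { intros z L HL Hz.
      assert (Hin : forall t, 0 <= t <= L -> supnorm m (upd z j (z j + t)) <= 2 * L).
      { intros t Ht. pose proof (supnorm_nonneg m z). apply supnorm_le; [lra|]. intros p Hp.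
        pose proof (supnorm_ge m z p Hp). unfold upd. destruct (Nat.eq_dec p j) as [->|]; [|lra].
        eapply Rle_trans; [apply Rabs_triang|]. rewrite (Rabs_right t) by lra. lra. }
      assert (H : Rabs (g (upd z j (z j + 0))) * L <=
        C * (A * (2 * L) ^ S (S n) + Rabs M * L ^ S (S n))).
      { apply (HK (fun t => f (upd z j (z j + t))) (fun t => g (upd z j (z j + t)))).
        - lra.
        - intros t Ht. specialize (Hin t Ht).
          assert (Hb : ball0 m r (upd z j (z j + t))) by (unfold ball0; lra).
          pose proof (partial_on_line _ _ _ _ z (z j + t) Hg Hb) as Hl.
          pose proof (derivable_pt_lim_comp (fun s => z j + s) (fun s => f (upd z j s)) t 1
            (g (upd z j (z j + t)))) as Hc.
          rewrite Rmult_1_r in Hc. apply Hc; [|exact Hl].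
          apply (derivable_pt_lim_eq (fun s => (fun _ => z j) s + id s) _ t (0 + 1)); [auto|ring|].
          apply (derivable_pt_lim_plus (fun _ => z j) id);
            [apply derivable_pt_lim_const|apply derivable_pt_lim_id].
        - assert (Hm : forall k h L M M', M <= M' -> chain k h L M -> chain k h L M').
          { clear. induction k as [|k IHk]; intros h L M M' HM Hh.
            - intros t Ht. specialize (Hh t Ht). lra.
            - destruct Hh as [h' [H1 H2]]. exists h'. split; eauto. }
          apply (Hm _ _ _ M); [apply Rle_abs|]. apply Hch; [lra|].
          intros t Ht. specialize (Hin t Ht). unfold ball0. lra.
        - intros t Ht. specialize (Hin t Ht). eapply Rle_trans.
          + apply HfA. unfold ball0. lra.
          + apply Rmult_le_compat_l; [auto|]. apply pow_incr. split; [apply supnorm_nonneg|auto]. }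
      rewrite Rplus_0_r, upd_id in H.
      rewrite Rpow_mult_distr in H.
      replace (C * (A * (2 ^ S (S n) * L ^ S (S n)) + Rabs M * L ^ S (S n))) with
        (K * L ^ S n * L) in H by (unfold K; simpl; ring).
      apply Rmult_le_reg_r with L; lra. }
    exists K, r3. split; [lra|]. intros z Hz.
    destruct (Req_dec (supnorm m z) 0) as [Hz0|Hz0].
    + rewrite Hz0. simpl. rewrite Rmult_0_l, Rmult_0_r.
      apply le_epsilon. intros eps He. rewrite Rplus_0_l.
      set (L := Rmin (Rmin (r3 / 2) 1) (eps / (K + 1))).
      assert (HL : 0 < L).
      { unfold L. repeat apply Rmin_glb_lt; try lra. apply Rdiv_lt_0_compat; lra. }
      assert (HL1 : L <= Rmin (r3 / 2) 1) by apply Rmin_l.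
      assert (HL2 : L <= eps / (K + 1)) by apply Rmin_r.
      pose proof (Rmin_l (r3 / 2) 1). pose proof (Rmin_r (r3 / 2) 1).
      eapply Rle_trans; [apply (key z L); lra|].
      pose proof (pow_le_one L n ltac:(lra)).
      apply Rle_trans with (K * L).
      * apply Rmult_le_compat_l; [auto|]. simpl. nra.
      * apply Rle_trans with ((K + 1) * (eps / (K + 1))); [|right; field; lra].
        apply Rmult_le_compat; lra.
    + pose proof (supnorm_nonneg m z). apply key; [|lra]. unfold ball0 in Hz. lra.
Qed.

(** The condition on the residual that survives differentiation: each of [s] derivatives lowers the
    order of vanishing by at most one. The radii are existential at each level, since only behaviour
    near 0 matters. *)
Fixpoint flat (s w m : nat) (E : (nat -> R) -> R) : Prop :=
  bigO m w E /\
  match s with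
  | O => True
  | S s' => forall j, (j < m)%nat -> exists e,
      (exists r, 0 < r /\ partial_on (ball0 m r) j E e) /\ flat s' (w - 1) m e
  end.

Lemma flat_bigO s w m E : flat s w m E -> bigO m w E.
Proof. destruct s; intros [H _]; exact H. Qed.

Lemma Ck_flat s : forall w m E r, (s <= w)%nat -> 0 < r -> Ck w m (ball0 m r) E -> bigO m w E ->
  flat s w m E.
Proof.
  induction s as [|s IH]; intros w m E r Hs Hr HC HO; split; auto.
  intros j Hj. destruct w as [|w]; [lia|].
  pose proof HC as [_ Hd]. destruct (Hd j Hj) as [e [He Ce]].
  exists e. split; [exists r; auto|]. replace (S w - 1)%nat with w by lia.
  apply (IH _ _ _ r); auto; [lia|].
  eapply bigO_partial; eauto.
Qed.

Lemma flat_pred s : forall w m E, flat (S s) w m E -> flat s w m E.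
Proof.
  induction s as [|s IH]; intros w m E [HO H]; split; auto.
  intros j Hj. destruct (H j Hj) as [e [He Hf]]. exists e. split; auto.
Qed.

Lemma flat_ext s w m E E' r : 0 < r -> (forall z, ball0 m r z -> E z = E' z) ->
  flat s w m E -> flat s w m E'.
Proof.
  intros Hr He H. assert (HO : bigO m w E') by (eapply bigO_ext; eauto; eapply flat_bigO; eauto).
  destruct s as [|s]; split; auto. destruct H as [_ H].
  intros j Hj. destruct (H j Hj) as [e [[r1 [Hr1 Hp]] Hf]]. exists e. split; [|auto].
  pose proof (Rmin_l r r1). pose proof (Rmin_r r r1).
  exists (Rmin r r1). split; [apply Rmin_glb_lt; auto|].
  apply (partial_on_ext m (ball0 m (Rmin r r1)) j E).
  - apply ball0_open.
  - intros x Hx. apply He. eapply ball0_mono; [|exact Hx]; lra.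
  - intros x Hx. apply Hp. eapply ball0_mono; [|exact Hx]; lra.
Qed.

(** * Homogeneous polynomials and leading terms *)

(** Homogeneous polynomials of degree [n], with one variable split off at a time as in Euler's
    identity. The decomposition is not unique; its advantage is that inductions on the degree
    replace multi-indices. *)
Fixpoint Hom (m n : nat) (e : (nat -> R) -> R) : Prop :=
  match n with
  | O => exists c, forall z, e z = c
  | S n' => exists e' : nat -> (nat -> R) -> R, (forall j, (j < m)%nat -> Hom m n' (e' j)) /\
      forall z, e z = sumR m (fun j => z j * e' j z)
  end.

Lemma Hom_Ck m n : forall e k U, Hom m n e -> Ck k m U e.
Proof.
  induction n as [|n IH]; intros e k U H.
  - destruct H as [c Hc]. replace e with (fun _ : nat -> R => c).
    + apply Ck_const.
    + apply functional_extensionality. auto.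
  - destruct H as [e' [He' H]].
    replace e with (fun z => sumR m (fun j => z j * e' j z)) by (apply functional_extensionality; auto).
    apply (Ck_sumR k m U m (fun j z => z j * e' j z)). intros j Hj.
    apply Ck_mult; [now apply Ck_coord|auto].
Qed.

Lemma Hom_bound m n : forall e, Hom m n e -> exists C, 0 <= C /\
  forall z, Rabs (e z) <= C * supnorm m z ^ n.
Proof.
  induction n as [|n IH]; intros e H.
  - destruct H as [c Hc]. exists (Rabs c). split; [apply Rabs_pos|]. intros z. rewrite Hc. simpl. lra.
  - destruct H as [e' [He' H]].
    destruct (fin_bound m (fun j C => forall z, Rabs (e' j z) <= C * supnorm m z ^ n)) as [C [HC HCj]].
    + intros j C C' HCC HH z. eapply Rle_trans; [apply HH|].
      apply Rmult_le_compat_r; [apply pow_le, supnorm_nonneg|auto].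
    + intros j Hj. destruct (IH _ (He' j Hj)) as [C [_ HC]]. eauto.
    + exists (INR m * C). split; [pose proof (pos_INR m); nra|]. intros z. rewrite H.
      eapply Rle_trans; [apply sumR_abs|].
      apply Rle_trans with (sumR m (fun _ => supnorm m z * (C * supnorm m z ^ n))).
      * apply sumR_le. intros j Hj. rewrite Rabs_mult.
        apply Rmult_le_compat; try apply Rabs_pos; [now apply supnorm_ge|now apply HCj].
      * rewrite sumR_const. simpl. right; ring.
Qed.

Lemma Hom_bigO m n e : Hom m n e -> bigO m n e.
Proof. intros H. destruct (Hom_bound _ _ _ H) as [C [_ HC]]. exists C, 1. split; [lra|auto]. Qed.

Lemma Hom_scal m n : forall e c, Hom m n e -> Hom m n (fun z => c * e z).
Proof.
  induction n as [|n IH]; intros e c H.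
  - destruct H as [d Hd]. exists (c * d). intros z. now rewrite Hd.
  - destruct H as [e' [He' H]]. exists (fun j z => c * e' j z). split; [auto|].
    intros z. rewrite H, <- sumR_scal. apply sumR_ext. intros; ring.
Qed.

Lemma Hom_dilate m n : forall e t z, Hom m n e -> e (fun p => t * z p) = t ^ n * e z.
Proof.
  induction n as [|n IH]; intros e t z H.
  - destruct H as [c Hc]. rewrite !Hc. simpl; ring.
  - destruct H as [e' [He' H]]. rewrite !H, <- sumR_scal. apply sumR_ext. intros j Hj.
    rewrite IH by auto. simpl. ring.
Qed.

Lemma fin_bound_pos n (Q : nat -> R -> R -> Prop) :
  (forall i K K' r r', K <= K' -> 0 < r' <= r -> Q i K r -> Q i K' r') ->
  (forall i, (i < n)%nat -> exists K r, 0 < r /\ Q i K r) ->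
  exists K r, 0 < K /\ 0 < r /\ forall i, (i < n)%nat -> Q i K r.
Proof.
  intros Hm H.
  destruct (fin_bound n (fun i K => exists r, 0 < r /\ Q i K r)) as [K [HK HK']].
  - intros i K K' HKK [r [Hr HQ]]. exists r. split; [auto|]. eapply Hm; [exact HKK| |exact HQ]. lra.
  - exact H.
  - destruct (fin_pos n (fun i r => Q i K r)) as [r [Hr Hr']].
    + intros i r r' Hr. apply Hm; lra.
    + exact HK'.
    + exists K, r. auto.
Qed.

Lemma C1_locally_lipschitz n x0 d f : 0 < d -> Ck 1 n (box n x0 d) f ->
  exists K r, 0 < K /\ 0 < r <= d /\ forall x y, box n x0 r x -> box n x0 r y ->
    Rabs (f y - f x) <= K * sumR n (fun p => Rabs (y p - x p)).
Proof.
  intros Hd HC. destruct (Ck_partial _ _ _ _ HC) as [g [[Hc Hp] Hg]].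
  destruct (fin_bound_pos n (fun p K r => forall y, box n x0 r y -> Rabs (g p y) <= K))
    as [K [r [HK [Hr H]]]].
  { intros i K K' r r' HKK Hr H y Hy.
    apply Rle_trans with K; [|auto]. apply H. eapply box_mono; [|exact Hy]; lra. }
  { intros p Hpn. destruct (proj2 (Hp p Hpn) x0 (box_center _ _ _ Hd) 1 ltac:(lra)) as [r [Hr H]].
    exists (Rabs (g p x0) + 1), r. split; [auto|]. intros y Hy. specialize (H y Hy).
    replace (g p y) with ((g p y - g p x0) + g p x0) by ring.
    eapply Rle_trans; [apply Rabs_triang|]. lra. }
  pose proof (Rmin_l d r). pose proof (Rmin_r d r).
  assert (Hm : 0 < Rmin d r) by (apply Rmin_glb_lt; auto).
  exists K, (Rmin d r). split; [auto|]. split; [auto|]. intros x y Hx Hy.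
  pose proof (mean_value_box n x0 (Rmin d r) f g (fun _ => 0) (fun _ => K) x y) as Hmv.
  simpl in Hmv. rewrite (sumR_zero n (fun p => 0 * (y p - x p))) in Hmv by (intros; ring).
  rewrite Rminus_0_r, sumR_scal in Hmv. apply Hmv; auto.
  - intros z Hz. apply Hc. eapply box_mono; [|exact Hz]; lra.
  - intros p Hpn z Hz. apply (Hp p Hpn). eapply box_mono; [|exact Hz]; lra.
  - intros p z Hpn Hz. rewrite Rminus_0_r. apply H; [auto|]. eapply box_mono; [|exact Hz]; lra.
Qed.

(** Induction through Euler's identity: the partials of [f] have leading terms [e j] of degree one
    less, and the leading term of [f] is the sum of [z j * e j] divided by the degree. A mean value
    bound along the ray from 0 to [z] controls the error. *)
Lemma taylor_step m n : forall f r, 0 < r -> Ck (S n) m (ball0 m r) f -> bigO m n f ->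
  exists e, Hom m n e /\ bigO m (S n) (fun z => f z - e z).
Proof.
  induction n as [|n IH]; intros f r Hr HC HO.
  - exists (fun _ => f zerov). split; [exists (f zerov); auto|].
    destruct (C1_locally_lipschitz m zerov r f Hr) as [K [r0 [HK [Hr0 H]]]].
    { apply (Ck_sub 1 m (ball0 m r)); [|exact HC]. intros x Hx. now apply ball0_box. }
    exists (K * INR m), r0. split; [lra|]. intros z Hz.
    eapply Rle_trans; [apply H; [apply box_center; lra|apply ball0_box; [lra|auto]]|].
    rewrite pow_1, Rmult_assoc. apply Rmult_le_compat_l; [lra|]. rewrite <- sumR_const.
    apply sumR_le. intros p Hp. unfold zerov. rewrite Rminus_0_r. now apply supnorm_ge.
  - destruct (Ck_partial _ _ _ _ HC) as [g [HC1 Hg]].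
    destruct (fin_choice (fun _ => 0) m (fun j e => Hom m n e /\ bigO m (S n) (fun z => g j z - e z)))
      as [e He].
    { intros j Hj. apply (IH (g j) r Hr); auto.
      apply (bigO_partial n m r f j); auto using Ck_pred. apply (proj2 HC1 j Hj). }
    set (q := / INR (S n)).
    exists (fun z => sumR m (fun j => z j * (q * e j z))). split.
    { exists (fun j z => q * e j z). split; [|reflexivity]. intros j Hj. apply Hom_scal, He, Hj. }
    destruct (fin_bound m (fun j K => exists r', 0 < r' /\ forall z, ball0 m r' z ->
       Rabs (g j z - e j z) <= K * supnorm m z ^ S n)) as [K [HK HKj]].
    { intros i M M' HMM [r' [Hr' H]]. exists r'. split; [auto|]. intros z Hz. specialize (H z Hz).
      eapply Rle_trans; [exact H|]. apply Rmult_le_compat_r; [apply pow_le, supnorm_nonneg|auto]. }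
    { intros j Hj. destruct (He j Hj) as [_ [K [r' [Hr' H]]]]. exists K, r'. auto. }
    destruct (fin_pos m (fun j r' => forall z, ball0 m r' z ->
       Rabs (g j z - e j z) <= K * supnorm m z ^ S n)) as [r0 [Hr0 H0]].
    { intros i r1 r2 H12 H2 z Hz. apply H2. eapply ball0_mono; [|exact Hz]; lra. }
    { intros j Hj. destruct (HKj j Hj) as [r' [Hr' H]]. exists r'. auto. }
    pose proof (Rmin_l r r0). pose proof (Rmin_r r r0).
    exists (INR m * K), (Rmin r r0). split; [apply Rmin_glb_lt; auto|]. intros z Hz.
    set (dz := fun t : R => (fun p => t * z p) : nat -> R).
    assert (Hball : forall t, 0 <= t <= 1 -> supnorm m (dz t) <= supnorm m z).
    { intros t Ht. unfold dz. rewrite supnorm_scal by lra. pose proof (supnorm_nonneg m z). nra. }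
    assert (Hin : forall t, 0 <= t <= 1 -> ball0 m r (dz t) /\ ball0 m r0 (dz t)).
    { intros t Ht. specialize (Hball t Ht). unfold ball0 in *. lra. }
    set (E := sumR m (fun j => z j * (q * e j z))).
    (* By homogeneity of the [e j], the derivative of [t ^ S n * E] is the sum of
       [z j * e j (dz t)]. The derivative along the ray thus contains only the differences
       [g j - e j], which are of order [S n]. *)
    assert (Hd : forall t, 0 <= t <= 1 -> derivable_pt_lim (fun t => f (dz t) - t ^ S n * E) t
       (sumR m (fun j => z j * (g j (dz t) - e j (dz t))))).
    { intros t Ht.
      assert (D1 : derivable_pt_lim (fun t => f (dz t)) t (sumR m (fun j => g j (dz t) * z j))).
      { apply (chain_rule m (ball0 m r)); auto.
        - apply ball0_open.
        - now apply Hin.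
        - intros p Hp. unfold dz.
          pose proof (derivable_pt_lim_scal id (z p) t 1 (derivable_pt_lim_id t)) as Hs.
          apply (derivable_pt_lim_eq (fun s => z p * id s) _ t (z p * 1)); [|ring|exact Hs].
          intros; unfold id; ring. }
      assert (D2 : derivable_pt_lim (fun t => t ^ S n * E) t (INR (S n) * t ^ n * E)).
      { apply (derivable_pt_lim_eq (fun s => E * s ^ S n) _ t (E * (INR (S n) * t ^ n)));
          [intros; ring|ring|].
        apply (derivable_pt_lim_scal (fun s => s ^ S n)). apply (derivable_pt_lim_pow t (S n)). }
      eapply derivable_pt_lim_eq; [| |apply (derivable_pt_lim_minus _ _ _ _ _ D1 D2)].
      - reflexivity.
      - unfold E. rewrite <- sumR_scal, <- sumR_minus. apply sumR_ext. intros j Hj.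
        unfold dz. rewrite (Hom_dilate m n (e j)) by (apply He; auto). unfold q. field.
        apply not_0_INR; lia. }
    assert (HB : forall t, 0 <= t <= 1 -> Rabs (sumR m (fun j => z j * (g j (dz t) - e j (dz t))))
       <= INR m * K * supnorm m z ^ S (S n)).
    { intros t Ht. eapply Rle_trans; [apply sumR_abs|].
      apply Rle_trans with (sumR m (fun _ => supnorm m z * (K * supnorm m z ^ S n))).
      - apply sumR_le. intros j Hj. rewrite Rabs_mult.
        apply Rmult_le_compat; try apply Rabs_pos; [now apply supnorm_ge|].
        eapply Rle_trans; [apply H0; [auto|apply Hin; auto]|].
        apply Rmult_le_compat_l; [lra|]. apply pow_incr. split; [apply supnorm_nonneg|auto].
      - rewrite sumR_const. simpl. right; ring. }
    pose proof (increment_bound0 _ _ 0 1 _ ltac:(lra) Hd HB) as HF.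
    cbv beta in HF.
    assert (Hd1 : dz 1 = z) by (apply functional_extensionality; intros; unfold dz; ring).
    assert (Hd0 : dz 0 = zerov) by (apply functional_extensionality; intros; unfold dz, zerov; ring).
    rewrite Hd1, Hd0, (bigO_at0 m n f HO), pow1 in HF.
    rewrite pow_i in HF by lia. unfold E in HF.
    replace (f z - 1 * sumR m (fun j => z j * (q * e j z)) -
       (0 - 0 * sumR m (fun j => z j * (q * e j z)))) with
      (f z - sumR m (fun j => z j * (q * e j z))) in HF by ring.
    eapply Rle_trans; [exact HF|]. right; ring.
Qed.

(** * Determinants *)

Lemma detS n A :
  det (S n) A = sumR (S n) (fun j => ((-1) ^ j * A 0%nat j * det n (minor A j))%R).
Proof. reflexivity. Qed.

Module DetBridge.
Import ssreflect ssrfun ssrbool eqtype ssrnat fintype bigop ssralg matrix Rstruct.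
Import GRing.Theory.
Local Open Scope ring_scope.

Lemma sumRE n (f : nat -> R) : sumR n f = \sum_(i < n) f i.
Proof. by elim: n => [|n IH] /=; rewrite ?big_ord0 // big_ord_recr /= -IH. Qed.

(** Gives access to matrix inversion. Both determinants expand along the first row, and the column
    shift in [minor] is the [bump] of the cofactor. *)
Lemma detE n (A : nat -> nat -> R) : det n A = \det (\matrix_(i < n, j < n) A i j).
Proof.
elim: n A => [|n IH] A; first by rewrite det_mx00.
rewrite detS sumRE (expand_det_row _ ord0); apply: eq_bigr => j _.
rewrite IH /cofactor mxE add0n RpowE.
rewrite !RmultE mulrAC mulrC; congr (_ * _); congr (_ ^+ _ * \det _).
apply/matrixP => i k; rewrite !mxE /minor /= /bump leq0n add1n.
case: Nat.ltb_spec; case: leqP => //.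
  by move=> jk /ssrnat.ltP; rewrite ltnNge jk.
by move=> kj /ssrnat.leP; rewrite leqNgt kj.
Qed.

Lemma det_solvable d (A : nat -> nat -> R) : det d A <> IZR 0 ->
  forall e : nat -> R, exists h : nat -> R, forall i, (i < d)%coq_nat ->
    sumR d (fun b => Rmult (A i b) (h b)) = e i.
Proof.
rewrite detE => /eqP; rewrite -unitfE -/(_ \in unitmx) => uA e.
set M := (\matrix_(i, j) _) in uA.
pose h : 'cV[R]_d := invmx M *m \col_i e i.
(* Indices outside the range of the matrix receive the default value 0. *)
exists (fun b => if insub b is Some j then h j ord0 else 0) => i /ssrnat.ltP ltid.
have := congr1 (fun C : 'cV[R]_d => C (Ordinal ltid) ord0) (mulKVmx uA (\col_i e i)).
rewrite -/h !mxE sumRE /= => <-; apply: eq_bigr => j _.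
by rewrite valK RmultE; congr (_ * _); rewrite /M mxE.
Qed.
End DetBridge.

(** * Graded systems: convergence in C^0 *)

Fixpoint iter (D : nat) (lam : nat -> R) (F : (nat -> R) -> nat -> R)
  (P0 : (nat -> R) -> nat -> R) (n : nat) : (nat -> R) -> nat -> R :=
  match n with
  | O => P0
  | S n' => fun z => F (Lstack D lam (iter D lam F P0 n') z)
  end.

(** The centre is built from [P0 zerov] rather than 0: in a derived system the unknown contains
    derivatives, whose values at 0 need not vanish. *)
Definition dom (D N : nat) (lam : nat -> R) (P0 : (nat -> R) -> nat -> R) (delta : R) :
  (nat -> R) -> Prop := box (D * S N) (Lstack D lam P0 zerov) delta.

(* [w a] is the order of vanishing prescribed for the correction to component
   [a] of [P0], and [L a p] a Lipschitz constant of component [a] of [F] in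
   coordinate [p].  [Hrow] is the contraction condition within one weight;
   columns of larger weight contribute a factor |z| and need no condition. *)
Record graded_system (m N : nat) (lam : nat -> R) (l : R) (s D : nat)
  (F : (nat -> R) -> nat -> R) (w : nat -> nat) (P0 : (nat -> R) -> nat -> R)
  (theta delta : R) (L : nat -> nat -> R) : Prop := {
  gs_D : (0 < D)%nat;
  gs_delta : 0 < delta;
  gs_theta : theta < 1;
  gs_C : forall a, (a < D)%nat -> Ck (S s) (D * S N) (dom D N lam P0 delta) (fun X => F X a);
  gs_L0 : forall a p, 0 <= L a p;
  gs_lip : forall a X Y, (a < D)%nat -> dom D N lam P0 delta X -> dom D N lam P0 delta Y ->
    Rabs (F X a - F Y a) <= sumR (D * S N) (fun p => L a p * Rabs (X p - Y p));
  gs_tri : forall a p, (a < D)%nat -> (p < D * S N)%nat -> (w (p mod D) < w a)%nat -> L a p = 0;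
  gs_row : forall a, (a < D)%nat ->
    sumR (D * S N) (fun p => if Nat.eq_dec (w (p mod D)%nat) (w a)
                             then L a p * l ^ (p / D * w a) else 0) <= theta;
  gs_w : forall a, (a < D)%nat -> (S s <= w a)%nat;
  gs_P0 : forall a, (a < D)%nat -> Ck s m (fun _ => True) (fun z => P0 z a);
  gs_err : forall a, (a < D)%nat -> flat s (w a) m (fun z => F (Lstack D lam P0 z) a - P0 z a)
}.

(** Besides the fixed point this retains the iterates: for a derived system, [il_dom] and [il_unif]
    are what permits termwise differentiation of the original iterates on the same ball. *)
Record invariant_limit (m N : nat) (lam : nat -> R) (s D : nat)
  (F : (nat -> R) -> nat -> R) (w : nat -> nat) (P0 : (nat -> R) -> nat -> R)
  (delta rho : R) (P : (nat -> R) -> nat -> R) : Prop := {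
  il_rho : 0 < rho;
  il_dom : forall n z, ball0 m rho z -> dom D N lam P0 delta (Lstack D lam (iter D lam F P0 n) z);
  il_unif : forall a, (a < D)%nat -> forall eps, 0 < eps -> exists n0, forall n z, (n0 <= n)%nat ->
    ball0 m rho z -> Rabs (iter D lam F P0 n z a - P z a) < eps;
  il_C : forall a, (a < D)%nat -> Ck s m (ball0 m rho) (fun z => P z a);
  il_domP : forall z, ball0 m rho z -> dom D N lam P0 delta (Lstack D lam P z);
  il_fix : forall z a, ball0 m rho z -> (a < D)%nat -> F (Lstack D lam P z) a = P z a;
  il_close : forall a, (a < D)%nat -> bigO m (w a) (fun z => P z a - P0 z a)
}.

Lemma Un_cv_dist_le u l k c B : Un_cv u l -> (forall j, Rabs (u (k + j)%nat - c) <= B) ->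
  Rabs (l - c) <= B.
Proof.
  intros Hu H. apply le_epsilon. intros eps He. destruct (Hu eps He) as [n0 Hn].
  specialize (Hn (k + n0)%nat ltac:(lia)). unfold R_dist in Hn. specialize (H n0).
  replace (l - c) with (- (u (k + n0)%nat - l) + (u (k + n0)%nat - c)) by ring.
  eapply Rle_trans; [apply Rabs_triang|]. rewrite Rabs_Ropp. lra.
Qed.

Lemma pow_small q A eps : 0 <= q < 1 -> 0 <= A -> 0 < eps ->
  exists n0, forall n, (n0 <= n)%nat -> A * q ^ n < eps.
Proof.
  intros Hq HA He.
  destruct (pow_lt_1_zero q ltac:(rewrite Rabs_right; lra) (eps / (A + 1)) ltac:(apply Rdiv_lt_0_compat; lra))
    as [n0 Hn0].
  exists n0. intros n Hn. specialize (Hn0 n Hn).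
  pose proof (pow_le q n ltac:(lra)). rewrite Rabs_right in Hn0 by lra.
  apply Rle_lt_trans with ((A + 1) * q ^ n); [nra|].
  apply Rlt_le_trans with ((A + 1) * (eps / (A + 1))); [apply Rmult_lt_compat_l; lra|].
  right; field; lra.
Qed.

Lemma derivative_bound f x l M eps : 0 < eps -> derivable_pt_lim f x l ->
  (forall t, Rabs (t - x) < eps -> Rabs (f t - f x) <= M * Rabs (t - x)) -> Rabs l <= M.
Proof.
  intros He Hd H. apply le_epsilon. intros e1 He1. destruct (Hd e1 He1) as [d Hdd].
  set (h := Rmin d eps / 2).
  assert (Hh : 0 < h /\ h < d /\ h < eps).
  { pose proof (Rmin_l d eps). pose proof (Rmin_r d eps). pose proof (cond_pos d).
    assert (0 < Rmin d eps) by (apply Rmin_glb_lt; lra). unfold h. lra. }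
  specialize (Hdd h ltac:(lra) ltac:(rewrite Rabs_right; lra)).
  specialize (H (x + h)). replace (x + h - x) with h in H by ring.
  rewrite Rabs_right in H by lra. specialize (H ltac:(lra)).
  replace l with (- ((f (x + h) - f x) / h - l) + (f (x + h) - f x) / h) by ring.
  eapply Rle_trans; [apply Rabs_triang|]. rewrite Rabs_Ropp.
  assert (Rabs ((f (x + h) - f x) / h) <= M); [|lra].
  unfold Rdiv. rewrite Rabs_mult, Rabs_inv, (Rabs_right h) by lra.
  apply Rmult_le_reg_r with h; [lra|]. rewrite Rmult_assoc, Rinv_l, Rmult_1_r by lra. auto.
Qed.

Section Graded.
Variables (m N : nat) (lam : nat -> R) (l : R).
Hypothesis Hlam : forall j, (j < m)%nat -> Rabs (lam j) <= l.
Hypothesis Hl : 0 <= l <= 1.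

Lemma Lstack_at0 D P p : Lstack D lam P zerov p = P zerov (p mod D)%nat.
Proof. unfold Lstack, stack. now rewrite Lpow_zerov. Qed.

Lemma Lstack_near D P0 delta : 0 < delta ->
  (forall a, (a < D)%nat -> cont_at m (fun z => P0 z a) zerov) ->
  exists r, 0 < r /\ forall z, ball0 m r z -> dom D N lam P0 delta (Lstack D lam P0 z).
Proof.
  intros Hd Hc.
  destruct (fin_pos D (fun a r => forall z, ball0 m r z -> Rabs (P0 z a - P0 zerov a) < delta))
    as [r [Hr H]].
  - intros i r r' Hr H z Hz. apply H. eapply ball0_mono; [|exact Hz]; lra.
  - intros a Ha. destruct (Hc a Ha delta Hd) as [r [Hr H]]. exists r. split; [auto|].
    intros z Hz. apply H. now apply ball0_box.
  - exists r. split; [auto|]. intros z Hz p Hp. rewrite Lstack_at0. unfold Lstack, stack.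
    apply H; [eapply mod_lt_block; eauto|]. eapply Lpow_ball; eauto.
Qed.

Section Base.
Variables (s D : nat) (F : (nat -> R) -> nat -> R) (w : nat -> nat)
  (P0 : (nat -> R) -> nat -> R) (theta delta : R) (L : nat -> nat -> R).
Hypothesis G : graded_system m N lam l s D F w P0 theta delta L.

Notation bx := (dom D N lam P0 delta).
Notation it := (iter D lam F P0).

(** Row [a] is split by the weight of the column. Smaller weights are absent by [gs_tri], equal
    weights add up to at most [theta] by [gs_row], and for larger weights the spare power of |z|
    beats the whole row sum [T] once the radius is small. *)
Lemma graded_contraction : exists theta' r, 0 <= theta' < 1 /\ 0 < r <= 1 /\
  forall (X Y : (nat -> R) -> nat -> R) A z a, 0 <= A -> ball0 m r z -> (a < D)%nat ->
    bx (Lstack D lam X z) -> bx (Lstack D lam Y z) ->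
    (forall y b, ball0 m r y -> (b < D)%nat -> Rabs (X y b - Y y b) <= A * supnorm m y ^ w b) ->
    Rabs (F (Lstack D lam X z) a - F (Lstack D lam Y z) a) <= theta' * A * supnorm m z ^ w a.
Proof.
  destruct G as [HD Hdel Hth HC HL0 Hlip Htri Hrow Hw HP0 Herr].
  destruct (fin_bound D (fun a T => sumR (D * S N) (fun p => L a p) <= T)) as [T [HT HTa]].
  { intros; lra. }
  { intros a Ha. eexists. apply Rle_refl. }
  assert (Hth0 : 0 <= theta).
  { eapply Rle_trans; [|apply (Hrow O HD)]. apply sumR_nonneg. intros p Hp.
    destruct (Nat.eq_dec _ _); [|lra]. apply Rmult_le_pos; [auto|]. apply pow_le; lra. }
  (* With [r * T <= (1 - theta) / 2] the larger weights use half of the gap between [theta] and 1,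
     which leaves the constant [(1 + theta) / 2]. The bound [r <= 1] lets surplus powers of the norm
     be dropped. *)
  set (r := Rmin 1 ((1 - theta) / 2 / T)).
  assert (Hr : 0 < r <= 1 /\ r * T <= (1 - theta) / 2).
  { assert (0 < (1 - theta) / 2 / T) by (repeat apply Rdiv_lt_0_compat; lra).
    pose proof (Rmin_r 1 ((1 - theta) / 2 / T)). fold r in H0.
    split; [split; [apply Rmin_glb_lt; lra|apply Rmin_l]|].
    apply Rle_trans with ((1 - theta) / 2 / T * T); [apply Rmult_le_compat_r; lra|].
    right; field; lra. }
  destruct Hr as [Hr HrT].
  exists ((1 + theta) / 2), r. split; [lra|]. split; [auto|].
  intros X Y A z a HA Hz Ha HX HY HXY.
  eapply Rle_trans; [apply Hlip; auto|].
  set (nz := supnorm m z). assert (Hnz : 0 <= nz < r) by (split; [apply supnorm_nonneg|exact Hz]).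
  apply Rle_trans with (sumR (D * S N) (fun p => A * nz ^ w a *
    ((if Nat.eq_dec (w (p mod D)%nat) (w a) then L a p * l ^ (p / D * w a) else 0) + r * L a p))).
  - apply sumR_le. intros p Hp.
    assert (Hb : (p mod D < D)%nat) by (eapply mod_lt_block; eauto).
    pose proof (HXY (Lpow lam (p / D) z) (p mod D)%nat (Lpow_ball m lam l Hlam Hl _ _ _ Hz) Hb) as H1.
    change (Rabs (Lstack D lam X z p - Lstack D lam Y z p) <=
      A * supnorm m (Lpow lam (p / D) z) ^ w (p mod D)%nat) in H1.
    assert (H2 : supnorm m (Lpow lam (p / D) z) ^ w (p mod D)%nat <= (l ^ (p / D) * nz) ^ w (p mod D)%nat).
    { apply pow_incr. split; [apply supnorm_nonneg|]. now apply Lpow_norm. }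
    rewrite Rpow_mult_distr, <- pow_mult in H2.
    assert (H3 : Rabs (Lstack D lam X z p - Lstack D lam Y z p) <=
       A * (l ^ (p / D * w (p mod D)) * nz ^ w (p mod D)%nat)) by nra.
    assert (Hnw : 0 <= nz ^ w a) by (apply pow_le; lra).
    pose proof (HL0 a p) as HL.
    assert (Hrest : 0 <= A * nz ^ w a * (r * L a p)).
    { repeat apply Rmult_le_pos; lra. }
    destruct (lt_eq_lt_dec (w (p mod D)%nat) (w a)) as [[Hlt|Heq]|Hgt].
    + rewrite Htri by auto. destruct (Nat.eq_dec _ _); [lia|]. lra.
    + destruct (Nat.eq_dec _ _) as [E|E]; [|lia]. rewrite <- E in *.
      apply Rle_trans with (L a p * (A * (l ^ (p / D * w (p mod D)) * nz ^ w (p mod D)%nat))).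
      * apply Rmult_le_compat_l; auto.
      * rewrite Rmult_plus_distr_l. apply Rle_trans with (A * nz ^ w (p mod D) * (L a p * l ^ (p / D * w (p mod D)))).
        -- right; ring.
        -- lra.
    + destruct (Nat.eq_dec _ _); [lia|]. rewrite Rplus_0_l.
      apply Rle_trans with (L a p * (A * (r * nz ^ w a))); [|right; ring].
      apply Rmult_le_compat_l; [auto|]. eapply Rle_trans; [exact H3|].
      apply Rmult_le_compat_l; [auto|].
      pose proof (pow_le_one l (p / D * w (p mod D)) Hl) as Hlp.
      replace (w (p mod D)%nat) with (w a + 1 + (w (p mod D) - w a - 1))%nat at 2 by lia.
      rewrite !pow_add, pow_1.
      pose proof (pow_le_one nz (w (p mod D) - w a - 1) ltac:(lra)) as Hnp.
      set (u := nz ^ (w (p mod D) - w a - 1)) in *. set (v := l ^ _) in *.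
      assert (0 <= v * u <= 1) by nra.
      apply Rle_trans with ((v * u) * (nz ^ w a * nz)); [right; ring|].
      assert (0 <= nz ^ w a * nz) by nra. nra.
  - rewrite sumR_scal, sumR_plus, sumR_scal.
    specialize (Hrow a Ha). specialize (HTa a Ha).
    assert (Hnw : 0 <= A * nz ^ w a) by (apply Rmult_le_pos; [auto|apply pow_le; lra]).
    replace ((1 + theta) / 2 * A * nz ^ w a) with (A * nz ^ w a * ((1 + theta) / 2)) by ring.
    apply Rmult_le_compat_l; [auto|].
    assert (r * sumR (D * S N) (fun p => L a p) <= r * T) by (apply Rmult_le_compat_l; lra).
    change (sumR (D * S N) (L a)) with (sumR (D * S N) (fun p => L a p)). lra.
Qed.

Theorem graded_limit0 : exists rho P, invariant_limit m N lam 0 D F w P0 delta rho P.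
Proof.
  destruct graded_contraction as [th [r0 [Hth [Hr0 Hcon]]]].
  destruct G as [HD Hdel Hth0 HC HL0 Hlip Htri Hrow Hw HP0 Herr].
  destruct (fin_bound_pos D (fun a C r => forall z, ball0 m r z ->
     Rabs (F (Lstack D lam P0 z) a - P0 z a) <= C * supnorm m z ^ w a)) as [C [r1 [HCp [Hr1 HE]]]].
  { intros i K K' r r' HK Hr H z Hz. eapply Rle_trans; [apply H; eapply ball0_mono; [|exact Hz]; lra|].
    apply Rmult_le_compat_r; [apply pow_le, supnorm_nonneg|auto]. }
  { intros a Ha. destruct (flat_bigO _ _ _ _ (Herr a Ha)) as [C [r [Hr H]]]. eauto. }
  (* The solution of [th * M + C = M], so that the tube of width [M * supnorm m z ^ w a] around [P0]
     is mapped into itself. *)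
  set (M := C / (1 - th)).
  assert (HM : 0 < M) by (apply Rdiv_lt_0_compat; lra).
  assert (HMC : th * M + C = M) by (unfold M; field; lra).
  destruct (Lstack_near D P0 (delta / 2) ltac:(lra)) as [r2 [Hr2 HS]].
  { intros a Ha. apply (Ck_cont s m (fun _ => True)); auto. }
  (* Half of [delta] is reserved for the variation of [P0] near 0 and half for the tube, whose width
     is at most [M * rho] because all weights are at least 1. *)
  set (rho := Rmin (Rmin r0 r1) (Rmin r2 (delta / 2 / M))).
  assert (Hrho : 0 < rho /\ rho <= r0 /\ rho <= r1 /\ rho <= r2 /\ M * rho <= delta / 2).
  { unfold rho. assert (0 < delta / 2 / M) by (repeat apply Rdiv_lt_0_compat; lra).
    pose proof (Rmin_l (Rmin r0 r1) (Rmin r2 (delta / 2 / M))).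
    pose proof (Rmin_r (Rmin r0 r1) (Rmin r2 (delta / 2 / M))).
    pose proof (Rmin_l r0 r1). pose proof (Rmin_r r0 r1).
    pose proof (Rmin_l r2 (delta / 2 / M)). pose proof (Rmin_r r2 (delta / 2 / M)).
    split; [repeat apply Rmin_glb_lt; lra|]. repeat split; try lra.
    apply Rle_trans with (M * (delta / 2 / M)); [apply Rmult_le_compat_l; lra|].
    right; field; lra. }
  clearbody rho. destruct Hrho as [Hrho [Hrr0 [Hrr1 [Hrr2 HrM]]]].
  assert (Hdom : forall X z, ball0 m rho z ->
     (forall y b, ball0 m rho y -> (b < D)%nat -> Rabs (X y b - P0 y b) <= M * supnorm m y ^ w b) ->
     bx (Lstack D lam X z)).
  { intros X z Hz HX p Hp. rewrite Lstack_at0.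
    assert (Hb : (p mod D < D)%nat) by (eapply mod_lt_block; eauto).
    pose proof (HS z (ball0_mono _ _ _ _ Hrr2 Hz) p Hp) as H1. rewrite Lstack_at0 in H1.
    unfold Lstack, stack in *.
    set (y := Lpow lam (p / D) z) in *.
    assert (Hy : ball0 m rho y) by (eapply Lpow_ball; eauto).
    specialize (HX y _ Hy Hb). unfold ball0 in Hy. pose proof (supnorm_nonneg m y) as Hy0.
    assert (H2 : supnorm m y ^ w (p mod D) <= supnorm m y).
    { specialize (Hw _ Hb). destruct (w (p mod D)) as [|k]; [lia|]. simpl.
      pose proof (pow_le_one (supnorm m y) k ltac:(lra)). nra. }
    replace (X y (p mod D)%nat - P0 zerov (p mod D)%nat) with
      ((X y (p mod D)%nat - P0 y (p mod D)%nat) + (P0 y (p mod D)%nat - P0 zerov (p mod D)%nat)) by ring.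
    eapply Rle_lt_trans; [apply Rabs_triang|].
    assert (M * supnorm m y ^ w (p mod D) <= delta / 2) by nra. lra. }
  assert (Hcon' : forall X Y A z a, 0 <= A -> ball0 m rho z -> (a < D)%nat ->
     (forall y b, ball0 m rho y -> (b < D)%nat -> Rabs (X y b - P0 y b) <= M * supnorm m y ^ w b) ->
     (forall y b, ball0 m rho y -> (b < D)%nat -> Rabs (Y y b - P0 y b) <= M * supnorm m y ^ w b) ->
     (forall y b, ball0 m rho y -> (b < D)%nat -> Rabs (X y b - Y y b) <= A * supnorm m y ^ w b) ->
     Rabs (F (Lstack D lam X z) a - F (Lstack D lam Y z) a) <= th * A * supnorm m z ^ w a).
  { intros X Y A z a HA Hz Ha HX HY HXY.
    (* The contraction estimate wants its hypothesis on the larger ball of radius [r0]. Replacing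
       both functions by [P0] outside the ball of radius [rho] provides it, and leaves the stacks at
       [z] unchanged because powers of [Lambda] keep [z] in the smaller ball. *)
    set (cut := fun (X : (nat -> R) -> nat -> R) y => if Rlt_dec (supnorm m y) rho then X y else P0 y).
    assert (Hcut : forall X, Lstack D lam (cut X) z = Lstack D lam X z).
    { intros X0. apply functional_extensionality. intros p. unfold Lstack, stack, cut.
      destruct (Rlt_dec _ _) as [Hn|Hn]; [auto|]. exfalso. apply Hn.
      exact (Lpow_ball m lam l Hlam Hl _ _ _ Hz). }
    rewrite <- (Hcut X), <- (Hcut Y). apply Hcon; auto.
    - eapply ball0_mono; eauto.
    - rewrite Hcut. now apply Hdom.
    - rewrite Hcut. now apply Hdom.
    - intros y b Hy Hb. unfold cut. destruct (Rlt_dec _ _); [auto|].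
      rewrite Rminus_diag, Rabs_R0. apply Rmult_le_pos; [lra|apply pow_le, supnorm_nonneg]. }
  assert (HP00 : forall y b, Rabs (P0 y b - P0 y b) <= M * supnorm m y ^ w b).
  { intros y b. rewrite Rminus_diag, Rabs_R0. apply Rmult_le_pos; [lra|apply pow_le, supnorm_nonneg]. }
  assert (I1 : forall n z a, ball0 m rho z -> (a < D)%nat ->
     Rabs (it n z a - P0 z a) <= M * supnorm m z ^ w a).
  { induction n as [|n IH]; intros z a Hz Ha; [apply HP00|].
    simpl. replace (F (Lstack D lam (it n) z) a - P0 z a) with
      ((F (Lstack D lam (it n) z) a - F (Lstack D lam P0 z) a) + (F (Lstack D lam P0 z) a - P0 z a)) by ring.
    eapply Rle_trans; [apply Rabs_triang|].
    assert (H0 : Rabs (F (Lstack D lam P0 z) a - P0 z a) <= C * supnorm m z ^ w a).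
    { apply HE; auto. eapply ball0_mono; eauto. }
    assert (H1 : Rabs (F (Lstack D lam (it n) z) a - F (Lstack D lam P0 z) a)
      <= th * M * supnorm m z ^ w a) by (apply Hcon'; auto; lra).
    rewrite <- HMC at 1. lra. }
  assert (I3 : forall k j z a, ball0 m rho z -> (a < D)%nat ->
     Rabs (it (k + j)%nat z a - it k z a) <= M * th ^ k * supnorm m z ^ w a).
  { induction k as [|k IH]; intros j z a Hz Ha.
    - simpl. rewrite Rmult_1_r. apply I1; auto.
    - simpl. replace (M * (th * th ^ k)) with (th * (M * th ^ k)) by ring.
      apply Hcon'; auto. apply Rmult_le_pos; [lra|apply pow_le; lra]. }
  (* [R_complete] returns the limit as data, so [P] can be defined pointwise without choice; 0 is
     the default outside the ball and from component [D] on. *)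
  assert (lim : forall z a, {q | ball0 m rho z -> (a < D)%nat -> Un_cv (fun n => it n z a) q}).
  { intros z a. destruct (Rlt_dec (supnorm m z) rho) as [Hz|Hz];
      [|exists 0; intros Hz'; contradiction].
    destruct (lt_dec a D) as [Ha|Ha]; [|exists 0; intros; contradiction].
    destruct (R_complete (fun n => it n z a)) as [q Hq].
    - intros eps He.
      destruct (pow_small th (2 * (M * supnorm m z ^ w a)) eps Hth) as [n0 Hn0]; [|auto|].
      { apply Rmult_le_pos; [lra|]. apply Rmult_le_pos; [lra|apply pow_le, supnorm_nonneg]. }
      exists n0. intros n k Hn Hk. unfold R_dist.
      pose proof (I3 n0 (n - n0)%nat z a Hz Ha) as H1. pose proof (I3 n0 (k - n0)%nat z a Hz Ha) as H2.
      replace (n0 + (n - n0))%nat with n in H1 by lia. replace (n0 + (k - n0))%nat with k in H2 by lia.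
      specialize (Hn0 n0 (le_n _)).
      replace (it n z a - it k z a) with ((it n z a - it n0 z a) + - (it k z a - it n0 z a)) by ring.
      eapply Rle_lt_trans; [apply Rabs_triang|]. rewrite Rabs_Ropp.
      replace (M * th ^ n0 * supnorm m z ^ w a) with (M * supnorm m z ^ w a * th ^ n0) in * by ring. lra.
    - exists q. intros _ _. exact Hq. }
  set (P := fun z a => proj1_sig (lim z a)).
  assert (HP : forall z a, ball0 m rho z -> (a < D)%nat -> Un_cv (fun n => it n z a) (P z a)).
  { intros z a Hz Ha. unfold P. destruct (lim z a) as [q Hq]. simpl. auto. }
  assert (I4 : forall k z a, ball0 m rho z -> (a < D)%nat ->
     Rabs (P z a - it k z a) <= M * th ^ k * supnorm m z ^ w a).
  { intros k z a Hz Ha. apply (Un_cv_dist_le (fun n => it n z a) _ k); [now apply HP|].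
    intros j. now apply I3. }
  assert (I5 : forall z a, ball0 m rho z -> (a < D)%nat ->
     Rabs (P z a - P0 z a) <= M * supnorm m z ^ w a).
  { intros z a Hz Ha. pose proof (I4 O z a Hz Ha) as H. simpl in H. lra. }
  assert (Hsmall : forall z a, ball0 m rho z -> 0 <= supnorm m z ^ w a <= 1).
  { intros z a Hz. unfold ball0 in Hz. apply pow_le_one. pose proof (supnorm_nonneg m z). lra. }
  assert (Hunif : forall a, (a < D)%nat -> forall eps, 0 < eps -> exists n0, forall n z, (n0 <= n)%nat ->
    ball0 m rho z -> Rabs (it n z a - P z a) < eps).
  { intros a Ha eps He. destruct (pow_small th M eps Hth ltac:(lra) He) as [n0 Hn0].
    exists n0. intros n z Hn Hz. rewrite Rabs_minus_sym. eapply Rle_lt_trans; [now apply I4|].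
    specialize (Hn0 n Hn). specialize (Hsmall z a Hz).
    assert (0 <= M * th ^ n) by (apply Rmult_le_pos; [lra|apply pow_le; lra]). nra. }
  assert (Hcont : forall n a, (a < D)%nat -> Ck 0 m (ball0 m rho) (fun z => it n z a)).
  { induction n as [|n IH]; intros a Ha.
    - simpl it. apply (Ck_sub 0 m (fun _ => True)); [auto|]. apply (Ck_le s); [lia|auto].
    - apply (Ck_comp 0 (D * S N) m bx _ (box_open _ _ _) (fun X => F X a) (Lstack D lam (it n))).
      + intros z Hz. exact (Hdom _ z Hz (I1 n)).
      + apply (Ck_le (S s)); [lia|auto].
      + apply (Ck_Lstack m lam l Hlam Hl). auto. }
  exists rho, P. split; auto.
  - intros a Ha z Hz eps He.
    destruct (Hunif a Ha (eps / 3) ltac:(lra)) as [n0 Hn0].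
    destruct (Hcont n0 a Ha z Hz (eps / 3) ltac:(lra)) as [d1 [Hd1 H1]].
    destruct (ball0_open m rho z Hz) as [d2 [Hd2 H2]].
    exists (Rmin d1 d2). pose proof (Rmin_l d1 d2). pose proof (Rmin_r d1 d2).
    split; [apply Rmin_glb_lt; auto|]. intros y Hy.
    specialize (H1 y ltac:(intros p Hp; specialize (Hy p Hp); lra)).
    specialize (H2 y ltac:(intros p Hp; specialize (Hy p Hp); lra)).
    pose proof (Hn0 n0 z (le_n _) Hz) as Ez. pose proof (Hn0 n0 y (le_n _) H2) as Ey.
    replace (P y a - P z a) with (- (it n0 y a - P y a) + (it n0 y a - it n0 z a) + (it n0 z a - P z a)) by ring.
    eapply Rle_lt_trans; [apply Rabs_triang|].
    eapply Rle_lt_trans; [apply Rplus_le_compat_r, Rabs_triang|]. rewrite Rabs_Ropp. lra.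
  - intros z a Hz Ha. apply cond_eq. intros eps He.
    destruct (pow_small th (2 * M) eps Hth ltac:(lra) He) as [n Hn]. specialize (Hn n (le_n _)).
    assert (H1 : Rabs (F (Lstack D lam P z) a - F (Lstack D lam (it n) z) a)
                 <= th * (M * th ^ n) * supnorm m z ^ w a).
    { apply Hcon'; auto. apply Rmult_le_pos; [lra|apply pow_le; lra]. }
    pose proof (I4 (S n) z a Hz Ha) as H2. simpl in H2.
    replace (F (Lstack D lam P z) a - P z a) with
      ((F (Lstack D lam P z) a - F (Lstack D lam (it n) z) a) + - (P z a - F (Lstack D lam (it n) z) a)) by ring.
    eapply Rle_lt_trans; [apply Rabs_triang|]. rewrite Rabs_Ropp.
    specialize (Hsmall z a Hz).
    assert (0 <= M * th ^ n) by (apply Rmult_le_pos; [lra|apply pow_le; lra]).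
    assert (th * (M * th ^ n) * supnorm m z ^ w a <= M * th ^ n).
    { assert (0 <= th * supnorm m z ^ w a <= 1) by nra. nra. }
    lra.
  - intros a Ha. exists M, rho. split; [auto|]. intros z Hz. now apply I5.
Qed.
End Base.
End Graded.

(** * Graded systems: derivatives *)

Section Derived.
Variables (m N : nat) (lam : nat -> R) (l : R).
Hypothesis Hlam : forall j, (j < m)%nat -> Rabs (lam j) <= l.
Hypothesis Hl : 0 <= l <= 1.
Variables (s D : nat) (F : (nat -> R) -> nat -> R) (w : nat -> nat)
  (P0 : (nat -> R) -> nat -> R) (theta delta : R) (L : nat -> nat -> R).
Hypothesis G : graded_system m N lam l (S s) D F w P0 theta delta L.
Variable g : nat -> nat -> (nat -> R) -> R.
Hypothesis Hg1 : forall a, (a < D)%nat ->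
  C1_on (D * S N) (dom D N lam P0 delta) (fun X => F X a) (g a).
Hypothesis Hg2 : forall a p, (a < D)%nat -> (p < D * S N)%nat ->
  Ck (S s) (D * S N) (dom D N lam P0 delta) (g a p).
Variable dP : nat -> nat -> (nat -> R) -> R.
Hypothesis HdP1 : forall a, (a < D)%nat -> C1_on m (fun _ => True) (fun z => P0 z a) (dP a).
Hypothesis HdP2 : forall a j, (a < D)%nat -> (j < m)%nat -> Ck s m (fun _ => True) (dP a j).

(* Block 0 of the derived unknown is the unknown itself and block j+1 is its
   derivative in z_j; [emb i p] is the position in block [i] of the stacked
   derived unknown that corresponds to position [p] of the stacked unknown. *)
Definition D' := (D * S m)%nat.
Definition emb (i p : nat) : nat := (p / D * D' + (i * D + p mod D))%nat.
Definition proj (X : nat -> R) : nat -> R := fun p => X (emb 0 p).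

(** Block 0 is the original map. Block [S j] is the chain rule for the derivative of
    [F(P(z), ..., P(Lambda^N z))] in [z j], with the derivatives of [P] turned into independent
    unknowns. *)
Definition dF (X : nat -> R) (a' : nat) : R :=
  match (a' / D)%nat with
  | O => F (proj X) (a' mod D)%nat
  | S j => sumR (D * S N) (fun p =>
             lam j ^ (p / D) * g (a' mod D)%nat p (proj X) * X (emb (S j) p))
  end.

Definition dw (a' : nat) : nat :=
  match (a' / D)%nat with O => w (a' mod D)%nat | S _ => (w (a' mod D) - 1)%nat end.

Definition dP0 (z : nat -> R) (a' : nat) : R :=
  match (a' / D)%nat with O => P0 z (a' mod D)%nat | S j => dP (a' mod D)%nat j z end.

(** The constant [M] of a derivative row against the original unknown comes from Lipschitz bounds on
    the partials of [F] and may be large. Cutting it off already at [w b < w a], and not only below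
    the weight [w a - 1] of the row, keeps it out of the equal-weight sum in [gs_row]. *)
Definition dL (M : R) (a' p' : nat) : R :=
  let k := (p' / D')%nat in let b := (p' mod D' mod D)%nat in
  match (a' / D)%nat, (p' mod D' / D)%nat with
  | O, O => L (a' mod D)%nat (k * D + b)%nat
  | O, S _ => 0
  | S j, O => if Nat.ltb (w b) (w (a' mod D)%nat) then 0 else M
  | S j, S i => if Nat.eq_dec i j then Rabs (lam j) ^ k * L (a' mod D)%nat (k * D + b)%nat else 0
  end.

Let HD : (0 < D)%nat.
Proof. exact (gs_D _ _ _ _ _ _ _ _ _ _ _ _ G). Qed.

Lemma emb_div i p : (i < S m)%nat -> (emb i p / D' = p / D)%nat.
Proof.
  intros. apply div_block. unfold D'. apply block_lt; auto. apply Nat.mod_upper_bound. lia.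
Qed.

Lemma emb_mod i p : (i < S m)%nat -> (emb i p mod D' = i * D + p mod D)%nat.
Proof.
  intros. apply mod_block. unfold D'. apply block_lt; auto. apply Nat.mod_upper_bound. lia.
Qed.

Lemma emb_mod_div i p : (i < S m)%nat -> (emb i p mod D' / D = i)%nat.
Proof. intros. rewrite emb_mod by auto. apply div_block, Nat.mod_upper_bound. lia. Qed.

Lemma emb_mod_mod i p : (i < S m)%nat -> (emb i p mod D' mod D = p mod D)%nat.
Proof. intros. rewrite emb_mod by auto. apply mod_block, Nat.mod_upper_bound. lia. Qed.

Lemma emb_lt i p : (i < S m)%nat -> (p < D * S N)%nat -> (emb i p < D' * S N)%nat.
Proof.
  intros. apply block_lt; [now apply div_lt_block|]. unfold D'. apply block_lt; auto.
  apply Nat.mod_upper_bound. lia.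
Qed.

Lemma sumR_emb f : sumR (D' * S N) f =
  sumR (D * S N) (fun p => f (emb 0 p)) + sumR m (fun i => sumR (D * S N) (fun p => f (emb (S i) p))).
Proof.
  rewrite sumR_mul.
  transitivity (sumR (S N) (fun k => sumR (S m) (fun i => sumR D (fun b => f (k * D' + (i * D + b))%nat)))).
  { apply sumR_ext. intros k Hk. unfold D' at 1. rewrite sumR_mul. reflexivity. }
  rewrite sumR_swap, sumR_shift.
  assert (H : forall i, sumR (S N) (fun k => sumR D (fun b => f (k * D' + (i * D + b))%nat)) =
            sumR (D * S N) (fun p => f (emb i p))).
  { intros i. rewrite sumR_mul. apply sumR_ext. intros k Hk. apply sumR_ext. intros b Hb.
    unfold emb. rewrite div_block, mod_block by auto. reflexivity. }
  rewrite <- H. f_equal. apply sumR_ext. intros; apply H.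
Qed.

Lemma Lstack_emb P z i p : (i < S m)%nat ->
  Lstack D' lam P z (emb i p) = P (Lpow lam (p / D) z) (i * D + p mod D)%nat.
Proof. intros Hi. unfold Lstack, stack. now rewrite emb_div, emb_mod. Qed.

Lemma proj_Lstack P z : proj (Lstack D' lam P z) = Lstack D lam P z.
Proof.
  apply functional_extensionality; intros p. unfold proj. rewrite Lstack_emb by lia. reflexivity.
Qed.

Lemma block0_div a : (a < D)%nat -> (a / D = 0)%nat.
Proof. apply Nat.div_small. Qed.

Lemma Lstack_agree P Q z : (forall y b, (b < D)%nat -> P y b = Q y b) ->
  Lstack D lam P z = Lstack D lam Q z.
Proof.
  intros H. apply functional_extensionality; intros p. unfold Lstack, stack. apply H.
  apply Nat.mod_upper_bound. lia.
Qed.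

Lemma dP0_block0 z a : (a < D)%nat -> dP0 z a = P0 z a.
Proof. intros Ha. unfold dP0. rewrite block0_div by auto. now rewrite Nat.mod_small. Qed.

Lemma dP0_blockS z j a : (a < D)%nat -> dP0 z (S j * D + a) = dP a j z.
Proof. intros Ha. unfold dP0. now rewrite div_block, mod_block. Qed.

Lemma dF_block0 X a : (a < D)%nat -> dF X a = F (proj X) a.
Proof. intros Ha. unfold dF. rewrite block0_div by auto. now rewrite Nat.mod_small. Qed.

Lemma dF_blockS X j a : (a < D)%nat -> dF X (S j * D + a) =
  sumR (D * S N) (fun p => lam j ^ (p / D) * g a p (proj X) * X (emb (S j) p)).
Proof. intros Ha. unfold dF. now rewrite div_block, mod_block. Qed.

Lemma proj_dom d X : d <= delta -> dom D' N lam dP0 d X -> dom D N lam P0 d (proj X).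
Proof.
  intros Hd HX p Hp.
  assert (Hb : (p mod D < D)%nat) by (eapply mod_lt_block; eauto).
  specialize (HX (emb 0 p) (emb_lt 0 p ltac:(lia) Hp)).
  rewrite Lstack_emb in HX by lia. rewrite Lpow_zerov, dP0_block0 in HX by auto.
  rewrite Lstack_at0. exact HX.
Qed.

Lemma partial_lip_bound a p X : (a < D)%nat -> (p < D * S N)%nat -> dom D N lam P0 delta X ->
  Rabs (g a p X) <= L a p.
Proof.
  intros Ha Hp HX.
  destruct (Hg1 a Ha) as [_ Hd]. destruct (Hd p Hp) as [Hpa _].
  destruct (open_upd _ _ X p (box_open (D * S N) (Lstack D lam P0 zerov) delta) HX) as [e [He Hu]].
  apply (derivative_bound (fun t => F (upd X p t) a) (X p) (g a p X) (L a p) e He).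
  - apply Hpa, HX.
  - intros t Ht. simpl. rewrite upd_id.
    eapply Rle_trans; [apply (gs_lip _ _ _ _ _ _ _ _ _ _ _ _ G); auto; apply Hu; auto|].
    rewrite (sumR_single _ _ p Hp).
    + rewrite upd_same. lra.
    + intros q Hq Hqp. rewrite upd_other by auto. rewrite Rminus_diag, Rabs_R0. ring.
Qed.

(** A vanishing Lipschitz constant means independence: by [gs_tri], component [a] does not see
    coordinates of weight below [w a]. *)
Lemma F_indep a X Y : (a < D)%nat -> dom D N lam P0 delta X -> dom D N lam P0 delta Y ->
  (forall q, (q < D * S N)%nat -> (w a <= w (q mod D))%nat -> X q = Y q) -> F X a = F Y a.
Proof.
  intros Ha HX HY HXY. apply Rminus_diag_uniq.
  assert (H : Rabs (F X a - F Y a) <= 0); [|pose proof (Rabs_pos (F X a - F Y a))].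
  - eapply Rle_trans; [apply (gs_lip _ _ _ _ _ _ _ _ _ _ _ _ G); auto|].
    right. apply sumR_zero. intros q Hq. destruct (le_lt_dec (w a) (w (q mod D))).
    + rewrite HXY by auto. rewrite Rminus_diag, Rabs_R0. ring.
    + rewrite (gs_tri _ _ _ _ _ _ _ _ _ _ _ _ G) by auto. ring.
  - destruct (Req_dec (F X a - F Y a) 0) as [|Hn]; [auto|]. apply Rabs_no_R0 in Hn. lra.
Qed.

(** This justifies the cut-off in [dL]. If coordinate [p] has weight at least [w a], moving it from
    [X] and from [Y] gives locally the same function of [t]; otherwise both partials are bounded by
    the Lipschitz constant 0. *)
Lemma partial_indep a p X Y : (a < D)%nat -> (p < D * S N)%nat ->
  dom D N lam P0 delta X -> dom D N lam P0 delta Y ->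
  (forall q, (q < D * S N)%nat -> (w a <= w (q mod D))%nat -> X q = Y q) -> g a p X = g a p Y.
Proof.
  intros Ha Hp HX HY HXY.
  destruct (le_lt_dec (w a) (w (p mod D))) as [Hw|Hw].
  - destruct (Hg1 a Ha) as [_ Hd]. destruct (Hd p Hp) as [Hpa _].
    destruct (open_upd _ _ X p (box_open (D * S N) (Lstack D lam P0 zerov) delta) HX) as [e1 [He1 Hu1]].
    destruct (open_upd _ _ Y p (box_open (D * S N) (Lstack D lam P0 zerov) delta) HY) as [e2 [He2 Hu2]].
    pose proof (Hpa X HX) as H1. pose proof (Hpa Y HY) as H2.
    rewrite <- (HXY p Hp Hw) in H2, Hu2.
    apply (uniqueness_limite (fun t => F (upd X p t) a) (X p)); [exact H1|].
    apply (derivable_pt_lim_ext_loc (fun t => F (upd Y p t) a) _ _ _ (Rmin e1 e2)); [| |exact H2].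
    + apply Rmin_glb_lt; auto.
    + intros t Ht. pose proof (Rmin_l e1 e2). pose proof (Rmin_r e1 e2).
      symmetry. apply F_indep; auto.
      * apply Hu1. lra.
      * apply Hu2. lra.
      * intros q Hq Hwq. unfold upd. destruct (Nat.eq_dec q p); auto.
  - pose proof (partial_lip_bound a p X Ha Hp HX) as H1.
    pose proof (partial_lip_bound a p Y Ha Hp HY) as H2.
    rewrite (gs_tri _ _ _ _ _ _ _ _ _ _ _ _ G) in H1, H2 by auto.
    assert (Hz : forall u, Rabs u <= 0 -> u = 0).
    { intros u Hu. destruct (Req_dec u 0) as [|Hn]; [auto|]. apply Rabs_pos_lt in Hn. lra. }
    rewrite (Hz _ H1), (Hz _ H2). reflexivity.
Qed.

Lemma partial_lipschitz : exists K r, 0 < K /\ 0 < r <= delta /\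
  forall a p X Y, (a < D)%nat -> (p < D * S N)%nat ->
    dom D N lam P0 r X -> dom D N lam P0 r Y ->
    Rabs (g a p X - g a p Y) <= K * sumR (D * S N) (fun q =>
      if Nat.ltb (w (q mod D)%nat) (w a) then 0 else Rabs (X q - Y q)).
Proof.
  assert (Hdel : 0 < delta) by apply (gs_delta _ _ _ _ _ _ _ _ _ _ _ _ G).
  assert (Hmono : forall r r' X Y K K' a p, K <= K' -> 0 < r' <= r ->
    (forall X Y, dom D N lam P0 r X -> dom D N lam P0 r Y ->
       Rabs (g a p Y - g a p X) <= K * sumR (D * S N) (fun q => Rabs (Y q - X q))) ->
    dom D N lam P0 r' X -> dom D N lam P0 r' Y ->
       Rabs (g a p Y - g a p X) <= K' * sumR (D * S N) (fun q => Rabs (Y q - X q))).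
  { intros r r' X Y K K' a p HK Hr H HX HY. eapply Rle_trans.
    - apply H; eapply box_mono; try eassumption; lra.
    - apply Rmult_le_compat_r; [|auto]. apply sumR_nonneg. intros; apply Rabs_pos. }
  destruct (fin_bound_pos D (fun a K r => forall p, (p < D * S N)%nat -> forall X Y,
     dom D N lam P0 r X -> dom D N lam P0 r Y ->
     Rabs (g a p Y - g a p X) <= K * sumR (D * S N) (fun q => Rabs (Y q - X q))))
    as [K [r [HK [Hr H]]]].
  { intros a K K' r r' HKK Hr H p Hp X Y HX HY. eapply Hmono; eauto. }
  { intros a Ha.
    destruct (fin_bound_pos (D * S N) (fun p K r => forall X Y,
      dom D N lam P0 r X -> dom D N lam P0 r Y ->
      Rabs (g a p Y - g a p X) <= K * sumR (D * S N) (fun q => Rabs (Y q - X q))))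
      as [K [r [HK [Hr H]]]].
    - intros p K K' r r' HKK Hr H X Y HX HY. eapply Hmono; eauto.
    - intros p Hp.
      destruct (C1_locally_lipschitz (D * S N) (Lstack D lam P0 zerov) delta (g a p) Hdel)
        as [K [r [HK [Hr H]]]].
      + apply (Ck_le (S s)); [lia|]. now apply Hg2.
      + exists K, r. split; [lra|]. exact H.
    - exists K, r. split; auto. }
  pose proof (Rmin_l delta r). pose proof (Rmin_r delta r).
  exists K, (Rmin delta r). split; [auto|]. split; [split; [apply Rmin_glb_lt; auto|auto]|].
  intros a p X Y Ha Hp HX HY.
  (* Coordinates of low weight may be copied from [X] into [Y] without changing the partial, so they
     drop out of the Lipschitz bound. *)
  set (Y' := fun q => if Nat.ltb (w (q mod D)%nat) (w a) then X q else Y q).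
  assert (HY' : dom D N lam P0 (Rmin delta r) Y').
  { intros q Hq. unfold Y'. destruct (Nat.ltb _ _); auto. }
  assert (Hmono' : forall Z, dom D N lam P0 (Rmin delta r) Z -> dom D N lam P0 delta Z /\ dom D N lam P0 r Z).
  { intros Z HZ. split; (eapply box_mono; [|exact HZ]; lra). }
  rewrite (partial_indep a p Y Y' Ha Hp).
  - eapply Rle_trans; [apply (H a Ha p Hp Y' X); apply Hmono'; auto|].
    apply Rmult_le_compat_l; [lra|]. apply sumR_le. intros q Hq. unfold Y'.
    destruct (Nat.ltb _ _); [rewrite Rminus_diag, Rabs_R0|]; lra.
  - apply Hmono'; auto.
  - apply Hmono'; auto.
  - intros q Hq Hw. unfold Y'. destruct (Nat.ltb_spec (w (q mod D)%nat) (w a)); [lia|auto].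
Qed.

Lemma derived_index a' : (a' < D')%nat ->
  (a' < D)%nat \/ exists j a, (j < m)%nat /\ (a < D)%nat /\ a' = (S j * D + a)%nat.
Proof.
  intros H. unfold D' in H. pose proof (div_mod_block a' D) as E.
  assert (Hb : (a' mod D < D)%nat) by (apply Nat.mod_upper_bound; lia).
  assert (Hq : (a' / D < S m)%nat) by (apply div_lt_block; auto).
  destruct (a' / D)%nat as [|j]; [left; simpl in E; lia|].
  right. exists j, (a' mod D)%nat. repeat split; auto; lia.
Qed.

Lemma dL_00 M a p : (a < D)%nat -> dL M a (emb 0 p) = L a p.
Proof.
  intros Ha. unfold dL. rewrite emb_mod_div, emb_mod_mod, emb_div, block0_div by (auto; lia).
  rewrite Nat.mod_small by auto. now rewrite <- div_mod_block.
Qed.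

Lemma dL_0S M a i p : (a < D)%nat -> (i < m)%nat -> dL M a (emb (S i) p) = 0.
Proof. intros Ha Hi. unfold dL. now rewrite emb_mod_div, block0_div by (auto; lia). Qed.

Lemma dL_S0 M j a p : (a < D)%nat -> dL M (S j * D + a) (emb 0 p) =
  if Nat.ltb (w (p mod D)%nat) (w a) then 0 else M.
Proof.
  intros Ha. unfold dL. rewrite emb_mod_div, emb_mod_mod, div_block, mod_block by (auto; lia). reflexivity.
Qed.

Lemma dL_SS M j a i p : (a < D)%nat -> (i < m)%nat -> dL M (S j * D + a) (emb (S i) p) =
  if Nat.eq_dec i j then Rabs (lam j) ^ (p / D) * L a p else 0.
Proof.
  intros Ha Hi. unfold dL.
  rewrite emb_mod_div, emb_mod_mod, emb_div, div_block, mod_block by (auto; lia).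
  now rewrite <- div_mod_block.
Qed.

Lemma dw_0 a : (a < D)%nat -> dw a = w a.
Proof. intros Ha. unfold dw. rewrite block0_div, Nat.mod_small by auto. reflexivity. Qed.

Lemma dw_S j a : (a < D)%nat -> dw (S j * D + a) = (w a - 1)%nat.
Proof. intros Ha. unfold dw. now rewrite div_block, mod_block. Qed.

Lemma dw_emb0 p : (dw (emb 0 p mod D') = w (p mod D))%nat.
Proof.
  rewrite emb_mod by lia. apply dw_0. apply Nat.mod_upper_bound. lia.
Qed.

Lemma dw_embS i p : (i < m)%nat -> (dw (emb (S i) p mod D') = w (p mod D) - 1)%nat.
Proof.
  intros Hi. rewrite emb_mod by lia. apply dw_S. apply Nat.mod_upper_bound. lia.
Qed.

Lemma emb_surj p' : (p' < D' * S N)%nat -> exists i p, (i < S m)%nat /\ (p < D * S N)%nat /\ p' = emb i p.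
Proof.
  intros H. pose proof (div_mod_block p' D') as E1. pose proof (div_mod_block (p' mod D') D) as E2.
  assert (Hk : (p' / D' < S N)%nat) by (apply div_lt_block; auto).
  assert (Hm : (p' mod D' < D')%nat) by (eapply mod_lt_block; eauto).
  assert (Hb : (p' mod D' mod D < D)%nat) by (apply Nat.mod_upper_bound; lia).
  exists (p' mod D' / D)%nat, (p' / D' * D + p' mod D' mod D)%nat.
  repeat split.
  - apply div_lt_block. exact Hm.
  - now apply block_lt.
  - unfold emb. rewrite div_block, mod_block by auto. lia.
Qed.

Lemma dP0_C a' : (a' < D')%nat -> Ck s m (fun _ => True) (fun z => dP0 z a').
Proof.
  intros Ha'. destruct (derived_index a' Ha') as [Ha|[j [a [Hj [Ha ->]]]]].
  - replace (fun z => dP0 z a') with (fun z => P0 z a').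
    + apply Ck_pred. apply (gs_P0 _ _ _ _ _ _ _ _ _ _ _ _ G); auto.
    + apply functional_extensionality; intros. now rewrite dP0_block0.
  - replace (fun z => dP0 z (S j * D + a)%nat) with (dP a j).
    + now apply HdP2.
    + apply functional_extensionality; intros. now rewrite dP0_blockS.
Qed.

Lemma partial_Lstack rho Q dQ j :
  (j < m)%nat -> (forall z, ball0 m rho z -> dom D N lam P0 delta (Lstack D lam Q z)) ->
  (forall b, (b < D)%nat -> partial_on (ball0 m rho) j (fun z => Q z b) (dQ b)) ->
  forall a, (a < D)%nat -> partial_on (ball0 m rho) j (fun z => F (Lstack D lam Q z) a)
    (fun z => sumR (D * S N) (fun p => lam j ^ (p / D) * g a p (Lstack D lam Q z) *
       dQ (p mod D)%nat (Lpow lam (p / D) z))).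
Proof.
  intros Hj Hdom HQ a Ha.
  pose proof (partial_on_comp (D * S N) m (dom D N lam P0 delta) (ball0 m rho)
    (fun X => F X a) (g a) (Lstack D lam Q)
    (fun p z => lam j ^ (p / D) * dQ (p mod D)%nat (Lpow lam (p / D) z)) j) as H.
  assert (H' : partial_on (ball0 m rho) j (fun z => F (Lstack D lam Q z) a)
    (fun z => sumR (D * S N) (fun p => g a p (Lstack D lam Q z) *
       (lam j ^ (p / D) * dQ (p mod D)%nat (Lpow lam (p / D) z))))).
  { apply H; auto.
    - apply box_open.
    - intros p Hp. unfold Lstack, stack.
      apply (partial_on_Lpow m lam l Hlam Hl rho (fun z => Q z (p mod D)%nat) (dQ (p mod D)%nat)).
      apply HQ. eapply mod_lt_block; eauto. }
  intros z Hz. eapply derivable_pt_lim_eq; [| |apply (H' z Hz)].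
  - reflexivity.
  - apply sumR_ext. intros; ring.
Qed.

Lemma dF_Lstack_S Q j a z : (a < D)%nat -> (j < m)%nat -> dF (Lstack D' lam Q z) (S j * D + a) =
  sumR (D * S N) (fun p => lam j ^ (p / D) * g a p (Lstack D lam Q z) *
    Q (Lpow lam (p / D) z) (S j * D + p mod D)%nat).
Proof.
  intros Ha Hj. rewrite dF_blockS, proj_Lstack by auto. apply sumR_ext. intros p Hp.
  rewrite Lstack_emb by lia. reflexivity.
Qed.

Lemma derived_system : exists delta' L', delta' <= delta /\
  graded_system m N lam l s D' dF dw dP0 theta delta' L'.
Proof.
  destruct partial_lipschitz as [K [r [HK [Hr HKL]]]].
  pose proof G as [_ Hdel Hth HC HL0 Hlip Htri Hrow Hw HP0 Herr].
  destruct (fin_bound D' (fun a Q => Rabs (dP0 zerov a) <= Q)) as [Q [HQ HQa]].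
  { intros; lra. }
  { intros. eexists; apply Rle_refl. }
  (* On the box the derivative unknowns are at most [Q + r], the partials of [F] are Lipschitz with
     constant [K], and [INR (D * S N)] counts the terms of the chain rule. *)
  set (M := INR (D * S N) * (K * (Q + r))).
  assert (HM : 0 <= M).
  { unfold M. pose proof (pos_INR (D * S N)). apply Rmult_le_pos; [auto|].
    apply Rmult_le_pos; lra. }
  assert (Hdd : forall X, dom D' N lam dP0 r X -> dom D N lam P0 r (proj X) /\ dom D N lam P0 delta (proj X)).
  { intros X HX. pose proof (proj_dom r X ltac:(lra) HX) as H. split; [auto|].
    eapply box_mono; [|exact H]; lra. }
  exists r, (dL M). split; [lra|]. split; auto.
  - unfold D'. lia.
  - lra.
  - intros a' Ha'.
    assert (Hproj : forall p, (p < D * S N)%nat ->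
      Ck (S s) (D' * S N) (dom D' N lam dP0 r) (fun X => proj X p)).
    { intros p Hp. unfold proj. apply Ck_coord, emb_lt; auto; lia. }
    destruct (derived_index a' Ha') as [Ha|[j [a [Hj [Ha ->]]]]].
    + replace (fun X => dF X a') with (fun X => F (proj X) a').
      * apply (Ck_comp (S s) (D * S N) (D' * S N) (dom D N lam P0 delta) _ (box_open _ _ _)
          (fun X => F X a') proj); auto.
        -- intros X HX. now apply Hdd.
        -- apply Ck_pred. auto.
      * apply functional_extensionality; intros. now rewrite dF_block0.
    + replace (fun X => dF X (S j * D + a)%nat) with (fun X => sumR (D * S N) (fun p =>
         lam j ^ (p / D) * g a p (proj X) * X (emb (S j) p))).
      * apply (Ck_sumR _ _ _ _ (fun p X => lam j ^ (p / D) * g a p (proj X) * X (emb (S j) p))).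
        intros p Hp. apply Ck_mult; [|apply Ck_coord, emb_lt; auto; lia].
        apply Ck_scal.
        apply (Ck_comp (S s) (D * S N) (D' * S N) (dom D N lam P0 delta) _ (box_open _ _ _)
          (g a p) proj); auto.
        intros X HX. now apply Hdd.
      * apply functional_extensionality; intros. now rewrite dF_blockS.
  - intros a' p'. unfold dL. destruct (a' / D)%nat as [|j], (p' mod D' / D)%nat as [|i]; auto; try lra.
    + destruct (Nat.ltb _ _); lra.
    + destruct (Nat.eq_dec _ _); [|lra]. apply Rmult_le_pos; [apply pow_le, Rabs_pos|auto].
  - intros a' X Y Ha' HX HY. rewrite sumR_emb.
    destruct (Hdd X HX) as [HX1 HX2]. destruct (Hdd Y HY) as [HY1 HY2].
    destruct (derived_index a' Ha') as [Ha|[j [a [Hj [Ha ->]]]]].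
    + rewrite !dF_block0 by auto. eapply Rle_trans; [apply Hlip; auto|].
      rewrite <- (Rplus_0_r (sumR (D * S N) (fun p => L a' p * _))).
      apply Rplus_le_compat.
      * apply sumR_le. intros p Hp. rewrite dL_00 by auto. apply Rle_refl.
      * apply sumR_nonneg. intros i Hi. apply sumR_nonneg. intros p Hp. rewrite dL_0S by auto. lra.
    + rewrite !dF_blockS by auto. rewrite <- sumR_minus.
      eapply Rle_trans; [apply sumR_abs|].
      rewrite (sumR_single m _ j Hj).
      2:{ intros i Hi Hij. apply sumR_zero. intros p Hp. rewrite dL_SS by auto.
          destruct (Nat.eq_dec i j); [contradiction|ring]. }
      set (S0 := sumR (D * S N) (fun q =>
         if Nat.ltb (w (q mod D)%nat) (w a) then 0 else Rabs (proj X q - proj Y q))).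
      assert (HS0 : 0 <= S0).
      { apply sumR_nonneg. intros q Hq. destruct (Nat.ltb _ _); [lra|apply Rabs_pos]. }
      assert (Hx : sumR (D * S N) (fun p => dL M (S j * D + a) (emb 0 p) * Rabs (X (emb 0 p) - Y (emb 0 p)))
                   = M * S0).
      { unfold S0. rewrite <- sumR_scal. apply sumR_ext. intros p Hp. rewrite dL_S0 by auto.
        unfold proj. destruct (Nat.ltb _ _); ring. }
      rewrite Hx. unfold M. rewrite Rmult_assoc, <- sumR_const, <- sumR_plus.
      apply sumR_le. intros p Hp. rewrite dL_SS by auto. destruct (Nat.eq_dec j j) as [_|]; [|contradiction].
      assert (Hb : (p mod D < D)%nat) by (eapply mod_lt_block; eauto).
      set (c := lam j ^ (p / D)).
      assert (Hc : Rabs c = Rabs (lam j) ^ (p / D)) by (unfold c; symmetry; apply RPow_abs).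
      assert (Hc1 : Rabs c <= 1).
      { rewrite Hc. specialize (Hlam j Hj). apply pow_le_one. pose proof (Rabs_pos (lam j)). lra. }
      assert (HY3 : Rabs (Y (emb (S j) p)) <= Q + r).
      { specialize (HY _ (emb_lt (S j) p ltac:(lia) Hp)).
        rewrite Lstack_at0, emb_mod in HY by lia.
        assert (HQ' : Rabs (dP0 zerov (S j * D + p mod D)%nat) <= Q).
        { apply HQa. unfold D'. apply block_lt; lia. }
        replace (Y (emb (S j) p)) with ((Y (emb (S j) p) - dP0 zerov (S j * D + p mod D)%nat) +
          dP0 zerov (S j * D + p mod D)%nat) by ring.
        eapply Rle_trans; [apply Rabs_triang|]. lra. }
      pose proof (HKL a p _ _ Ha Hp HX1 HY1) as Hgl. fold S0 in Hgl.
      pose proof (partial_lip_bound a p _ Ha Hp HX2) as Hgb.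
      (* The first part is the variation of the coefficient and feeds [M]; the second is the
         variation of the derivative unknown and feeds the block of the same direction [j]. *)
      replace (c * g a p (proj X) * X (emb (S j) p) - c * g a p (proj Y) * Y (emb (S j) p)) with
        (c * ((g a p (proj X) - g a p (proj Y)) * Y (emb (S j) p)) +
         c * g a p (proj X) * (X (emb (S j) p) - Y (emb (S j) p))) by ring.
      eapply Rle_trans; [apply Rabs_triang|]. apply Rplus_le_compat.
      * rewrite !Rabs_mult.
        assert (Rabs (g a p (proj X) - g a p (proj Y)) * Rabs (Y (emb (S j) p)) <= K * S0 * (Q + r)).
        { apply Rmult_le_compat; auto; apply Rabs_pos. }
        assert (0 <= Rabs (g a p (proj X) - g a p (proj Y)) * Rabs (Y (emb (S j) p))).
        { apply Rmult_le_pos; apply Rabs_pos. }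
        pose proof (Rabs_pos c). nra.
      * rewrite !Rabs_mult, Hc. apply Rmult_le_compat_r; [apply Rabs_pos|].
        apply Rmult_le_compat_l; [apply pow_le, Rabs_pos|auto].
  - intros a' p' Ha' Hp' Hww. destruct (emb_surj p' Hp') as [i [p [Hi [Hp ->]]]].
    destruct (derived_index a' Ha') as [Ha|[j [a [Hj [Ha ->]]]]]; destruct i as [|i].
    + rewrite dw_emb0, dw_0 in Hww by auto. rewrite dL_00 by auto. auto.
    + apply dL_0S; auto; lia.
    + rewrite dw_emb0, dw_S in Hww by auto. rewrite dL_S0 by auto.
      destruct (Nat.ltb_spec (w (p mod D)%nat) (w a)); [auto|lia].
    + rewrite dw_embS, dw_S in Hww by (auto; lia). rewrite dL_SS by (auto; lia).
      rewrite Htri by (auto; lia). destruct (Nat.eq_dec i j); ring.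
  - intros a' Ha'. rewrite sumR_emb.
    destruct (derived_index a' Ha') as [Ha|[j [a [Hj [Ha ->]]]]].
    + rewrite dw_0 by auto.
      rewrite (sumR_zero m).
      2:{ intros i Hi. apply sumR_zero. intros p Hp. rewrite dL_0S by auto.
          destruct (Nat.eq_dec _ _); ring. }
      rewrite Rplus_0_r. eapply Rle_trans; [|apply (Hrow a' Ha)]. right. apply sumR_ext. intros p Hp.
      rewrite dw_emb0, dL_00, emb_div by (auto; lia). reflexivity.
    + rewrite dw_S by auto.
      rewrite (sumR_zero (D * S N)).
      2:{ intros p Hp. rewrite dw_emb0, dL_S0 by auto. specialize (Hw a Ha).
          destruct (Nat.eq_dec _ _); [|auto].
          destruct (Nat.ltb_spec (w (p mod D)%nat) (w a)); [ring|lia]. }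
      rewrite (sumR_single m _ j Hj).
      2:{ intros i Hi Hij. apply sumR_zero. intros p Hp. rewrite dL_SS by auto.
          destruct (Nat.eq_dec i j); [contradiction|]. destruct (Nat.eq_dec _ _); ring. }
      rewrite Rplus_0_l. eapply Rle_trans; [|apply (Hrow a Ha)]. apply sumR_le. intros p Hp.
      rewrite dw_embS, dL_SS, emb_div by (auto; lia).
      destruct (Nat.eq_dec j j) as [_|]; [|contradiction].
      assert (Hb : (p mod D < D)%nat) by (eapply mod_lt_block; eauto).
      (* Weights are at least 2 here, so the truncated subtraction of 1 keeps distinct weights
         distinct. *)
      pose proof (Hw a Ha). pose proof (Hw _ Hb).
      destruct (Nat.eq_dec (w (p mod D) - 1) (w a - 1)), (Nat.eq_dec (w (p mod D)%nat) (w a)); try lia; [|lra].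
      replace (p / D * w a)%nat with (p / D + p / D * (w a - 1))%nat by nia.
      rewrite pow_add.
      assert (H1 : Rabs (lam j) ^ (p / D) <= l ^ (p / D)).
      { apply pow_incr. split; [apply Rabs_pos|auto]. }
      assert (H2 : 0 <= L a p * l ^ (p / D * (w a - 1))).
      { apply Rmult_le_pos; [auto|apply pow_le; lra]. }
      replace (Rabs (lam j) ^ (p / D) * L a p * l ^ (p / D * (w a - 1))) with
        (L a p * l ^ (p / D * (w a - 1)) * Rabs (lam j) ^ (p / D)) by ring.
      replace (L a p * (l ^ (p / D) * l ^ (p / D * (w a - 1)))) with
        (L a p * l ^ (p / D * (w a - 1)) * l ^ (p / D)) by ring.
      now apply Rmult_le_compat_l.
  - intros a' Ha'. destruct (derived_index a' Ha') as [Ha|[j [a [Hj [Ha ->]]]]].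
    + rewrite dw_0 by auto. specialize (Hw a' Ha). lia.
    + rewrite dw_S by auto. specialize (Hw a Ha). lia.
  - apply dP0_C.
  - intros a' Ha'. destruct (derived_index a' Ha') as [Ha|[j [a [Hj [Ha ->]]]]].
    + rewrite dw_0 by auto. apply (flat_ext s (w a') m
        (fun z => F (Lstack D lam P0 z) a' - P0 z a') _ 1); [lra| |].
      * intros z _. rewrite dF_block0, proj_Lstack, dP0_block0 by auto.
        rewrite (Lstack_agree dP0 P0); [reflexivity|]. intros; now apply dP0_block0.
      * apply flat_pred, Herr, Ha.
    + rewrite dw_S by auto.
      destruct (Herr a Ha) as [_ Hfl]. destruct (Hfl j Hj) as [e [[r1 [Hr1 He]] Hfe]].
      destruct (Lstack_near m N lam l Hlam Hl D P0 delta Hdel) as [r2 [Hr2 Hnear]].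
      { intros b Hb. apply (HdP1 b Hb). exact I. }
      pose proof (Rmin_l r1 r2). pose proof (Rmin_r r1 r2).
      apply (flat_ext s (w a - 1) m e _ (Rmin r1 r2)); [apply Rmin_glb_lt; auto| |exact Hfe].
      intros z Hz. rewrite dF_Lstack_S, dP0_blockS by auto.
      rewrite (Lstack_agree dP0 P0) by (intros; now apply dP0_block0).
      (* [flat] supplies some derivative [e] of the residual; uniqueness of the limit identifies it
         with the residual of the derived system. *)
      apply (uniqueness_limite (fun t => F (Lstack D lam P0 (upd z j t)) a - P0 (upd z j t) a) (z j)).
      * apply He. eapply ball0_mono; [|exact Hz]; lra.
      * apply (derivable_pt_lim_minus (fun t => F (Lstack D lam P0 (upd z j t)) a)
          (fun t => P0 (upd z j t) a)); [|apply (HdP1 a Ha); auto].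
        assert (HpL : partial_on (ball0 m (Rmin r1 r2)) j (fun z => F (Lstack D lam P0 z) a)
          (fun z => sumR (D * S N) (fun p => lam j ^ (p / D) * g a p (Lstack D lam P0 z) *
             dP (p mod D)%nat j (Lpow lam (p / D) z)))).
        { apply (partial_Lstack (Rmin r1 r2) P0 (fun b => dP b j)); auto.
          - intros y Hy. apply Hnear. eapply ball0_mono; [|exact Hy]; lra.
          - intros b Hb y _. apply (HdP1 b Hb); auto. }
        eapply derivable_pt_lim_eq; [| |apply (HpL z Hz)]; [reflexivity|].
        apply sumR_ext. intros p Hp.
        rewrite dP0_blockS; [reflexivity|]. eapply mod_lt_block; eauto.
Qed.

(** Iteration and differentiation commute: the chain rule for [F] at an iterate is exactly one step
    of [dF] on block [S j]. Membership in the domain is carried along because the chain rule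
    requires it. *)
Lemma derived_iter rho delta' : delta' <= delta ->
  (forall n z, ball0 m rho z ->
     dom D' N lam dP0 delta' (Lstack D' lam (iter D' lam dF dP0 n) z)) ->
  forall n,
  (forall z a, ball0 m rho z -> (a < D)%nat -> iter D' lam dF dP0 n z a = iter D lam F P0 n z a) /\
  (forall z, ball0 m rho z -> dom D N lam P0 delta (Lstack D lam (iter D lam F P0 n) z)) /\
  (forall j a, (j < m)%nat -> (a < D)%nat -> partial_on (ball0 m rho) j
     (fun z => iter D lam F P0 n z a) (fun z => iter D' lam dF dP0 n z (S j * D + a)%nat)).
Proof.
  intros Hd' Hdom n.
  set (it' := iter D' lam dF dP0). set (it := iter D lam F P0).
  assert (Hst : forall n, (forall z a, ball0 m rho z -> (a < D)%nat -> it' n z a = it n z a) ->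
    forall z, ball0 m rho z -> Lstack D lam (it' n) z = Lstack D lam (it n) z).
  { intros k Hk z Hz. apply functional_extensionality; intros p. unfold Lstack, stack.
    apply Hk; [eapply Lpow_ball; eauto|]. apply Nat.mod_upper_bound. lia. }
  assert (Hdm : forall n, (forall z a, ball0 m rho z -> (a < D)%nat -> it' n z a = it n z a) ->
    forall z, ball0 m rho z -> dom D N lam P0 delta (Lstack D lam (it n) z)).
  { intros k Hk z Hz. specialize (Hdom k z Hz). apply proj_dom in Hdom; [|auto].
    rewrite proj_Lstack in Hdom. fold it' in Hdom. rewrite Hst in Hdom by auto.
    eapply box_mono; [|exact Hdom]; lra. }
  induction n as [|n [IH1 [IH2 IH3]]].
  - assert (H0 : forall z a, ball0 m rho z -> (a < D)%nat -> it' O z a = it O z a).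
    { intros z a _ Ha. now apply dP0_block0. }
    split; [auto|]. split; [now apply Hdm|].
    intros j a Hj Ha z Hz. unfold it', it. cbn [iter]. rewrite dP0_blockS by auto.
    now apply (HdP1 a Ha).
  - assert (H0 : forall z a, ball0 m rho z -> (a < D)%nat -> it' (S n) z a = it (S n) z a).
    { intros z a Hz Ha. unfold it', it. cbn [iter]. rewrite dF_block0, proj_Lstack by auto.
      fold it' it. now rewrite Hst. }
    split; [auto|]. split; [now apply Hdm|].
    intros j a Hj Ha z Hz. unfold it', it. cbn [iter]. rewrite dF_Lstack_S by auto. fold it' it.
    rewrite Hst by auto.
    apply (partial_Lstack rho (it n) (fun b z => it' n z (S j * D + b)%nat) j Hj IH2
      (fun b Hb => IH3 j b Hj Hb) a Ha z Hz).
Qed.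

(** Block 0 occupies the first [D] components, so the same [P'] serves both systems and the ball
    does not shrink. Uniform convergence of the derivative blocks gives termwise differentiation. *)
Lemma derived_limit delta' rho P' : delta' <= delta ->
  invariant_limit m N lam s D' dF dw dP0 delta' rho P' ->
  invariant_limit m N lam (S s) D F w P0 delta rho P'.
Proof.
  intros Hd' [Hrho Hdom Hunif HC HdomP Hfix Hclose].
  pose proof (derived_iter rho delta' Hd' Hdom) as Hit.
  assert (HaD : forall a, (a < D)%nat -> (a < D')%nat) by (intros a Ha; unfold D'; nia).
  assert (HajD : forall j a, (j < m)%nat -> (a < D)%nat -> (S j * D + a < D')%nat).
  { intros j a Hj Ha. unfold D'. apply block_lt; lia. }
  split; auto.
  - intros n z Hz. now apply Hit.
  - intros a Ha eps He. destruct (Hunif a (HaD a Ha) eps He) as [n0 Hn0]. exists n0.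
    intros n z Hn Hz. destruct (Hit n) as [Hi _]. rewrite <- Hi by auto. auto.
  - intros a Ha. apply (Ck_of_partial _ _ _ _ (fun j z => P' z (S j * D + a)%nat)).
    { intros z Hz. apply (Ck_cont s m (ball0 m rho)); auto. }
    intros j Hj. split; [|now apply HC, HajD].
    intros z Hz.
    destruct (open_upd m (ball0 m rho) z j (ball0_open m rho) Hz) as [e [He Hu]].
    assert (HB : forall t, Boule (z j) (mkposreal e He) t -> ball0 m rho (upd z j t)).
    { intros t Ht. apply Hu. exact Ht. }
    pose proof (CVU_derivable (fun n t => iter D lam F P0 n (upd z j t) a)
      (fun n t => iter D' lam dF dP0 n (upd z j t) (S j * D + a)%nat)
      (fun t => P' (upd z j t) a) (fun t => P' (upd z j t) (S j * D + a)%nat)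
      (z j) (mkposreal e He)) as HCVU.
    specialize (fun h1 h2 h3 => HCVU h1 h2 h3 (z j)). cbv beta in HCVU. rewrite upd_id in HCVU.
    apply HCVU.
    + intros eps Heps. destruct (Hunif _ (HajD j a Hj Ha) eps Heps) as [n0 Hn0]. exists n0.
      intros n t Hn Ht. rewrite Rabs_minus_sym. apply Hn0; auto.
    + intros t Ht eps Heps. destruct (Hunif a (HaD a Ha) eps Heps) as [n0 Hn0]. exists n0.
      intros n Hn. unfold R_dist. destruct (Hit n) as [Hi _]. rewrite <- Hi by auto. apply Hn0; auto.
    + intros n t Ht. destruct (Hit n) as [_ [_ Hp]].
      apply (partial_on_line _ _ _ _ z t (Hp j a Hj Ha)). now apply HB.
    + unfold Boule. simpl. rewrite Rminus_diag, Rabs_R0. lra.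
  - intros z Hz. specialize (HdomP z Hz). apply proj_dom in HdomP; [|auto].
    rewrite proj_Lstack in HdomP. eapply box_mono; [|exact HdomP]; lra.
  - intros z a Hz Ha. specialize (Hfix z a Hz (HaD a Ha)).
    rewrite dF_block0, proj_Lstack in Hfix by auto. exact Hfix.
  - intros a Ha. specialize (Hclose a (HaD a Ha)). rewrite dw_0 in Hclose by auto.
    apply (bigO_ext m (w a) (fun z => P' z a - dP0 z a) _ 1); [lra| |auto].
    intros z _. now rewrite dP0_block0.
Qed.
End Derived.

(** One unit of [s] is traded for a system [S m] times as large, so the induction ranges over all
    systems at once. *)
Theorem graded_limit m N lam l : (forall j, (j < m)%nat -> Rabs (lam j) <= l) -> 0 <= l <= 1 ->
  forall s D F w P0 theta delta L, graded_system m N lam l s D F w P0 theta delta L ->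
  exists rho P, invariant_limit m N lam s D F w P0 delta rho P.
Proof.
  intros Hlam Hl. induction s as [|s IH]; intros D F w P0 theta delta L G.
  - eapply graded_limit0; eauto.
  - destruct (fin_choice (fun _ _ => 0) D (fun a (g : nat -> (nat -> R) -> R) =>
       C1_on (D * S N) (dom D N lam P0 delta) (fun X => F X a) g /\
       forall p, (p < D * S N)%nat -> Ck (S s) (D * S N) (dom D N lam P0 delta) (g p))) as [g Hg].
    { intros a Ha. apply Ck_partial. apply (gs_C _ _ _ _ _ _ _ _ _ _ _ _ G a Ha). }
    destruct (fin_choice (fun _ _ => 0) D (fun a (dP : nat -> (nat -> R) -> R) =>
       C1_on m (fun _ => True) (fun z => P0 z a) dP /\
       forall j, (j < m)%nat -> Ck s m (fun _ => True) (dP j))) as [dP HdP].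
    { intros a Ha. apply Ck_partial. apply (gs_P0 _ _ _ _ _ _ _ _ _ _ _ _ G a Ha). }
    destruct (derived_system m N lam l Hlam Hl s D F w P0 theta delta L G g
      (fun a Ha => proj1 (Hg a Ha)) (fun a p Ha => proj2 (Hg a Ha) p) dP
      (fun a Ha => proj1 (HdP a Ha)) (fun a j Ha => proj2 (HdP a Ha) j)) as [delta' [L' [Hd' G']]].
    destruct (IH _ _ _ _ _ _ _ G') as [rho [P HP]]. exists rho, P.
    eapply derived_limit; eauto.
    + intros a Ha; apply (Hg a Ha).
    + intros a Ha; apply (HdP a Ha).
Qed.

(** * The approximate solution and the fixed point *)

Definition incr (al : nat -> nat) (j : nat) : nat -> nat :=
  fun i => if Nat.eq_dec i j then S (al i) else al i.

Lemma sumN_incr_ge m al j : (m <= j)%nat -> sumN m (incr al j) = sumN m al.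
Proof.
  induction m as [|m IH]; intros H; simpl; [reflexivity|]. rewrite IH by lia.
  unfold incr. destruct (Nat.eq_dec m j); lia.
Qed.

Lemma sumN_incr m al j : (j < m)%nat -> sumN m (incr al j) = S (sumN m al).
Proof.
  induction m as [|m IH]; intros H; [lia|]. simpl.
  destruct (Nat.eq_dec j m) as [->|].
  - rewrite sumN_incr_ge by lia. unfold incr. destruct (Nat.eq_dec m m); lia.
  - rewrite IH by lia. unfold incr. destruct (Nat.eq_dec m j); lia.
Qed.

Lemma mpow_incr_ge m lam al j : (m <= j)%nat -> mpow m lam (incr al j) = mpow m lam al.
Proof.
  unfold mpow. induction m as [|m IH]; intros H; simpl; [reflexivity|]. rewrite IH by lia.
  unfold incr. destruct (Nat.eq_dec m j); [lia|reflexivity].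
Qed.

Lemma mpow_incr m lam al j : (j < m)%nat -> mpow m lam (incr al j) = lam j * mpow m lam al.
Proof.
  induction m as [|m IH]; intros H; [lia|].
  destruct (Nat.eq_dec j m) as [->|].
  - pose proof (mpow_incr_ge m lam al m (le_n m)) as E. unfold mpow in *. simpl. rewrite E.
    unfold incr. destruct (Nat.eq_dec m m); [simpl; ring|lia].
  - specialize (IH ltac:(lia)). unfold mpow in *. simpl. rewrite IH.
    unfold incr. destruct (Nat.eq_dec m j); [lia|ring].
Qed.

Lemma mpow_0 m lam : mpow m lam (fun _ => O) = 1.
Proof. unfold mpow. induction m as [|m IH]; simpl in *; [reflexivity|]. rewrite IH. ring. Qed.

Lemma sumN_0 m : sumN m (fun _ => O) = O.
Proof. induction m as [|m IH]; simpl; lia. Qed.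

(* The scalar [c] accumulates the eigenvalues of the variables split off so far. *)
Lemma solve_homogeneous d N m B lam n : forall (e : nat -> (nat -> R) -> R) c,
  (forall i, (i < d)%nat -> Hom m n (e i)) ->
  (forall al, sumN m al = n -> Fdet d N B (c * mpow m lam al) <> 0) ->
  exists h : nat -> (nat -> R) -> R, (forall i, (i < d)%nat -> Hom m n (h i)) /\
    forall z i, (i < d)%nat ->
      sumR (S N) (fun k => c ^ k * sumR d (fun b => B k i b * h b (Lpow lam k z))) = e i z.
Proof.
  induction n as [|n IH]; intros e c He Hdet.
  (* In degree 0 all arguments [Lambda^k z] have become irrelevant and the equation is the linear
     system with matrix [Tmat N B c], invertible by the assumption on [Fdet]. *)
  - specialize (Hdet (fun _ => O) (sumN_0 m)). rewrite mpow_0, Rmult_1_r in Hdet.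
    destruct (DetBridge.det_solvable d (Tmat N B c) Hdet (fun i => e i zerov)) as [h Hh].
    exists (fun b _ => h b). split; [intros i Hi; exists (h i); auto|].
    intros z i Hi. destruct (He i Hi) as [q Hq]. rewrite Hq, <- (Hq zerov), <- (Hh i Hi).
    unfold Tmat.
    transitivity (sumR (S N) (fun k => sumR d (fun b => c ^ k * B k i b * h b))).
    + apply sumR_ext. intros k Hk. rewrite <- sumR_scal. apply sumR_ext. intros; ring.
    + rewrite sumR_swap. apply sumR_ext. intros b Hb.
      rewrite (Rmult_comm _ (h b)), <- sumR_scal. apply sumR_ext. intros; ring.
  - destruct (fin_choice (fun _ _ => 0) d (fun i (e' : nat -> (nat -> R) -> R) =>
      (forall j, (j < m)%nat -> Hom m n (e' j)) /\
      forall z, e i z = sumR m (fun j => z j * e' j z))) as [e' He'].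
    { intros i Hi. exact (He i Hi). }
    destruct (fin_choice (fun _ _ => 0) m (fun j (h : nat -> (nat -> R) -> R) =>
      (forall i, (i < d)%nat -> Hom m n (h i)) /\
      forall z i, (i < d)%nat -> sumR (S N) (fun k => (c * lam j) ^ k *
         sumR d (fun b => B k i b * h b (Lpow lam k z))) = e' i j z)) as [h Hh].
    { intros j Hj. apply IH.
      - intros i Hi. now apply He'.
      - intros al Hal. rewrite Rmult_assoc, <- mpow_incr by auto. apply Hdet.
        rewrite sumN_incr by auto. lia. }
    exists (fun b z => sumR m (fun j => z j * h j b z)). split.
    + intros i Hi. exists (fun j => h j i). split; [|reflexivity]. intros j Hj. now apply Hh.
    + intros z i Hi. rewrite (proj2 (He' i Hi)).
      transitivity (sumR (S N) (fun k => sumR m (fun j => z j * ((c * lam j) ^ k *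
         sumR d (fun b => B k i b * h j b (Lpow lam k z)))))).
      * apply sumR_ext. intros k Hk.
        transitivity (c ^ k * sumR d (fun b => sumR m (fun j =>
          lam j ^ k * z j * (B k i b * h j b (Lpow lam k z))))).
        { f_equal. apply sumR_ext. intros b Hb. rewrite <- sumR_scal. apply sumR_ext. intros j Hj.
          unfold Lpow at 1. ring. }
        rewrite sumR_swap, <- sumR_scal. apply sumR_ext. intros j Hj. rewrite sumR_scal.
        rewrite Rpow_mult_distr. ring.
      * rewrite sumR_swap. apply sumR_ext. intros j Hj. rewrite sumR_scal. f_equal.
        now apply Hh.
Qed.

(** * Second-order remainders and operator norms *)

Lemma bigO_dominated m n f g r : 0 < r -> (forall z, ball0 m r z -> Rabs (f z) <= g z) ->
  bigO m n g -> bigO m n f.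
Proof.
  intros Hr H [C [r1 [Hr1 H1]]]. exists C, (Rmin r r1).
  pose proof (Rmin_l r r1). pose proof (Rmin_r r r1).
  split; [apply Rmin_glb_lt; auto|]. intros z Hz.
  eapply Rle_trans; [apply H; eapply ball0_mono; [|exact Hz]; lra|].
  eapply Rle_trans; [apply Rle_abs|]. apply H1. eapply ball0_mono; [|exact Hz]; lra.
Qed.

Lemma bigO_abs m n f : bigO m n f -> bigO m n (fun z => Rabs (f z)).
Proof. intros [C [r [Hr H]]]. exists C, r. split; [auto|]. intros z Hz. rewrite Rabs_Rabsolu. auto. Qed.

Lemma supnorm_le_sum n x : supnorm n x <= sumR n (fun p => Rabs (x p)).
Proof.
  apply supnorm_le; [apply sumR_nonneg; intros; apply Rabs_pos|].
  intros p Hp. apply (sumR_term_le n (fun p => Rabs (x p))); [intros; apply Rabs_pos|auto].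
Qed.

Lemma bigO_supnorm m k n (X : (nat -> R) -> nat -> R) :
  (forall p, (p < n)%nat -> bigO m k (fun z => X z p)) -> bigO m k (fun z => supnorm n (X z)).
Proof.
  intros H. apply (bigO_dominated m k _ (fun z => sumR n (fun p => Rabs (X z p))) 1); [lra| |].
  - intros z _. rewrite Rabs_right by (apply Rle_ge, supnorm_nonneg). apply supnorm_le_sum.
  - apply (bigO_sumR m k n (fun p z => Rabs (X z p))). intros p Hp. now apply bigO_abs, H.
Qed.

Lemma bigO_small m f eps : bigO m 1 f -> 0 < eps ->
  exists r, 0 < r /\ forall z, ball0 m r z -> Rabs (f z) < eps.
Proof.
  intros H He. destruct (bigO_pos _ _ _ H) as [C [r [HC [Hr HH]]]].
  exists (Rmin r (eps / (C + 1))). assert (0 < eps / (C + 1)) by (apply Rdiv_lt_0_compat; lra).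
  pose proof (Rmin_l r (eps / (C + 1))). pose proof (Rmin_r r (eps / (C + 1))).
  split; [apply Rmin_glb_lt; lra|]. intros z Hz.
  specialize (HH z ltac:(eapply ball0_mono; [|exact Hz]; lra)). rewrite pow_1 in HH.
  unfold ball0 in Hz. pose proof (supnorm_nonneg m z).
  eapply Rle_lt_trans; [exact HH|]. apply Rle_lt_trans with ((C + 1) * supnorm m z); [nra|].
  apply Rlt_le_trans with ((C + 1) * (eps / (C + 1))); [apply Rmult_lt_compat_l; lra|].
  right; field; lra.
Qed.

Lemma bigO_Lpow m lam l n f k : (forall j, (j < m)%nat -> Rabs (lam j) <= l) -> 0 <= l <= 1 ->
  bigO m n f -> bigO m n (fun z => f (Lpow lam k z)).
Proof.
  intros Hlam Hl H. destruct (bigO_pos _ _ _ H) as [C [r [HC [Hr HH]]]].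
  exists C, r. split; [lra|]. intros z Hz.
  eapply Rle_trans; [apply HH; eapply Lpow_ball; eauto|].
  apply Rmult_le_compat_l; [auto|]. apply pow_incr. split; [apply supnorm_nonneg|].
  eapply Lpow_norm_le; eauto.
Qed.

Lemma bigO_coord m p : (p < m)%nat -> bigO m 1 (fun z => z p).
Proof.
  intros Hp. exists 1, 1. split; [lra|]. intros z _. rewrite pow_1, Rmult_1_l. now apply supnorm_ge.
Qed.

(** The partials are locally Lipschitz, so on a box of radius comparable to |x| + |y| they differ
    from their values at 0 by a multiple of that size. The mean value bound with slopes [g p zerov]
    does the rest. *)
Lemma second_order_estimate n U f g : is_open n U -> U zerov -> C1_on n U f g ->
  (forall p, (p < n)%nat -> Ck 1 n U (g p)) ->
  exists K eta, 0 < eta /\ forall x y, ball0 n eta x -> ball0 n eta y ->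
    Rabs (f y - f x - sumR n (fun p => g p zerov * (y p - x p))) <=
      K * (supnorm n x + supnorm n y) * sumR n (fun p => Rabs (y p - x p)).
Proof.
  intros HU H0 [Hc Hg] HC.
  destruct (is_open_sub_box n U zerov HU H0) as [r0 [Hr0 HU0]].
  destruct (fin_bound_pos n (fun p K r => r <= r0 /\ forall z, box n zerov r z ->
     Rabs (g p z - g p zerov) <= K * sumR n (fun q => Rabs (z q)))) as [K [r [HK [Hr H]]]].
  { intros p K K' r r' HKK Hr [Hrr H]. split; [lra|]. intros z Hz.
    eapply Rle_trans; [apply H; eapply box_mono; [|exact Hz]; lra|].
    apply Rmult_le_compat_r; [|auto]. apply sumR_nonneg. intros; apply Rabs_pos. }
  { intros p Hp. destruct (C1_locally_lipschitz n zerov r0 (g p) Hr0) as [K [r [HK [Hr H]]]].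
    - apply (Ck_sub 1 n U); auto.
    - exists K, r. split; [lra|]. split; [lra|]. intros z Hz.
      eapply Rle_trans; [apply (H zerov z); [apply box_center; lra|auto]|].
      right. f_equal. apply sumR_ext. intros q Hq. unfold zerov. now rewrite Rminus_0_r. }
  exists (2 * K * INR n), (Rmin r0 r / 2).
  pose proof (Rmin_l r0 r). pose proof (Rmin_r r0 r).
  assert (Hm : 0 < Rmin r0 r) by (apply Rmin_glb_lt; auto).
  split; [lra|]. intros x y Hx Hy.
  set (sg := supnorm n x + supnorm n y).
  assert (Hsx : 0 <= supnorm n x) by apply supnorm_nonneg.
  assert (Hsy : 0 <= supnorm n y) by apply supnorm_nonneg.
  unfold ball0 in Hx, Hy. assert (Hs : 0 <= sg < Rmin r0 r) by (unfold sg; lra).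
  (* If the size is 0 there is no box of comparable radius; then [x], [y] and [zerov] agree on the
     first [n] coordinates. *)
  destruct (Req_dec sg 0) as [E|E].
  - assert (Hxy : forall p, (p < n)%nat -> x p = 0 /\ y p = 0).
    { intros p Hp. pose proof (supnorm_ge n x p Hp). pose proof (supnorm_ge n y p Hp).
      pose proof (Rabs_pos (x p)). pose proof (Rabs_pos (y p)). unfold sg in E.
      split; (match goal with |- ?u = 0 => destruct (Req_dec u 0) as [|Hn]; [auto|apply Rabs_pos_lt in Hn; lra] end). }
    assert (f y = f x).
    { transitivity (f zerov); [|symmetry]; apply (cont_at_local n); auto;
        intros p Hp; apply (Hxy p Hp). }
    rewrite !sumR_zero, E, H3.
    + rewrite Rminus_diag, Rminus_0_r, Rabs_R0. lra.
    + intros p Hp. destruct (Hxy p Hp) as [-> ->]. now rewrite Rminus_0_r, Rabs_R0.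
    + intros p Hp. destruct (Hxy p Hp) as [-> ->]. ring.
  (* The radius [et'] lies strictly above [sg], is at most [2 * sg], and stays below [Rmin r0 r],
     where the Lipschitz bounds hold. *)
  - set (et := (sg + Rmin r0 r) / 2).
    set (et' := Rmin et (2 * sg)).
    assert (Het : sg < et' /\ et' <= et /\ et' <= 2 * sg).
    { unfold et'. split; [apply Rmin_glb_lt; unfold et; lra|]. split; [apply Rmin_l|apply Rmin_r]. }
    pose proof (mean_value_box n zerov et' f g (fun p => g p zerov)
      (fun _ => K * (INR n * (2 * sg))) x y) as Hmv.
    assert (Hin : forall z, box n zerov et' z -> box n zerov r0 z /\ box n zerov r z).
    { intros z Hz. unfold et in Het. split; (eapply box_mono; [|exact Hz]; lra). }
    cbv beta in Hmv. rewrite (sumR_scal n (K * (INR n * (2 * sg)))) in Hmv.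
    eapply Rle_trans; [apply Hmv|right; ring].
    + intros z Hz. apply Hc, HU0. now apply Hin.
    + intros p Hp z Hz. apply Hg; [auto|]. apply HU0. now apply Hin.
    + intros p z Hp Hz. destruct (H p Hp) as [_ Hpz].
      eapply Rle_trans; [apply Hpz; now apply Hin|]. apply Rmult_le_compat_l; [lra|].
      rewrite <- sumR_const. apply sumR_le. intros q Hq. specialize (Hz q Hq).
      unfold zerov in Hz. rewrite Rminus_0_r in Hz. lra.
    + intros p Hp. unfold zerov. rewrite Rminus_0_r.
      pose proof (supnorm_ge n x p Hp). unfold sg in *. lra.
    + intros p Hp. unfold zerov. rewrite Rminus_0_r.
      pose proof (supnorm_ge n y p Hp). unfold sg in *. lra.
Qed.

(** This makes the correction of each degree a linear problem: the nonlinear effect of a change of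
    order [k] carries an extra factor |X| + |Y| and is thus one order smaller. *)
Lemma second_order_bigO m k n U f g (X Y : (nat -> R) -> nat -> R) :
  is_open n U -> U zerov -> C1_on n U f g -> (forall p, (p < n)%nat -> Ck 1 n U (g p)) ->
  (forall p, (p < n)%nat -> bigO m 1 (fun z => X z p)) ->
  (forall p, (p < n)%nat -> bigO m 1 (fun z => Y z p)) ->
  (forall p, (p < n)%nat -> bigO m k (fun z => Y z p - X z p)) ->
  bigO m (S k) (fun z => f (Y z) - f (X z) - sumR n (fun p => g p zerov * (Y z p - X z p))).
Proof.
  intros HU H0 Hf Hg HX HY HXY.
  destruct (second_order_estimate n U f g HU H0 Hf Hg) as [K [eta [Heta H]]].
  destruct (bigO_small m _ eta (bigO_supnorm m 1 n X HX) Heta) as [r1 [Hr1 H1]].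
  destruct (bigO_small m _ eta (bigO_supnorm m 1 n Y HY) Heta) as [r2 [Hr2 H2]].
  pose proof (Rmin_l r1 r2). pose proof (Rmin_r r1 r2).
  apply (bigO_dominated m (S k) _ (fun z => K * (supnorm n (X z) + supnorm n (Y z)) *
    sumR n (fun p => Rabs (Y z p - X z p))) (Rmin r1 r2)).
  - apply Rmin_glb_lt; auto.
  - intros z Hz. apply H.
    + specialize (H1 z ltac:(eapply ball0_mono; [|exact Hz]; lra)).
      rewrite Rabs_right in H1 by (apply Rle_ge, supnorm_nonneg). exact H1.
    + specialize (H2 z ltac:(eapply ball0_mono; [|exact Hz]; lra)).
      rewrite Rabs_right in H2 by (apply Rle_ge, supnorm_nonneg). exact H2.
  - apply (bigO_mult m 1 k (fun z => K * (supnorm n (X z) + supnorm n (Y z)))).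
    + apply bigO_scal, bigO_plus; now apply bigO_supnorm.
    + apply (bigO_sumR m k n (fun p z => Rabs (Y z p - X z p))). intros p Hp. apply bigO_abs. auto.
Qed.

(** Test the operator on the sign vector of row [a]. This converts operator norms into the absolute
    row sums that graded systems use. *)
Lemma opnorm_row n A c a : (0 < n)%nat -> is_opnorm n A c -> (a < n)%nat ->
  sumR n (fun b => Rabs (A a b)) <= c.
Proof.
  intros Hn [H _] Ha.
  set (x := fun b => if Rle_dec 0 (A a b) then 1 else -1).
  assert (Hx : supnorm n x = 1).
  { assert (Hx1 : forall b, Rabs (x b) = 1).
    { intros b. unfold x. destruct (Rle_dec 0 (A a b)); [apply Rabs_R1|].
      rewrite Rabs_left; lra. }
    apply Rle_antisym.
    - apply supnorm_le; [lra|]. intros; rewrite Hx1; lra.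
    - rewrite <- (Hx1 O). now apply supnorm_ge. }
  specialize (H x). rewrite Hx, Rmult_1_r in H.
  eapply Rle_trans; [|exact H]. eapply Rle_trans; [|apply (supnorm_ge n _ a Ha)].
  eapply Rle_trans; [|apply Rle_abs]. right. unfold matvec. apply sumR_ext. intros b Hb.
  unfold x. destruct (Rle_dec 0 (A a b)); [rewrite Rabs_right|rewrite Rabs_left]; lra.
Qed.

Lemma opnorm_diag m lam c j : is_opnorm m (diagm lam) c -> (j < m)%nat -> Rabs (lam j) <= c.
Proof.
  intros H Hj. eapply Rle_trans; [|apply (opnorm_row m (diagm lam) c j); auto; lia].
  rewrite (sumR_single m _ j Hj).
  - unfold diagm. destruct (Nat.eq_dec j j); [lra|contradiction].
  - intros i Hi Hij. unfold diagm. destruct (Nat.eq_dec j i); [congruence|apply Rabs_R0].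
Qed.

(** In dimension 0 every constant, however negative, is admissible, so no least one exists. *)
Lemma opnorm_dim_pos m A c : is_opnorm m A c -> (0 < m)%nat.
Proof.
  intros [_ H]. destruct m as [|m]; [|lia]. exfalso.
  assert (c <= c - 1); [|lra]. apply H. intros x. simpl. rewrite Rmult_0_r. apply Rle_refl.
Qed.

Lemma derivable_of_quadratic phi c C r : 0 < r -> phi 0 = 0 ->
  (forall t, Rabs t < r -> Rabs (phi t - t * c) <= C * t ^ 2) -> derivable_pt_lim phi 0 c.
Proof.
  intros Hr H0 H eps He.
  set (d := Rmin r (eps / (Rabs C + 1))).
  assert (HC : 0 <= Rabs C) by apply Rabs_pos.
  assert (Hd : 0 < d) by (apply Rmin_glb_lt; [auto|apply Rdiv_lt_0_compat; lra]).
  exists (mkposreal d Hd). simpl. intros h Hn Hh.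
  assert (Hd1 : d <= r) by apply Rmin_l. assert (Hd2 : d <= eps / (Rabs C + 1)) by apply Rmin_r.
  rewrite Rplus_0_l, H0, Rminus_0_r. specialize (H h ltac:(lra)).
  replace (phi h / h - c) with ((phi h - h * c) / h) by (field; auto).
  assert (Hh0 : 0 < Rabs h) by now apply Rabs_pos_lt.
  unfold Rdiv. rewrite Rabs_mult, Rabs_inv. apply Rmult_lt_reg_r with (Rabs h); [auto|].
  rewrite Rmult_assoc, Rinv_l, Rmult_1_r by lra.
  replace (h ^ 2) with (Rabs h * Rabs h) in H by (rewrite <- (pow2_abs h); ring).
  eapply Rle_lt_trans; [exact H|]. rewrite <- Rmult_assoc. apply Rmult_lt_compat_r; [auto|].
  apply Rle_lt_trans with (Rabs C * Rabs h).
  { apply Rmult_le_compat_r; [lra|apply Rle_abs]. }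
  apply Rle_lt_trans with (Rabs C * (eps / (Rabs C + 1))); [apply Rmult_le_compat_l; lra|].
  apply Rmult_lt_reg_r with (Rabs C + 1); [lra|].
  replace (Rabs C * (eps / (Rabs C + 1)) * (Rabs C + 1)) with (Rabs C * eps) by (field; lra). nra.
Qed.

(** * The given equation: polynomial approximation and quasi-Newton map *)

Section Problem.
Variables (d N m r : nat) (U : (nat -> R) -> Prop) (Z : (nat -> R) -> (nat -> R))
  (B : nat -> nat -> nat -> R) (lam : nat -> R) (l : R) (v : nat -> nat -> R).
Hypothesis Hd : (0 < d)%nat.
Hypothesis Hr : (2 <= r)%nat.
Hypothesis HUopen : is_open (d * S N) U.
Hypothesis HU0 : U zerov.
Hypothesis HZ : Ck_vec (S r) (d * S N) d U Z.
Hypothesis HZ0 : forall i, (i < d)%nat -> Z zerov i = 0.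
Hypothesis HB : forall k i j, (k <= N)%nat -> (i < d)%nat -> (j < d)%nat ->
     derivable_pt_lim (fun t => Z (upd zerov (k * d + j) t) i) 0 (B k i j).
Hypothesis Hlam : forall j, (j < m)%nat -> Rabs (lam j) <= l.
Hypothesis Hl : 0 <= l <= 1.
Hypothesis Hnr : forall al : nat -> nat, (2 <= sumN m al)%nat -> Fdet d N B (mpow m lam al) <> 0.
Hypothesis Hv : forall j, (j < m)%nat -> forall i, (i < d)%nat ->
     matvec d (Tmat N B (lam j)) (v j) i = 0.

Lemma partial_at_zero i g p : (i < d)%nat -> (p < d * S N)%nat ->
  C1_on (d * S N) U (fun X => Z X i) g -> g p zerov = B (p / d)%nat i (p mod d)%nat.
Proof.
  intros Hi Hp [_ Hg]. destruct (Hg p Hp) as [H _]. specialize (H zerov HU0).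
  assert (Hk : (p / d < S N)%nat) by (apply div_lt_block; auto).
  pose proof (HB (p / d) i (p mod d) ltac:(lia) Hi ltac:(eapply mod_lt_block; eauto)) as H2.
  rewrite <- div_mod_block in H2.
  eapply uniqueness_limite; [exact H|exact H2].
Qed.

Lemma linear_part (Q : (nat -> R) -> nat -> R) i z :
  sumR (d * S N) (fun p => B (p / d)%nat i (p mod d)%nat * Lstack d lam Q z p) =
  sumR (S N) (fun k => sumR d (fun b => B k i b * Q (Lpow lam k z) b)).
Proof.
  rewrite sumR_mul. apply sumR_ext. intros k Hk. apply sumR_ext. intros b Hb.
  unfold Lstack, stack. now rewrite div_block, mod_block.
Qed.

Definition linV (z : nat -> R) (i : nat) : R := sumR m (fun j => z j * v j i).

(** Collecting the powers [lam j ^ k] belonging to each coordinate [z j] turns the linearised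
    equation into the eigenvector equations. *)
Lemma linV_kernel i z : (i < d)%nat ->
  sumR (S N) (fun k => sumR d (fun b => B k i b * linV (Lpow lam k z) b)) = 0.
Proof.
  intros Hi.
  transitivity (sumR m (fun j => z j * matvec d (Tmat N B (lam j)) (v j) i)).
  2:{ apply sumR_zero. intros j Hj. rewrite Hv by auto. ring. }
  transitivity (sumR (S N) (fun k => sumR m (fun j => z j *
     sumR d (fun b => lam j ^ k * B k i b * v j b)))).
  - apply sumR_ext. intros k Hk. unfold linV.
    transitivity (sumR d (fun b => sumR m (fun j => z j * (lam j ^ k * B k i b * v j b)))).
    + apply sumR_ext. intros b Hb. rewrite <- sumR_scal. apply sumR_ext. intros j Hj.
      unfold Lpow. ring.
    + rewrite sumR_swap. apply sumR_ext. intros j Hj. now rewrite sumR_scal.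
  - rewrite sumR_swap. apply sumR_ext. intros j Hj. rewrite sumR_scal. f_equal.
    unfold matvec, Tmat. rewrite sumR_swap. apply sumR_ext. intros b Hb.
    rewrite (Rmult_comm _ (v j b)), <- sumR_scal. apply sumR_ext. intros; ring.
Qed.

Lemma linV_bigO i : bigO m 1 (fun z => linV z i).
Proof.
  unfold linV. apply (bigO_sumR m 1 m (fun j z => z j * v j i)). intros j Hj.
  apply (bigO_ext m 1 (fun z => v j i * z j) _ 1); [lra|intros; ring|].
  now apply bigO_scal, bigO_coord.
Qed.

Lemma Lstack_bigO n Q : (forall i, (i < d)%nat -> bigO m n (fun z => Q z i)) ->
  forall p, (p < d * S N)%nat -> bigO m n (fun z => Lstack d lam Q z p).
Proof.
  intros H p Hp. unfold Lstack, stack.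
  apply (bigO_Lpow m lam l n (fun z => Q z (p mod d)%nat) _ Hlam Hl). apply H.
  eapply mod_lt_block; eauto.
Qed.

Lemma Lstack_zerov Q : (forall i, (i < d)%nat -> Q zerov i = 0) -> Lstack d lam Q zerov = zerov.
Proof.
  intros H. apply functional_extensionality; intros p. rewrite Lstack_at0. apply H.
  apply Nat.mod_upper_bound. lia.
Qed.

(** Being a polynomial is recorded only as smoothness of every order on every set; [as_V] fixes the
    linear part through all corrections. *)
Record approximate_solution (n : nat) (P : (nat -> R) -> nat -> R) : Prop := {
  as_C : forall k V i, (i < d)%nat -> Ck k m V (fun z => P z i);
  as_V : forall i, (i < d)%nat -> bigO m 2 (fun z => P z i - linV z i);
  as_O : forall i, (i < d)%nat -> bigO m (S n) (fun z => Z (Lstack d lam P z) i)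
}.

Lemma approximate_bigO n P : approximate_solution n P ->
  forall i, (i < d)%nat -> bigO m 1 (fun z => P z i).
Proof.
  intros [_ HV _] i Hi.
  apply (bigO_ext m 1 (fun z => (P z i - linV z i) + linV z i) _ 1); [lra|intros; ring|].
  apply bigO_plus; [|apply linV_bigO]. apply (bigO_le m 2); auto.
Qed.

Lemma approximate_zero n P : approximate_solution n P ->
  forall i, (i < d)%nat -> P zerov i = 0.
Proof. intros H i Hi. exact (bigO_at0 m 0 (fun z => P z i) (approximate_bigO n P H i Hi)). Qed.

Lemma approximate_residual_C n P : approximate_solution n P ->
  exists rho, 0 < rho /\ forall i, (i < d)%nat ->
    Ck (S r) m (ball0 m rho) (fun z => Z (Lstack d lam P z) i).
Proof.
  intros HP. pose proof (approximate_zero n P HP) as HP0.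
  destruct (is_open_sub_box _ U zerov HUopen HU0) as [dl [Hdl HUd]].
  destruct (Lstack_near m N lam l Hlam Hl d P dl Hdl) as [rho [Hrho Hnear]].
  { intros a Ha. apply (Ck_cont 0 m (fun _ => True)); [now apply HP|auto]. }
  exists rho. split; [auto|]. intros i Hi.
  apply (Ck_comp (S r) (d * S N) m U _ HUopen (fun X => Z X i) (Lstack d lam P)).
  - intros z Hz. apply HUd. specialize (Hnear z Hz). unfold dom in Hnear.
    rewrite Lstack_zerov in Hnear by auto. exact Hnear.
  - now apply HZ.
  - apply (Ck_Lstack m lam l Hlam Hl). intros a Ha. now apply HP.
Qed.

Lemma Z_second_order k i (X Y : (nat -> R) -> nat -> R) : (i < d)%nat ->
  (forall a, (a < d)%nat -> bigO m 1 (fun z => X z a)) ->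
  (forall a, (a < d)%nat -> bigO m 1 (fun z => Y z a)) ->
  (forall a, (a < d)%nat -> bigO m k (fun z => Y z a - X z a)) ->
  bigO m (S k) (fun z => Z (Lstack d lam Y z) i - Z (Lstack d lam X z) i -
    sumR (S N) (fun k => sumR d (fun b => B k i b * (Y (Lpow lam k z) b - X (Lpow lam k z) b)))).
Proof.
  intros Hi HX HY HXY.
  destruct (Ck_partial _ _ _ _ (HZ i Hi)) as [g [Hg HgC]].
  eapply (bigO_ext m (S k) (fun z => Z (Lstack d lam Y z) i - Z (Lstack d lam X z) i -
    sumR (d * S N) (fun p => g p zerov * (Lstack d lam Y z p - Lstack d lam X z p))) _ 1); [lra| |].
  - intros z _. f_equal. rewrite <- (linear_part (fun z b => Y z b - X z b)).
    apply sumR_ext. intros p Hp. rewrite (partial_at_zero i g p Hi Hp Hg). reflexivity.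
  - apply (second_order_bigO m k (d * S N) U (fun X => Z X i) g); auto.
    + intros p Hp. apply (Ck_le r); [lia|auto].
    + now apply Lstack_bigO.
    + now apply Lstack_bigO.
    + apply (Lstack_bigO k (fun z a => Y z a - X z a)). exact HXY.
Qed.

(** Compare [linV] with the zero solution: the linear part of [Z] at 0 annihilates [linV], and the
    remainder is quadratic. *)
Lemma approximate_start : approximate_solution 1 linV.
Proof.
  split.
  - intros k V i Hi. unfold linV. apply (Ck_sumR k m V m (fun j z => z j * v j i)).
    intros j Hj. apply Ck_mult; [now apply Ck_coord|apply Ck_const].
  - intros i Hi. apply (bigO_ext m 2 (fun _ => 0) _ 1); [lra|intros; ring|apply bigO_zero].
  - intros i Hi.
    pose proof (Z_second_order 1 i (fun _ _ => 0) linV Hi) as H.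
    eapply (bigO_ext m 2 _ _ 1); [lra| |apply H].
    + intros z _. cbv beta.
      replace (Lstack d lam (fun _ _ => 0) z) with zerov by reflexivity.
      rewrite HZ0, Rminus_0_r by auto.
      rewrite (sumR_ext (S N) _ (fun k => sumR d (fun b => B k i b * linV (Lpow lam k z) b))).
      * rewrite linV_kernel by auto. ring.
      * intros k Hk. apply sumR_ext. intros; ring.
    + intros; apply bigO_zero.
    + intros; apply linV_bigO.
    + intros a Ha. apply (bigO_ext m 1 (fun z => linV z a) _ 1); [lra|intros; ring|apply linV_bigO].
Qed.

(** The leading term [e] of the residual is removed by a homogeneous [h] that solves the linearised
    equation with right-hand side [-e]; by [Z_second_order] the remaining effect of [h] is one order
    smaller. *)
Lemma approximate_step n P : (1 <= n)%nat -> (S n <= r)%nat -> approximate_solution n P ->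
  exists Q, approximate_solution (S n) Q.
Proof.
  intros Hn Hnr' HP. pose proof (approximate_bigO n P HP) as HPO.
  destruct (approximate_residual_C n P HP) as [rho [Hrho HC]].
  destruct (fin_choice (fun _ => 0) d (fun i e => Hom m (S n) e /\
     bigO m (S (S n)) (fun z => Z (Lstack d lam P z) i - e z))) as [e He].
  { intros i Hi. apply (taylor_step m (S n) _ rho Hrho).
    - apply (Ck_le (S r)); [lia|]. now apply HC.
    - now apply HP. }
  (* The scalar starts at 1. Since [1 <= n], the degree [S n] is at least 2 and nonresonance covers
     every multi-index of this degree. *)
  destruct (solve_homogeneous d N m B lam (S n) (fun i z => (-1) * e i z) 1) as [h [Hh Hsol]].
  { intros i Hi. now apply Hom_scal, He. }
  { intros al Hal. rewrite Rmult_1_l. apply Hnr. lia. }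
  exists (fun z i => P z i + h i z).
  assert (HhO : forall i, (i < d)%nat -> bigO m (S n) (h i)) by (intros; now apply Hom_bigO, Hh).
  split.
  - intros k V i Hi. apply Ck_plus; [now apply HP|]. apply (Hom_Ck m (S n)). auto.
  - intros i Hi. apply (bigO_ext m 2 (fun z => (P z i - linV z i) + h i z) _ 1); [lra|intros; ring|].
    apply bigO_plus; [now apply HP|]. apply (bigO_le m (S n)); [lia|auto].
  - intros i Hi.
    pose proof (Z_second_order (S n) i P (fun z i => P z i + h i z) Hi HPO) as H.
    eapply (bigO_ext m (S (S n)) _ _ 1); [lra| |].
    2:{ apply (bigO_plus m (S (S n))); [apply H|apply (proj2 (He i Hi))].
      - intros a Ha. apply bigO_plus; [auto|]. apply (bigO_le m (S n)); [lia|auto].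
      - intros a Ha. apply (bigO_ext m (S n) (h a) _ 1); [lra|intros; ring|auto]. }
    intros z _. cbv beta.
    rewrite (sumR_ext (S N) _ (fun k => 1 ^ k * sumR d (fun b => B k i b * h b (Lpow lam k z)))).
    + rewrite Hsol by auto. ring.
    + intros k Hk. rewrite pow1, Rmult_1_l. apply sumR_ext. intros; ring.
Qed.

Lemma approximate_exists n : (1 <= n)%nat -> (n <= r)%nat -> exists P, approximate_solution n P.
Proof.
  induction n as [|n IH]; intros H1 H2; [lia|]. destruct n as [|n].
  - exists linV. apply approximate_start.
  - destruct IH as [P HP]; [lia|lia|]. apply (approximate_step (S n) P); auto; lia.
Qed.

Variables (B0inv : nat -> nat -> R) (kap : R).
Hypothesis HB0inv : is_inverse d (B 0%nat) B0inv.
Hypothesis Hkap : kap < 1.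
Hypothesis Hrow : forall a, (a < d)%nat ->
  sumR N (fun k => sumR d (fun b => Rabs (matmul d B0inv (B (S k)) a b)) * l ^ (S k * S r)) <= kap.

(** A Newton step in the block [P(z)] alone, with the derivative frozen at 0. For [a < d] the
    coordinate [X a] belongs to that block. *)
Definition newton (X : nat -> R) (a : nat) : R := X a - sumR d (fun i => B0inv a i * Z X i).

Lemma newton_C a : (a < d)%nat -> Ck (S r) (d * S N) U (fun X => newton X a).
Proof.
  intros Ha. unfold newton. apply Ck_minus; [apply Ck_coord; nia|].
  apply (Ck_sumR _ _ _ d (fun i X => B0inv a i * Z X i)). intros i Hi. apply Ck_scal. now apply HZ.
Qed.

Definition newton_slope (a p : nat) : R :=
  (if Nat.eq_dec p a then 1 else 0) - matmul d B0inv (B (p / d)%nat) a (p mod d)%nat.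

Lemma newton_partial a g p : (a < d)%nat -> (p < d * S N)%nat ->
  C1_on (d * S N) U (fun X => newton X a) g -> g p zerov = newton_slope a p.
Proof.
  intros Ha Hp [_ Hg]. destruct (Hg p Hp) as [H _]. specialize (H zerov HU0).
  eapply uniqueness_limite; [exact H|]. unfold newton, newton_slope.
  apply (derivable_pt_lim_minus (fun t => upd zerov p t a)
    (fun t => sumR d (fun i => B0inv a i * Z (upd zerov p t) i))).
  - destruct (Nat.eq_dec p a) as [->|Hn].
    + apply (derivable_pt_lim_eq id _ _ 1); [intros; now rewrite upd_same|auto|].
      apply derivable_pt_lim_id.
    + apply (derivable_pt_lim_eq (fun _ => 0) _ _ 0); [intros; now rewrite upd_other by auto|auto|].
      apply derivable_pt_lim_const.
  - unfold matmul. apply (derivable_pt_lim_sumR d (fun i t => B0inv a i * Z (upd zerov p t) i)).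
    intros i Hi. apply (derivable_pt_lim_scal (fun t => Z (upd zerov p t) i)).
    assert (Hk : (p / d < S N)%nat) by (apply div_lt_block; auto).
    pose proof (HB (p / d) i (p mod d) ltac:(lia) Hi ltac:(eapply mod_lt_block; eauto)) as H2.
    rewrite <- div_mod_block in H2. exact H2.
Qed.

(** The purpose of [B0inv]: it removes from the linearisation the one block that gains no
    contraction factor from [Lambda]. *)
Lemma newton_slope_block0 a b : (a < d)%nat -> (b < d)%nat -> newton_slope a b = 0.
Proof.
  intros Ha Hb. unfold newton_slope. rewrite Nat.div_small, Nat.mod_small by auto.
  rewrite (proj1 (HB0inv a b Ha Hb)). unfold idm.
  destruct (Nat.eq_dec b a), (Nat.eq_dec a b); try lia; ring.
Qed.

Lemma newton_slope_row a : (a < d)%nat ->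
  sumR (d * S N) (fun p => Rabs (newton_slope a p) * l ^ (p / d * S r)) <= kap.
Proof.
  intros Ha. eapply Rle_trans; [|apply (Hrow a Ha)]. right. rewrite sumR_mul, sumR_shift.
  rewrite (sumR_zero d), Rplus_0_l.
  - apply sumR_ext. intros k Hk. rewrite (Rmult_comm (sumR d _)), <- sumR_scal.
    apply sumR_ext. intros b Hb. rewrite div_block by auto. unfold newton_slope.
    rewrite div_block, mod_block by auto. destruct (Nat.eq_dec (S k * d + b) a); [nia|].
    replace (0 - matmul d B0inv (B (S k)) a b) with (- matmul d B0inv (B (S k)) a b) by ring.
    rewrite Rabs_Ropp. ring.
  - intros b Hb. replace (0 * d + b)%nat with b by lia. rewrite newton_slope_block0 by auto.
    rewrite Rabs_R0. ring.
Qed.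

Lemma newton_system P : approximate_solution r P ->
  exists theta delta L, (forall X, dom d N lam P delta X -> U X) /\
    graded_system m N lam l r d newton (fun _ => S r) P theta delta L.
Proof.
  intros HP. pose proof (approximate_zero r P HP) as HP0.
  assert (Hst0 : Lstack d lam P zerov = zerov) by (now apply Lstack_zerov).
  (* Enlarging each of the [d * S N] entries of a row by [eps] costs at most [(1 - kap) / 2], so the
     row sum stays within [(1 + kap) / 2]. *)
  set (eps := (1 - kap) / 2 / INR (d * S N)).
  assert (HINR : 0 < INR (d * S N)) by (apply lt_0_INR; nia).
  assert (Heps : 0 < eps) by (repeat apply Rdiv_lt_0_compat; lra).
  destruct (fin_choice (fun _ _ => 0) d (fun a (g : nat -> (nat -> R) -> R) =>
    C1_on (d * S N) U (fun X => newton X a) g)) as [g Hg].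
  { intros a Ha. destruct (Ck_partial _ _ _ _ (newton_C a Ha)) as [g [Hg _]]. eauto. }
  destruct (is_open_sub_box _ U zerov HUopen HU0) as [d0 [Hd0 HUd]].
  destruct (fin_pos d (fun a rr => forall p, (p < d * S N)%nat -> forall X, box (d * S N) zerov rr X ->
     Rabs (g a p X - g a p zerov) < eps)) as [d1 [Hd1 Hg1]].
  { intros a rr rr' Hrr H p Hp X HX. apply H; auto. eapply box_mono; [|exact HX]; lra. }
  { intros a Ha. apply (fin_pos (d * S N) (fun p rr => forall X, box (d * S N) zerov rr X ->
       Rabs (g a p X - g a p zerov) < eps)).
    - intros p rr rr' Hrr H X HX. apply H; auto. eapply box_mono; [|exact HX]; lra.
    - intros p Hp. destruct (Hg a Ha) as [_ Hga]. destruct (Hga p Hp) as [_ Hgc].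
      destruct (Hgc zerov HU0 eps Heps) as [rr [Hrr H]]. exists rr. split; auto. }
  set (delta := Rmin d0 d1). set (L := fun a p => Rabs (newton_slope a p) + eps).
  assert (Hdelta : 0 < delta) by (apply Rmin_glb_lt; auto).
  assert (Hbox : forall X, box (d * S N) zerov delta X -> U X /\ box (d * S N) zerov d1 X).
  { intros X HX. split.
    - apply HUd. eapply box_mono; [|exact HX]. apply Rmin_l.
    - eapply box_mono; [|exact HX]. apply Rmin_r. }
  exists ((1 + kap) / 2), delta, L. unfold dom. rewrite Hst0.
  split; [intros X HX; now apply Hbox|].
  destruct (approximate_residual_C r P HP) as [rho [Hrho HC]].
  split; unfold dom; rewrite ?Hst0; auto.
  - lra.
  - intros a Ha. apply (Ck_sub (S r) _ U); [intros X HX; now apply Hbox|]. now apply newton_C.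
  - intros a p. unfold L. pose proof (Rabs_pos (newton_slope a p)). lra.
  - intros a X Y Ha HX HY. destruct (Hg a Ha) as [Hgc Hgp].
    pose proof (mean_value_box (d * S N) zerov delta (fun X => newton X a) (g a)
      (fun _ => 0) (L a) Y X) as Hmv. cbv beta in Hmv.
    rewrite (sumR_zero (d * S N) (fun p => 0 * _)) in Hmv by (intros; ring).
    rewrite Rminus_0_r in Hmv. apply Hmv; auto.
    + intros z Hz. apply Hgc. now apply Hbox.
    + intros p Hp z Hz. apply (Hgp p Hp). now apply Hbox.
    + intros p z Hp Hz. rewrite Rminus_0_r. unfold L.
      rewrite <- (newton_partial a (g a) p Ha Hp (Hg a Ha)).
      replace (g a p z) with (g a p zerov + (g a p z - g a p zerov)) by ring.
      eapply Rle_trans; [apply Rabs_triang|]. apply Rplus_le_compat_l. left.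
      apply (Hg1 a Ha p Hp). now apply Hbox.
  - intros a p _ _ Hww. lia.
  - intros a Ha.
    apply Rle_trans with (sumR (d * S N) (fun p => Rabs (newton_slope a p) * l ^ (p / d * S r) + eps)).
    + apply sumR_le. intros p Hp. destruct (Nat.eq_dec _ _); [|lia]. unfold L.
      pose proof (pow_le_one l (p / d * S r) Hl). nra.
    + rewrite sumR_plus, sumR_const. pose proof (newton_slope_row a Ha).
      assert (INR (d * S N) * eps = (1 - kap) / 2) by (unfold eps; field; lra). lra.
  - intros a Ha. now apply HP.
  - intros a Ha.
    replace (fun z => newton (Lstack d lam P z) a - P z a) with
      (fun z => (-1) * sumR d (fun i => B0inv a i * Z (Lstack d lam P z) i)).
    (* The residual inherits class C^(r+1) from [Z], which turns its order of vanishing into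
       flatness for [r] derivatives. *)
    + apply (Ck_flat r (S r) m _ rho); auto.
      * apply Ck_scal. apply (Ck_sumR _ _ _ d (fun i z => B0inv a i * Z (Lstack d lam P z) i)).
        intros i Hi. apply Ck_scal. auto.
      * apply bigO_scal. apply (bigO_sumR m (S r) d (fun i z => B0inv a i * Z (Lstack d lam P z) i)).
        intros i Hi. apply bigO_scal. now apply HP.
    + apply functional_extensionality; intros z. unfold newton.
      unfold Lstack at 2, stack. rewrite Nat.div_small, Nat.mod_small, Lpow_0 by auto. ring.
Qed.

(** At a fixed point [B0inv] annihilates [Z X]; multiplying by [B 0] on the left recovers [Z X]
    itself. *)
Lemma newton_fixed X : (forall a, (a < d)%nat -> newton X a = X a) ->
  forall i, (i < d)%nat -> Z X i = 0.
Proof.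
  intros H i Hi.
  assert (H0 : forall a, (a < d)%nat -> sumR d (fun i => B0inv a i * Z X i) = 0).
  { intros a Ha. specialize (H a Ha). unfold newton in H. lra. }
  transitivity (sumR d (fun k => matmul d (B 0%nat) B0inv i k * Z X k)).
  - rewrite (sumR_single d _ i Hi).
    + rewrite (proj2 (HB0inv i i Hi Hi)). unfold idm. destruct (Nat.eq_dec i i); [ring|contradiction].
    + intros k Hk Hki. rewrite (proj2 (HB0inv i k Hi Hk)). unfold idm.
      destruct (Nat.eq_dec i k); [congruence|ring].
  - transitivity (sumR d (fun j => B 0%nat i j * sumR d (fun k => B0inv j k * Z X k))).
    + unfold matmul.
      transitivity (sumR d (fun k => sumR d (fun j => B 0%nat i j * B0inv j k * Z X k))).
      * apply sumR_ext. intros k Hk. rewrite (Rmult_comm _ (Z X k)), <- sumR_scal.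
        apply sumR_ext. intros; ring.
      * rewrite sumR_swap. apply sumR_ext. intros j Hj. rewrite <- sumR_scal.
        apply sumR_ext. intros; ring.
    + apply sumR_zero. intros j Hj. rewrite H0 by auto. ring.
Qed.

Lemma parameterization : exists rho P, 0 < rho /\
  (forall i, (i < d)%nat -> Ck r m (ball0 m rho) (fun z => P z i)) /\
  (forall i, (i < d)%nat -> bigO m 2 (fun z => P z i - linV z i)) /\
  (forall z, ball0 m rho z -> U (Lstack d lam P z) /\
     forall i, (i < d)%nat -> Z (Lstack d lam P z) i = 0).
Proof.
  destruct (approximate_exists r ltac:(lia) (le_n r)) as [P0 HP0].
  destruct (newton_system P0 HP0) as [theta [delta [L [HdU G]]]].
  destruct (graded_limit m N lam l Hlam Hl r d newton (fun _ => S r) P0 theta delta L G) as [rho [P HP]].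
  destruct HP as [Hrho _ _ HC HdomP Hfix Hclose].
  exists rho, P. split; [auto|]. split; [auto|]. split.
  - intros i Hi.
    apply (bigO_ext m 2 (fun z => (P z i - P0 z i) + (P0 z i - linV z i)) _ 1); [lra|intros; ring|].
    apply bigO_plus; [|now apply HP0]. apply (bigO_le m (S r)); [lia|auto].
  - intros z Hz. split; [apply HdU, HdomP, Hz|]. apply newton_fixed. intros a Ha.
    rewrite Hfix by auto. unfold Lstack, stack.
    now rewrite Nat.div_small, Nat.mod_small, Lpow_0 by auto.
Qed.
End Problem.

(** * The derivative at 0, the norm hypotheses and the closed disc *)

Lemma derivative_of_linear_approximation m v i f j : (j < m)%nat ->
  bigO m 2 (fun z => f z - linV m v z i) -> derivable_pt_lim (fun t => f (upd zerov j t)) 0 (v j i).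
Proof.
  intros Hj H. destruct (bigO_pos _ _ _ H) as [C [r [HC [Hr HH]]]].
  assert (Hlin : forall t, linV m v (upd zerov j t) i = t * v j i).
  { intros t. unfold linV. rewrite (sumR_single m _ j Hj).
    - now rewrite upd_same.
    - intros q Hq Hqj. rewrite upd_other by auto. unfold zerov. ring. }
  assert (Hn : forall t, supnorm m (upd zerov j t) <= Rabs t).
  { intros t. apply supnorm_le; [apply Rabs_pos|]. intros p Hp. unfold upd.
    destruct (Nat.eq_dec p j); [lra|]. unfold zerov. rewrite Rabs_R0. apply Rabs_pos. }
  apply (derivable_of_quadratic _ _ C r); [lra| |].
  - pose proof (bigO_at0 m 1 _ H) as H0. cbv beta in H0.
    change (upd zerov j 0) with (upd zerov j (zerov j)). rewrite upd_id.
    pose proof (Hlin 0) as Hl0. change (upd zerov j 0) with (upd zerov j (zerov j)) in Hl0.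
    rewrite upd_id in Hl0. lra.
  - intros t Ht. rewrite <- Hlin. eapply Rle_trans; [apply HH|].
    + unfold ball0. specialize (Hn t). lra.
    + apply Rmult_le_compat_l; [auto|]. rewrite <- (pow2_abs t). apply pow_incr.
      split; [apply supnorm_nonneg|auto].
Qed.

Theorem mainTheorem14
  (d N m r : nat) (Hr : (2 <= r)%nat)
  (U : (nat -> R) -> Prop) (Z : (nat -> R) -> (nat -> R))
  (HUopen : is_open (d * S N) U) (HU0 : U zerov)
  (HZ : Ck_vec (S r) (d * S N) d U Z)
  (HZ0 : forall i, (i < d)%nat -> Z zerov i = 0)
  (B : nat -> nat -> nat -> R)
  (HB : forall k i j, (k <= N)%nat -> (i < d)%nat -> (j < d)%nat ->
     derivable_pt_lim (fun t => Z (upd zerov (k * d + j) t) i) 0 (B k i j))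
  (B0inv : nat -> nat -> R) (HB0inv : is_inverse d (B 0%nat) B0inv)
  (lam : nat -> R) (Hlam : stable_nonresonant d N m B lam)
  (v : nat -> nat -> R)
  (Hv : forall j, (j < m)%nat -> forall i, (i < d)%nat ->
     matvec d (Tmat N B (lam j)) (v j) i = 0)
  (Hvind : forall c : nat -> R,
     (forall i, (i < d)%nat -> sumR m (fun j => c j * v j i) = 0) ->
     forall j, (j < m)%nat -> c j = 0)
  (normL : R) (HnormL : is_opnorm m (diagm lam) normL)
  (normB : nat -> R)
  (HnormB : forall k, (1 <= k <= N)%nat -> is_opnorm d (matmul d B0inv (B k)) (normB k))
  (Hmu : exists mu, normL ^ r <= mu /\ mu < 1 /\
     sumR N (fun k => mu ^ (S k) * normB (S k)) < 1) :
  exists (rho : R) (W : (nat -> R) -> Prop) (P : (nat -> R) -> (nat -> R)),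
    0 < rho /\ is_open m W /\
    (forall z, supnorm m z <= rho -> W z) /\
    Ck_vec r m d W P /\
    (forall i, (i < d)%nat -> P zerov i = 0) /\
    (forall i j, (i < d)%nat -> (j < m)%nat ->
       derivable_pt_lim (fun t => P (upd zerov j t) i) 0 (v j i)) /\
    (forall z, supnorm m z <= rho ->
       U (stack d (fun k => P (Lpow lam k z))) /\
       forall i, (i < d)%nat -> Z (stack d (fun k => P (Lpow lam k z))) i = 0).
Proof.
  destruct Hmu as [mu [Hmu1 [Hmu2 Hmu3]]].
  destruct Hlam as [Hl1 [_ Hnr]].
  assert (Hm : (0 < m)%nat) by (eapply opnorm_dim_pos; eauto).
  (* Independence excludes [d = 0]: since [m] is positive, coefficients all equal to 1 would give a
     vanishing combination. *)
  assert (Hd : (0 < d)%nat).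
  { destruct d as [|d']; [|lia]. exfalso.
    specialize (Hvind (fun _ => 1) ltac:(intros; lia) O Hm). lra. }
  (* The largest |lam j| is below 1 by stability; [normL] then enters only through [l <= normL], to
     compare [l ^ S r] with [mu]. *)
  set (l := supnorm m lam).
  assert (Hl : 0 <= l < 1).
  { split; [apply supnorm_nonneg|]. apply supnorm_lt; [lra|auto]. }
  assert (Hlj : forall j, (j < m)%nat -> Rabs (lam j) <= l) by (intros; now apply supnorm_ge).
  assert (Hlmu : l ^ S r <= mu).
  { assert (l <= normL).
    { apply supnorm_le.
      - pose proof (opnorm_diag m lam normL O HnormL Hm). pose proof (Rabs_pos (lam O)). lra.
      - intros j Hj. now apply opnorm_diag with m. }
    pose proof (pow_incr l normL r ltac:(lra)). pose proof (pow_le l r ltac:(lra)).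
    simpl. nra. }
  destruct (parameterization d N m r U Z B lam l v Hd Hr HUopen HU0 HZ HZ0 HB Hlj ltac:(lra) Hnr Hv
    B0inv _ HB0inv Hmu3) as [rho [P [Hrho [HC [HV HP]]]]].
  { intros a Ha. apply sumR_le. intros k Hk.
    pose proof (opnorm_row d _ _ a Hd (HnormB (S k) ltac:(lia)) Ha) as Hrow.
    assert (0 <= sumR d (fun b => Rabs (matmul d B0inv (B (S k)) a b))).
    { apply sumR_nonneg. intros; apply Rabs_pos. }
    rewrite (Nat.mul_comm (S k)), pow_mult, Rmult_comm.
    apply Rmult_le_compat; auto.
    - apply pow_le, pow_le; lra.
    - apply pow_incr. split; [apply pow_le; lra|auto]. }
  (* Halving the radius puts the closed disc inside an open ball on which [P] is C^r, so smoothness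
     holds up to the boundary. *)
  exists (rho / 2), (ball0 m rho), P. split; [lra|]. split; [apply ball0_open|].
  assert (Hin : forall z, supnorm m z <= rho / 2 -> ball0 m rho z) by (intros z Hz; unfold ball0; lra).
  split; [exact Hin|]. split; [exact HC|]. split; [|split].
  - intros i Hi. pose proof (bigO_at0 m 1 _ (HV i Hi)) as H0. cbv beta in H0.
    assert (linV m v zerov i = 0); [|lra].
    apply sumR_zero. intros j Hj. unfold zerov. ring.
  - intros i j Hi Hj. apply (derivative_of_linear_approximation m v i (fun z => P z i)); auto.
  - intros z Hz. exact (HP z (Hin z Hz)).
Qed.
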